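(* Let $\xi$ be a centered sub-Gaussian real random variable with unit variance. For each $n\ge 1$ let $W_n=(w_{ij})_{1\le i,j\le n}$ be an $n\times n$ real symmetric random matrix whose entries on and above the main diagonal, $(w_{ij})_{1\le i\le j\le n}$, are iid copies of $\xi$ (all $W_n$ being defined on a common probability space). For each $n$ let $\Sigma_n=(\sigma_{ij})_{1\le i,j\le n}$ be a (deterministic) symmetric matrix with non-negative entries such that $\sum_{j=1}^n\sigma_{ij}^2=1$ for every $i\in[n]$ (i.e. $(\sigma_{ij}^2)$ is doubly stochastic), and let $\sigma_n^*=\max_{1\le i,j\le n}\sigma_{ij}$. If $\sigma_n^*\sqrt{\log n}\to 0$ as $n\to\infty$, then $\|\Sigma_n\circ W_n\|\to 2$ almost surely, where $\circ$ denotes the entrywise (Hadamard) product and $\|\cdot\|$ the spectral norm.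
   Context: A random variable $\xi$ is sub-Gaussian if there is a constant $C$ with $\mathbb{E}e^{\lambda(\xi-\mathbb{E}\xi)}\le e^{C\lambda^2}$ for all $\lambda\in\mathbb{R}$. In particular the conclusion means that $\Sigma_n\circ W_n$ has no spectral outliers, i.e. no eigenvalues at non-vanishing distance outside $[-2,2]$. *)

(* Defs.v *)
From HB Require Import structures.
From mathcomp Require Import all_boot all_order all_algebra.
From mathcomp Require Import all_classical all_reals all_analysis.
Set Implicit Arguments. Unset Strict Implicit. Unset Printing Implicit Defensive.
Import Order.TTheory GRing.Theory Num.Theory.
Import numFieldNormedType.Exports.
Local Open Scope classical_set_scope.
Local Open Scope ring_scope.

Definition subgaussian d (T : measurableType d) (R : realType)
    (P : probability T R) (X : T -> R) : Prop :=
  exists C : R, forall l : R,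
    ('E_P[fun x => expR (l * (X x - fine 'E_P[X]))] <= (expR (C * l ^+ 2))%:E)%E.

Definition mutually_independent d (T : measurableType d) (R : realType)
    (P : probability T R) (I : finType) (A : {set I}) (X : I -> T -> R) : Prop :=
  forall J : {set I}, J \subset A ->
  forall B : I -> set R, (forall i, measurable (B i)) ->
    P (\bigcap_(i in [set i | i \in J]) (X i @^-1` B i))
    = (\prod_(i in J) P (X i @^-1` B i))%E.

Definition same_distribution d (T : measurableType d) (R : realType)
    (P : probability T R) (X Y : T -> R) : Prop :=
  forall B : set R, measurable B -> P (X @^-1` B) = P (Y @^-1` B).

Definition euclid_norm (R : realType) n (v : 'cV[R]_n) : R :=
  Num.sqrt (\sum_(i < n) v i ord0 ^+ 2).

Definition spectral_norm (R : realType) n (A : 'M[R]_n) : R :=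
  sup [set euclid_norm (A *m v) | v in [set v : 'cV[R]_n | euclid_norm v = 1]].

Definition hadamard (R : realType) n (A B : 'M[R]_n) : 'M[R]_n :=
  \matrix_(i, j) (A i j * B i j).

Definition max_entry (R : realType) n (A : 'M[R]_n) : R :=
  \big[Num.max/0]_(ij : 'I_n * 'I_n) A ij.1 ij.2.

(* Main.v *)
(* Write [X = Sigma o W] and expand powers of [X] over walks in the complete graph.

   Upper bound.  With [P] a power of two of order [log n], [E Tr X^P] is at most
   [4 n^4 (2 + ep)^P], and Markov's inequality applies.  To bound the trace, the moments of [xi]
   are dominated by those of [a + dv], where [a] is a sign and [dv] is a small perturbation with
   heavy enough moments, on a finite product space; norms and traces of the two parts are then
   separated.  Each part reduces to edge weights satisfying a Wick inequality (integration by
   parts).  For those the closed walk sums with several loops satisfy a recursion of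
   loop-equation type, and an explicit supersolution built from the normalised Catalan numbers
   dominates them by [(4 + O(al))^(P/2)] as soon as [P max sigma^2 <= al^2]; no counting of paths
   is needed.

   Lower bound.  Let [f_i] be the vector whose entry at [v] sums the edge products over the
   self-avoiding walks of length at most [K] from [i] to [v].  If [|X| <= th] then
   [\sum_i f_i^T (X - th) f_i <= 0].  Self-avoidance makes the expectation of the left side
   almost equal to [n (2 K - th (K + 1))], which is at least [n] for [th < 2] and [K] large; since
   its fourth central moment is [O(n^2)], the probability of the inequality is [O(n^-2)].

   Both estimates are summable, so Borel-Cantelli concludes. *)
Require Import Defs.
From HB Require Import structures.
From mathcomp Require Import all_boot all_order all_algebra.
From mathcomp Require Import all_classical all_reals all_analysis.
From mathcomp Require Import measurable_realfun.
From mathcomp Require Import ring lra zify.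
Set Implicit Arguments. Unset Strict Implicit. Unset Printing Implicit Defensive.
Import Order.TTheory GRing.Theory Num.Theory.
Import numFieldNormedType.Exports.
Local Open Scope ring_scope.

(** * Walk sums and formal derivatives *)

(** The Wick inequality asks for moments with [mu (m + 1) <= m * mu (m - 1)]. Signs and standard
    Gaussians satisfy it, but the moments of [xi] may be of size [(C sqrt m)^m] with a large [C],
    and rescaling by [C] would replace the limit 2 by a multiple of [C]. Hence the perturbation
    [dv]: it must have tiny variance and still dominate every moment of order at least 3. This is
    possible because a value [M] taken with probability [q] contributes [q M^2] to the variance but
    [q M^m] to the order [m]. Such a law violates the Wick inequality at its own variance, since [q]
    enters once per edge and not once per step. It is compared with a Gaussian times a Bernoulli
    mask, and the loop recursion is applied conditionally on the mask, whose row sums have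
    controlled moments. Every separation of parts costs a power of [n]. This is harmless: [P] is a
    large multiple of [log n], so a fixed ratio below 1 to the power [P] beats any power of [n]. In
    the lower bound a variance of order [n] would only give probability [1 / n], which is not
    summable; hence the fourth moment. *)

Definition edge n (u v : 'I_n) : 'I_n * 'I_n := if (u <= v)%N then (u, v) else (v, u).

Lemma edgeC n (u v : 'I_n) : edge u v = edge v u.
Proof.
rewrite /edge; case: ltngtP => // h.
by have -> : u = v by apply: val_inj.
Qed.

Lemma edge_eq n (u v x y : 'I_n) :
  edge x y = edge u v -> (x = u /\ y = v) \/ (x = v /\ y = u).
Proof. by rewrite /edge; case: ifP => _; case: ifP => _ [-> ->]; tauto. Qed.

Lemma edge_le n (u v : 'I_n) : ((edge u v).1 <= (edge u v).2)%N.
Proof. by rewrite /edge; case: ifP => //= /negbT; rewrite -ltnNge => /ltnW. Qed.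

(** Only an inequality: for [u = v] the two orientations coincide and the right side counts them
    twice. *)
Lemma edge_indicator (R : numDomainType) n (u v x y : 'I_n) :
  ((edge x y == edge u v)%:R : R) <=
    ((x == v) && (y == u))%:R + ((x == u) && (y == v))%:R.
Proof.
case: eqP => [/edge_eq[[-> ->]|[-> ->]]|_]; rewrite ?eqxx /=.
- by rewrite lerDr ler0n.
- by rewrite lerDl ler0n.
- by rewrite addr_ge0 ?ler0n.
Qed.

Section Walks.
Variables (R : realFieldType) (n : nat).
Local Notation E := ('I_n * 'I_n)%type.
Implicit Types (f g : seq E -> R) (u v x y : 'I_n) (l : seq E).

(** [f] receives the list of traversed edges. It need not factor over the edges, as it will be a
    joint moment; and nested walk sums can be joined or exchanged. *)
Fixpoint walks k u v f : R :=
  if k is k'.+1 then \sum_x walks k' x v (fun l => f (edge u x :: l))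
  else if u == v then f [::] else 0.

Lemma eq_walks k u v f g : f =1 g -> walks k u v f = walks k u v g.
Proof.
elim: k u f g => [|k IH] u f g fg /=; first by rewrite fg.
by apply: eq_bigr => x _; apply: IH => l; exact: fg.
Qed.

Lemma walks_size k u v f : walks k u v f = walks k u v (fun l => f l *+ (size l == k)).
Proof.
elim: k u f => [|k IH] u f //=.
by apply: eq_bigr => x _; rewrite IH [RHS]IH; apply: eq_walks => l /=; case: eqP => // ->; rewrite eqxx.
Qed.

Lemma eq_walks_size k u v f g :
  (forall l, size l = k -> f l = g l) -> walks k u v f = walks k u v g.
Proof.
move=> fg; rewrite walks_size [RHS]walks_size; apply: eq_walks => l.
by case: eqP => // /fg ->.
Qed.

Lemma le_walks k u v f g : (forall l, f l <= g l) -> walks k u v f <= walks k u v g.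
Proof.
elim: k u f g => [|k IH] u f g fg /=; first by case: ifP.
by apply: ler_sum => x _; apply: IH => l; exact: fg.
Qed.

Lemma walks0 k u v : walks k u v (fun=> 0) = 0.
Proof. by elim: k u => [|k IH] u /=; [case: ifP|rewrite big1]. Qed.

Lemma walks_ge0 k u v f : (forall l, 0 <= f l) -> 0 <= walks k u v f.
Proof. by move=> f0; rewrite -(walks0 k u v); exact: le_walks. Qed.

Lemma walksM c k u v f : walks k u v (fun l => c * f l) = c * walks k u v f.
Proof.
elim: k u f => [|k IH] u f /=; first by case: ifP; rewrite ?mulr0.
by rewrite mulr_sumr; apply: eq_bigr => x _; rewrite IH.
Qed.

Lemma walks_sum I (r : seq I) (P : pred I) k u v (F : I -> seq E -> R) :
  walks k u v (fun l => \sum_(i <- r | P i) F i l) =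
  \sum_(i <- r | P i) walks k u v (F i).
Proof.
elim: k u F => [|k IH] u F /=; first by case: ifP => // _; rewrite big1.
by under eq_bigr do rewrite IH; rewrite exchange_big.
Qed.

Lemma walksD k u v f g :
  walks k u v (fun l => f l + g l) = walks k u v f + walks k u v g.
Proof.
elim: k u f g => [|k IH] u f g /=; first by case: ifP => //; rewrite addr0.
by under eq_bigr do rewrite IH; rewrite big_split.
Qed.

Lemma walks_cat a b u v f :
  walks (a + b) u v f =
  \sum_x walks a u x (fun l1 => walks b x v (fun l2 => f (l1 ++ l2))).
Proof.
elim: a u f => [|a IH] u f /=.
  rewrite (bigD1 u) //= eqxx big1 ?addr0; first by apply: eq_walks.
  by move=> x; rewrite eq_sym => /negPf ->.
by rewrite exchange_big; apply: eq_bigr => x _; rewrite IH.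
Qed.

Lemma walks_rcons k u v f :
  walks k.+1 u v f = \sum_x walks k u x (fun l => f (rcons l (edge x v))).
Proof.
rewrite -addn1 walks_cat; apply: eq_bigr => x _; apply: eq_walks => l /=.
rewrite (bigD1 v) //= eqxx big1 ?addr0 ?cats1 // => y.
by move=> /negPf ->.
Qed.

Definition perm_inv (f : seq E -> R) := forall l l', perm_eq l l' -> f l = f l'.

(** Edges are undirected, so reversing a walk only permutes its list. Moments depend on the multiset
    of edges alone, which is what [perm_inv] records. *)
Lemma walks_rev k u v f : perm_inv f -> walks k u v f = walks k v u f.
Proof.
elim: k u v f => [|k IH] u v f pf; first by rewrite /= eq_sym.
rewrite walks_rcons /=; apply: eq_bigr => x _.
rewrite IH; last by move=> l l' p; apply: pf; rewrite -!cats1 perm_cat2r.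
apply: eq_walks => l; rewrite edgeC; apply: pf.
by rewrite perm_rcons.
Qed.

Lemma perm_inv_catl f m : perm_inv f -> perm_inv (fun l => f (m ++ l)).
Proof. by move=> pf l l' p; apply: pf; rewrite perm_cat2l. Qed.

(* [hit e l g] sums [g] over the lists obtained from [l] by deleting one
   occurrence of [e]: the formal derivative in the variable [e]. *)
Fixpoint hit (e : E) l (g : seq E -> R) : R :=
  if l is a :: l' then (a == e)%:R * g l' + hit e l' (fun m => g (a :: m)) else 0.

Lemma eq_hit e l f g : f =1 g -> hit e l f = hit e l g.
Proof.
elim: l f g => [|a l IH] f g fg //=; rewrite fg; congr (_ + _).
by apply: IH => m; exact: fg.
Qed.

Lemma hit_ge0 e l g : (forall m, 0 <= g m) -> 0 <= hit e l g.
Proof.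
elim: l g => [|a l IH] g g0 //=.
by rewrite addr_ge0 ?mulr_ge0 ?ler0n //; apply: IH => m; exact: g0.
Qed.

Lemma hit_cat e l1 l2 g : hit e (l1 ++ l2) g =
  hit e l1 (fun m => g (m ++ l2)) + hit e l2 (fun m => g (l1 ++ m)).
Proof. by elim: l1 g => [|a l IH] g /=; rewrite ?add0r // IH addrA. Qed.

Lemma hit_size e l g c : hit e l (fun m => c ^+ (size m) * g m) * c = c ^+ size l * hit e l g.
Proof.
elim: l g c => [|a l IH] g c /=; first by rewrite mul0r mulr0.
rewrite mulrDl mulrDr; congr (_ + _).
  by rewrite exprS; ring.
have -> : hit e l (fun m => c ^+ (size m).+1 * g (a :: m)) =
  hit e l (fun m => c ^+ size m * (c * g (a :: m))).
  by apply: eq_hit => m; rewrite exprS; ring.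
rewrite IH exprS.
have H h d : hit e l (fun m => d * h m) = d * hit e l h.
  elim: (l) h => [|b l' IH'] h /=; first by rewrite mulr0.
  by rewrite IH'; ring.
by rewrite H; ring.
Qed.

Lemma hit_perm_inv e l g : perm_inv g ->
  hit e l g = (count_mem e l)%:R * g (rem e l).
Proof.
elim: l g => [|a l IH] g pg /=; first by rewrite mul0r.
rewrite IH; last by move=> m m' p; apply: pg; rewrite perm_cons.
case: eqP => [->|_] /=; last by rewrite mul0r !add0r.
rewrite mul1r natrD mulrDl mul1r; congr (_ + _).
have [el|el] := boolP (e \in l); last by rewrite (count_memPn el) !mul0r.
by congr (_ * _); apply: pg; rewrite perm_sym; exact: perm_to_rem.
Qed.

(** Product rule: the deleted occurrence is step number [a], and it cuts the walk into pieces of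
    lengths [a] and [k - 1 - a]. *)
Lemma walks_hit k u v e g : walks k u v (fun l => hit e l g) =
  \sum_(a < k) \sum_x \sum_y (edge x y == e)%:R *
     walks a u x (fun l1 => walks (k.-1 - a) y v (fun l2 => g (l1 ++ l2))).
Proof.
elim: k u g => [|k IH] u g; first by rewrite big_ord0 /=; case: ifP.
rewrite big_ord_recl /= subn0.
under eq_bigr => x _ do rewrite walksD walksM IH.
rewrite big_split /=; congr (_ + _).
  rewrite [RHS](bigD1 u) //= [X in _ = _ + X]big1 ?addr0; last first.
    by move=> x; rewrite eq_sym => /negPf xu; rewrite big1 // => y _; rewrite xu mulr0.
  by apply: eq_bigr => x _; rewrite eqxx.
rewrite exchange_big; apply: eq_bigr => a _ /=; rewrite exchange_big.
apply: eq_bigr => x _ /=; rewrite exchange_big; apply: eq_bigr => y _ /=.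
rewrite mulr_sumr; apply: eq_bigr => z _.
congr (_ * _); apply: eq_walks => l1; congr walks.
by case: k a {IH} => [[]|k a] //=; rewrite bump0; lia.
Qed.

End Walks.

(** * The loop equation for chains of closed walks *)

Section Loop.
Variables (R : realFieldType) (n : nat).
Local Notation E := ('I_n * 'I_n)%type.
Implicit Types (f g : seq E -> R) (u v x y : 'I_n) (l : seq E) (w : 'I_n -> R).

Lemma walks_swap k u v k' u' v' (F : seq E -> seq E -> R) :
  walks k u v (fun l => walks k' u' v' (F l)) =
  walks k' u' v' (fun l' => walks k u v (fun l => F l l')).
Proof.
elim: k u F => [|k IH] u F /=; first by case: ifP => // _; rewrite walks0.
by rewrite walks_sum; apply: eq_bigr => x _; rewrite IH.
Qed.

Lemma sum_edge_le (T : 'I_n -> 'I_n -> R) x y : (forall a b, 0 <= T a b) ->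
  \sum_a \sum_b (edge a b == edge x y)%:R * T a b <= T y x + T x y.
Proof.
move=> T0; have H (a b : 'I_n) : T a b = \sum_z \sum_z' ((z == a) && (z' == b))%:R * T z z'.
  rewrite (bigD1 a) //= (bigD1 b) //= !eqxx mul1r !big1 ?addr0 //.
    by move=> z /negPf za; rewrite big1 // => z' _; rewrite za mul0r.
  by move=> z' /negPf zb; rewrite zb mul0r.
rewrite (H y x) (H x y) -big_split /=; apply: ler_sum => a _.
rewrite -big_split /=; apply: ler_sum => b _; rewrite -mulrDl ler_wpM2r //.
exact: edge_indicator.
Qed.

(** Deleting an occurrence of the edge [x y] opens the loop at [t], and the walk from [y] to [x]
    fills the gap, after reversal if needed. The factor counts [m] positions and two
    orientations. *)
Lemma walks_hit_le k m t g : perm_inv g -> (forall l, 0 <= g l) ->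
  \sum_x \sum_y walks k y x (fun l1 => walks m t t
     (fun l => hit (edge x y) l (fun l' => g (l1 ++ l')))) <=
  (2 * m)%:R * walks (m + k - 1) t t g.
Proof.
move=> pg g0.
pose T a x y z z' := walks k y x (fun l1 => walks a t z
  (fun l2 => walks (m.-1 - a) z' t (fun l3 => g (l1 ++ (l2 ++ l3))))).
have T0 a x y z z' : 0 <= T a x y z z'.
  by do 3 apply: walks_ge0 => ?.
have -> : \sum_x \sum_y walks k y x (fun l1 => walks m t t
     (fun l => hit (edge x y) l (fun l' => g (l1 ++ l')))) =
  \sum_x \sum_y \sum_(a < m) \sum_z \sum_z' (edge z z' == edge x y)%:R * T a x y z z'.
  apply: eq_bigr => x _; apply: eq_bigr => y _.
  under eq_walks do rewrite walks_hit.
  rewrite walks_sum; apply: eq_bigr => a _; rewrite walks_sum.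
  apply: eq_bigr => z _; rewrite walks_sum; apply: eq_bigr => z' _.
  by rewrite walksM.
apply: (@le_trans _ _ (\sum_(a < m) (\sum_x \sum_y (T a x y y x + T a x y x y)))).
  rewrite [leRHS]exchange_big; apply: ler_sum => x _.
  rewrite [leRHS]exchange_big; apply: ler_sum => y _.
  by apply: ler_sum => a _; exact: sum_edge_le.
have -> : (2 * m)%:R * walks (m + k - 1) t t g =
   \sum_(a < m) (walks (m + k - 1) t t g + walks (m + k - 1) t t g).
  by rewrite sumr_const card_ord -mulr2n -mulrnA mulr_natl mulnC.
apply: ler_sum => a _.
have am := ltn_ord a.
have eqn : (m + k - 1 = a + (k + (m.-1 - a)))%N by lia.
have key x y : T a x y y x = walks a t y (fun l2 => walks k y x (fun l1 =>
      walks (m.-1 - a) x t (fun l3 => g (l2 ++ (l1 ++ l3))))).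
  rewrite /T walks_swap; apply: eq_walks => l2; apply: eq_walks => l1.
  by apply: eq_walks => l3; apply: pg; rewrite perm_catCA.
have key2 x y : T a x y x y = walks a t x (fun l2 => walks k x y (fun l1 =>
      walks (m.-1 - a) y t (fun l3 => g (l2 ++ (l1 ++ l3))))).
  rewrite /T walks_swap; apply: eq_walks => l2.
  rewrite walks_rev; last first.
    move=> l l' p; apply: eq_walks => l3; apply: pg.
    by rewrite perm_cat2r.
  apply: eq_walks => l1.
  by apply: eq_walks => l3; apply: pg; rewrite perm_catCA.
have S1 : \sum_x \sum_y T a x y y x = walks (m + k - 1) t t g.
  rewrite eqn walks_cat exchange_big; apply: eq_bigr => y _.
  under eq_walks do rewrite walks_cat.
  by rewrite walks_sum; apply: eq_bigr => x _; rewrite key.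
have S2 : \sum_x \sum_y T a x y x y = walks (m + k - 1) t t g.
  rewrite eqn walks_cat; apply: eq_bigr => y _.
  under eq_walks do rewrite walks_cat.
  by rewrite walks_sum; apply: eq_bigr => x _; rewrite key2.
by under eq_bigr do rewrite big_split /=; rewrite big_split /= S1 S2.
Qed.

Variable s2 : E -> R.

(* Closed walks of lengths [ns] rooted at the successive vertices of a path,
   each step of the path being weighted by [s2]. *)
Fixpoint chain w (ns : seq nat) f : R :=
  if ns is m :: ns' then \sum_x w x * walks m x x (fun l =>
    chain (fun y => s2 (edge x y)) ns' (fun l' => f (l ++ l')))
  else f [::].

Hypothesis s2_ge0 : forall e, 0 <= s2 e.

Lemma eq_chain w ns f g : f =1 g -> chain w ns f = chain w ns g.
Proof.
elim: ns w f g => [|m ns IH] w f g fg /=; first exact: fg.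
apply: eq_bigr => x _; congr (_ * _); apply: eq_walks => l; apply: IH => l'.
exact: fg.
Qed.

Lemma le_chain w ns f g : (forall x, 0 <= w x) -> (forall l, f l <= g l) ->
  chain w ns f <= chain w ns g.
Proof.
elim: ns w f g => [|m ns IH] w f g w0 fg /=; first exact: fg.
apply: ler_sum => x _; rewrite ler_wpM2l //; apply: le_walks => l.
by apply: IH => // l'; exact: fg.
Qed.

Lemma chain0 w ns : chain w ns (fun=> 0) = 0.
Proof.
elim: ns w => [|m ns IH] w //=; rewrite big1 // => x _.
by under eq_walks do rewrite IH; rewrite walks0 mulr0.
Qed.

Lemma chain_ge0 w ns f : (forall x, 0 <= w x) -> (forall l, 0 <= f l) -> 0 <= chain w ns f.
Proof. by move=> w0 f0; rewrite -(chain0 w ns); exact: le_chain. Qed.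

Lemma chainM w ns c f : chain w ns (fun l => c * f l) = c * chain w ns f.
Proof.
elim: ns w f => [|m ns IH] w f //=; rewrite mulr_sumr; apply: eq_bigr => x _.
by under eq_walks do rewrite IH; rewrite walksM; ring.
Qed.

Lemma chainD w ns f g : chain w ns (fun l => f l + g l) = chain w ns f + chain w ns g.
Proof.
elim: ns w f g => [|m ns IH] w f g //=; rewrite -big_split /=; apply: eq_bigr => x _.
by under eq_walks do rewrite IH; rewrite walksD; ring.
Qed.

Lemma chain_hit w ns e l (F : seq E -> seq E -> R) :
  chain w ns (fun l' => hit e l (fun m => F m l')) = hit e l (fun m => chain w ns (F m)).
Proof.
elim: l F => [|a l IH] F /=; first by rewrite chain0.
by rewrite chainD chainM IH.
Qed.

Lemma perm_inv_chain w ns f : perm_inv f ->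
  perm_inv (fun l => chain w ns (fun l' => f (l ++ l'))).
Proof. by move=> pf l m lm; apply: eq_chain => l'; apply: pf; rewrite perm_cat2r. Qed.

(** The merging term of the loop equation: in one of the loops, of length [m], one of the [m] edges
    is replaced by a walk of length [k], in either orientation. *)
Fixpoint bumps k (ns : seq nat) (F : seq nat -> R) : R :=
  if ns is m :: ns' then (2 * m)%:R * F ((m + k - 1)%N :: ns') +
     bumps k ns' (fun ns'' => F (m :: ns''))
  else 0.

Lemma eq_bumps k ns F G : F =1 G -> bumps k ns F = bumps k ns G.
Proof.
elim: ns F G => [|m ns IH] F G FG //=; rewrite FG; congr (_ + _).
by apply: IH => ?; exact: FG.
Qed.

Lemma bumpsM k ns c F : bumps k ns (fun a => c * F a) = c * bumps k ns F.
Proof. by elim: ns F => [|m ns IH] F /=; rewrite ?mulr0 // IH; ring. Qed.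

Lemma bumps_sum k ns (F : 'I_n -> seq nat -> R) :
  bumps k ns (fun a => \sum_x F x a) = \sum_x bumps k ns (F x).
Proof.
elim: ns F => [|m ns IH] F /=; first by rewrite big1.
by rewrite IH big_split /= mulr_sumr.
Qed.

Lemma bumps_walks k ns m u v (F : seq E -> seq nat -> R) :
  walks m u v (fun l => bumps k ns (F l)) = bumps k ns (fun a => walks m u v (F^~ a)).
Proof.
elim: ns F => [|m' ns IH] F /=; first by rewrite walks0.
by rewrite walksD walksM IH.
Qed.

Lemma chain_hit_le k w ns f : (forall x, 0 <= w x) -> perm_inv f -> (forall l, 0 <= f l) ->
  \sum_x \sum_y walks k y x (fun l1 => chain w ns
     (fun l => hit (edge x y) l (fun l' => f (l1 ++ l')))) <=
  bumps k ns (fun a => chain w a f).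
Proof.
elim: ns w f => [|m ns IH] w f w0 pf f0 /=.
  by rewrite big1 // => x _; rewrite big1 // => y _; rewrite walks0.
pose sx x y := s2 (edge x y).
pose g t l := chain (sx t) ns (fun l' => f (l ++ l')).
have pg t : perm_inv (g t) by exact: perm_inv_chain.
have g0 t l : 0 <= g t l by apply: chain_ge0 => // y; exact: s2_ge0.
have -> : \sum_x \sum_y walks k y x (fun l1 => \sum_t w t * walks m t t (fun l =>
     chain (sx t) ns (fun l' => hit (edge x y) (l ++ l') (fun m' => f (l1 ++ m'))))) =
  \sum_t w t * (\sum_x \sum_y walks k y x (fun l1 => walks m t t (fun l =>
     hit (edge x y) l (fun m' => g t (l1 ++ m'))))) +
  \sum_t w t * walks m t t (fun l => \sum_x \sum_y walks k y x (fun l1 =>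
     chain (sx t) ns (fun l' => hit (edge x y) l' (fun m' => f (l ++ (l1 ++ m')))))).
  rewrite -big_split /=.
  under eq_bigr => x _ do under eq_bigr => y _ do rewrite walks_sum.
  under eq_bigr => x _ do rewrite exchange_big /=.
  rewrite exchange_big /=; apply: eq_bigr => t _.
  rewrite -mulrDr walks_sum -big_split /= mulr_sumr; apply: eq_bigr => x _.
  rewrite walks_sum -big_split /= mulr_sumr; apply: eq_bigr => y _.
  rewrite walksM; congr (_ * _); rewrite [X in _ = _ + X]walks_swap -walksD.
  apply: eq_walks => l1; rewrite -walksD; apply: eq_walks => l.
  rewrite /g -chain_hit -chainD; apply: eq_chain => l'.
  rewrite hit_cat; congr (_ + _); apply: eq_hit => m'.
    by rewrite catA.
  by apply: pf; rewrite perm_catCA.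
apply: lerD.
  rewrite mulr_sumr; apply: ler_sum => t _.
  rewrite mulrCA ler_wpM2l //; exact: walks_hit_le.
rewrite bumps_sum; apply: ler_sum => t _.
rewrite bumpsM ler_wpM2l // -bumps_walks; apply: le_walks => l.
apply: IH; first by move=> y; exact: s2_ge0.
- exact: perm_inv_catl.
- by move=> l'; exact: f0.
Qed.

Variables (q : R) (f : seq E -> R).
Hypotheses (s2_le : forall e, s2 e <= q) (s2_row : forall u, \sum_x s2 (edge u x) <= 1).
Hypotheses (pf : perm_inv f) (f_ge0 : forall l, 0 <= f l)
  (f_wick : forall e l, f (e :: l) <= s2 e * hit e l f).

Definition ztr ns := chain (fun=> 1) ns f.

Lemma ztr0 : ztr [:: 0%N] = n%:R * f [::].
Proof.
rewrite /ztr /=; under eq_bigr do rewrite eqxx mul1r.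
by rewrite sumr_const card_ord mulr_natl.
Qed.

(** A trivial first loop leaves only the weights of the links from its root to the next loop, and
    these add up to a row sum of [s2]. *)
Lemma ztr_pop m ns : ztr (0%N :: m :: ns) <= ztr (m :: ns).
Proof.
rewrite /ztr /=; under eq_bigr do rewrite eqxx mul1r.
rewrite exchange_big /=; apply: ler_sum => y _.
rewrite -mulr_suml ler_wpM2r //.
  by apply: walks_ge0 => l; apply: chain_ge0 => // x.
by under eq_bigr do rewrite edgeC; exact: s2_row.
Qed.

Lemma ztr_walk m : ztr [:: m] = \sum_x walks m x x f.
Proof.
apply: eq_bigr => x _; rewrite mul1r; apply: eq_walks => l /=.
by rewrite cats0.
Qed.

Lemma chain_le1 x m ns g : (forall l, 0 <= g l) ->
  chain (fun y => s2 (edge x y)) (m :: ns) g <= q * chain (fun=> 1) (m :: ns) g.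
Proof.
move=> g0 /=; rewrite mulr_sumr; apply: ler_sum => y _.
rewrite mul1r ler_wpM2r //; apply: walks_ge0 => l; exact: chain_ge0.
Qed.

(** The Wick inequality pairs the first step [x y] with another occurrence of its edge. Inside the
    first loop, a backward occurrence splits it into two loops linked by [s2]; a forward one, after
    reversal of a piece, leaves one loop of length [k - 1] and a weight [s2 <= q]. In a later loop
    the two loops merge; the weights of the step and of the first link are each bounded by [q],
    hence [q ^+ 2]. *)
Lemma ztr_rec k ns : ztr (k.+1 :: ns) <=
  \sum_(a < k) ztr (nat_of_ord a :: (k.-1 - a)%N :: ns) + k%:R * q * ztr (k.-1 :: ns)
  + q ^+ 2 * bumps k ns ztr.
Proof.
pose sx x y := s2 (edge x y).
pose g t l := chain (sx t) ns (fun l' => f (l ++ l')).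
have pg t : perm_inv (g t) by exact: perm_inv_chain.
have g0 t l : 0 <= g t l by apply: chain_ge0 => // y; exact: s2_ge0.
apply: (@le_trans _ _ (
  \sum_x \sum_y s2 (edge x y) * walks k y x (fun l => hit (edge x y) l (g x)) +
  \sum_x \sum_y s2 (edge x y) * walks k y x (fun l => chain (sx x) ns
      (fun l' => hit (edge x y) l' (fun m => f (l ++ m)))))).
  rewrite -big_split /=; apply: ler_sum => x _; rewrite mul1r.
  rewrite -big_split /=; apply: ler_sum => y _.
  rewrite -mulrDr -walksD -walksM; apply: le_walks => l.
  rewrite /g -chain_hit -chainD -chainM; apply: le_chain; first by move=> z; exact: s2_ge0.
  move=> l'; rewrite -hit_cat; exact: f_wick.
apply: lerD; last first.
  case: ns @g pg g0 => [|m ns] g pg g0.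
    rewrite /= mulr0 big1 // => x _; rewrite big1 // => y _.
    by rewrite walks0 mulr0.
  apply: (@le_trans _ _ (q ^+ 2 * \sum_x \sum_y walks k y x (fun l => chain (fun=> 1) (m :: ns)
      (fun l' => hit (edge x y) l' (fun m => f (l ++ m)))))); last first.
    rewrite ler_wpM2l ?sqr_ge0 //; exact: chain_hit_le.
  rewrite mulr_sumr; apply: ler_sum => x _; rewrite mulr_sumr; apply: ler_sum => y _.
  rewrite expr2 -mulrA; apply: ler_pM => //.
    by apply: walks_ge0 => l; apply: chain_ge0 => [z|l']; [exact: s2_ge0|exact: hit_ge0].
  rewrite -walksM; apply: le_walks => l; apply: chain_le1 => l'; exact: hit_ge0.
(* [T a x y y x] is the backward occurrence, [T a x y x y] the forward one. *)
pose T a x y z z' := walks a y z (fun l1 => walks (k.-1 - a) z' x (fun l2 => g x (l1 ++ l2))).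
have T0 a x y z z' : 0 <= T a x y z z' by do 2 apply: walks_ge0 => ?.
apply: (@le_trans _ _ (\sum_(a < k) (\sum_x \sum_y s2 (edge x y) * T a x y y x +
    \sum_x \sum_y s2 (edge x y) * T a x y x y))).
  under [leRHS]eq_bigr => a _ do rewrite -big_split /=.
  rewrite [leRHS]exchange_big; apply: ler_sum => x _.
  under [leRHS]eq_bigr => a _ do rewrite -big_split /=.
  rewrite [leRHS]exchange_big; apply: ler_sum => y _.
  under [leRHS]eq_bigr => a _ do rewrite -mulrDr.
  rewrite -mulr_sumr ler_wpM2l // walks_hit.
  by apply: ler_sum => a _; exact: (@sum_edge_le (T a x y) x y).
rewrite big_split /=; apply: lerD.
  apply: ler_sum => a _; rewrite /ztr [leRHS]/= exchange_big /=.
  apply: ler_sum => y _; rewrite mul1r walks_sum; apply: ler_sum => x _.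
  rewrite walksM [edge y x]edgeC /T /g le_eqVlt; apply/orP; left; apply/eqP.
  congr (_ * _); apply: eq_walks => l; apply: eq_walks => l0; apply: eq_chain => l'.
  by rewrite catA.
have -> : k%:R * q * ztr (k.-1 :: ns) = \sum_(a < k) q * ztr (k.-1 :: ns).
  by rewrite sumr_const card_ord -mulrA mulr_natl.
apply: ler_sum => a _.
rewrite /ztr [in leRHS]/= mulr_sumr; apply: ler_sum => x _.
have ak := ltn_ord a.
have -> : k.-1 = (a + (k.-1 - a))%N by lia.
rewrite mul1r walks_cat mulr_sumr; apply: ler_sum => y _.
apply: ler_pM => //; rewrite /T walks_rev //.
by move=> l l' p; apply: eq_walks => l2; apply: pg; rewrite perm_cat2r.
Qed.

End Loop.

(** * The recursion for closed walk sums *)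

Section CentralBinomial.
Variable R : realFieldType.

Fixpoint dd k : R := if k is k'.+1 then dd k' * ((2 * k'%:R + 1) / (2 * k'%:R + 2)) else 1.

(* Normalised Catalan numbers [C_k / 4 ^ k]; [dd k] is [binom(2k, k) / 4 ^ k]. *)
Definition cc k : R := 2 * (dd k - dd k.+1).

Lemma dd_gt0 k : 0 < dd k.
Proof. by elim: k => [|k IH] //=; rewrite mulr_gt0 ?divr_gt0 //; have := ler0n R k; lra. Qed.

Lemma ddS k : (2 * k%:R + 2) * dd k.+1 = (2 * k%:R + 1) * dd k.
Proof. by rewrite /=; field; have := ler0n R k; lra. Qed.

Lemma dd_le k : dd k.+1 <= dd k.
Proof.
have := dd_gt0 k; have := ddS k.
have : 0 <= k%:R :> R by exact: ler0n.
nra.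
Qed.

Lemma dd_anti k l : (k <= l)%N -> dd l <= dd k.
Proof.
move=> /subnKC <-; elim: (l - k)%N => [|m IH]; first by rewrite addn0.
by rewrite addnS (le_trans (dd_le _)).
Qed.

Lemma dd_le2 k : dd k <= 2 * dd k.+1.
Proof.
have := dd_gt0 k.+1; have := dd_gt0 k; have := ddS k.
have : 0 <= k%:R :> R by exact: ler0n.
nra.
Qed.

Lemma cc_dd k : k.+1%:R * cc k = dd k.
Proof.
rewrite /cc; have := ddS k; rewrite -natr1 => h.
suff : 2 * k%:R * dd k.+1 + 2 * dd k.+1 = 2 * k%:R * dd k + dd k by lra.
by lra.
Qed.

Lemma cc_gt0 k : 0 < cc k.
Proof. by have := dd_gt0 k; rewrite -cc_dd pmulr_rgt0 ?ltr0Sn. Qed.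

Lemma ccS k : (k%:R + 2) * 2 * cc k.+1 = (2 * k%:R + 1) * cc k.
Proof.
have := cc_dd k; have := cc_dd k.+1; have := ddS k.
rewrite -!natr1 => h h1 h2.
have k0 : 0 <= k%:R :> R by exact: ler0n.
have nz : k%:R + 1 != 0 :> R by rewrite lt0r_neq0 //; lra.
apply: (mulfI nz).
by rewrite -h1 -h2 in h; lra.
Qed.

Lemma cc_le k : cc k.+1 <= cc k.
Proof.
have := cc_gt0 k; have := ccS k.
have : 0 <= k%:R :> R by exact: ler0n.
nra.
Qed.

Lemma cc_le4 k : cc k <= 4 * cc k.+1.
Proof.
have := cc_gt0 k; have := cc_gt0 k.+1; have := ccS k.
have : 0 <= k%:R :> R by exact: ler0n.
nra.
Qed.

Lemma cc_anti k l : (k <= l)%N -> cc l <= cc k.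
Proof.
move=> /subnKC <-; elim: (l - k)%N => [|m IH]; first by rewrite addn0.
by rewrite addnS (le_trans (cc_le _)).
Qed.

Lemma cc_le_inv k : k.+1%:R * cc k <= 1.
Proof. by rewrite cc_dd; exact: (dd_anti (leq0n k)). Qed.

Lemma dd_lower k : 1 <= (4 * k%:R + 1) * dd k ^+ 2.
Proof.
elim: k => [|k IH]; first by rewrite /= expr1n mulr1 mulr0 add0r.
have := ddS k; have := dd_gt0 k.+1; have := dd_gt0 k; move: IH.
rewrite -[k.+1%:R]natr1.
have : 0 <= k%:R :> R by exact: ler0n.
move: (dd k) (dd k.+1) (k%:R) => a b x x0 h a0 b0 e.
have h1 : (2 * x + 2) ^+ 2 * b ^+ 2 = (2 * x + 1) ^+ 2 * a ^+ 2 by rewrite -!exprMn e.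
have h2 : 0 <= ((4 * x + 1) * a ^+ 2 - 1) * ((2 * x + 1) ^+ 2 * (4 * x + 5)).
  by rewrite mulr_ge0 // ?subr_ge0 // mulr_ge0 ?sqr_ge0 //; lra.
have h3 : 0 < (2 * x + 2) ^+ 2 * (4 * x + 1) by rewrite mulr_gt0 ?exprn_gt0 //; lra.
rewrite -(ler_pM2l h3).
have -> : (2 * x + 2) ^+ 2 * (4 * x + 1) * ((4 * (x + 1) + 1) * b ^+ 2) =
  (4 * x + 1) * (4 * x + 5) * ((2 * x + 2) ^+ 2 * b ^+ 2) by ring.
rewrite h1.
have -> : (4 * x + 1) * (4 * x + 5) * ((2 * x + 1) ^+ 2 * a ^+ 2) =
  ((4 * x + 1) * a ^+ 2 - 1) * ((2 * x + 1) ^+ 2 * (4 * x + 5)) + (2 * x + 1) ^+ 2 * (4 * x + 5) by ring.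
(* What remains is [(2 x + 2)^2 (4 x + 1) <= (2 x + 1)^2 (4 x + 5)], whose sides differ by exactly
   1. *)
nra.
Qed.

Lemma sum_dd k : \sum_(j < k) dd j = 2 * k%:R * dd k.
Proof.
elim: k => [|k IH]; first by rewrite big_ord0 mulr0 mul0r.
rewrite big_ord_recr IH -[k.+1%:R]natr1; have := ddS k => h.
transitivity ((2 * k%:R + 2) * dd k.+1); last by ring.
by rewrite h /=; ring.
Qed.

Lemma sum_cc k : \sum_(j < k) cc j = 2 * (1 - dd k).
Proof.
elim: k => [|k IH]; first by rewrite big_ord0 subrr mulr0.
by rewrite big_ord_recr IH /cc /=; ring.
Qed.

(** The generating function of [dd] is [(1 - z)^(-1/2)], with square [1 / (1 - z)]. The proof
    weights the sum by the index, symmetrises, and applies the recursion of [dd]. *)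
Lemma dd_conv m : \sum_(i < m.+1) dd i * dd (m - i) = 1.
Proof.
pose S m := \sum_(i < m.+1) dd i * dd (m - i).
have sym m' : 2 * \sum_(i < m'.+1) i%:R * (dd i * dd (m' - i)) = m'%:R * S m'.
  rewrite mulr_natl mulr2n {2}(reindex_inj rev_ord_inj) -big_split /= mulr_sumr.
  apply: eq_bigr => i _; rewrite subSS subKn; last by rewrite -ltnS.
  by rewrite [dd (m' - i) * _]mulrC -mulrDl -natrD subnKC // -ltnS.
elim: m => [|m IH]; first by rewrite big_ord_recl big_ord0 /= mulr1 addr0.
suff : m.+1%:R * S m.+1 = m.+1%:R * S m.
  by move/mulfI => H; rewrite -IH; apply: H; rewrite pnatr_eq0.
rewrite -sym big_ord_recl mul0r add0r mulr_sumr.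
transitivity (2 * (\sum_(i < m.+1) i%:R * (dd i * dd (m - i))) + S m).
  rewrite mulr_sumr -big_split /=; apply: eq_bigr => i _.
  rewrite -/(dd i) subSS -/(dd i.+1) /bump /= add1n.
  have h := ddS i; rewrite -[i.+1%:R]natr1.
  transitivity ((2 * i%:R + 2) * dd i.+1 * dd (m - i)); first by rewrite /=; ring.
  by rewrite h; ring.
by rewrite sym -[m.+1%:R]natr1; ring.
Qed.

Lemma cd_conv m : \sum_(i < m.+1) cc i * dd (m - i) = 2 * dd m.+1.
Proof.
have := dd_conv m.+1; rewrite big_ord_recl mul1r => h.
rewrite /cc; under eq_bigr do rewrite -mulrA mulrBl.
rewrite -mulr_sumr sumrB dd_conv; congr (2 * _).
have -> : \sum_(i < m.+1) dd i.+1 * dd (m - i) = 1 - dd m.+1.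
  by rewrite -h subn0 addrAC subrr add0r.
by ring.
Qed.

Lemma dc_conv m : \sum_(i < m.+1) dd i * cc (m - i) = 2 * dd m.+1.
Proof.
rewrite -cd_conv (reindex_inj rev_ord_inj); apply: eq_bigr => i _.
by rewrite /= subSS subKn 1?mulrC // -ltnS.
Qed.

(** The Catalan recursion. The 4 is due to the normalisation by [4 ^ k], and it is the square of the
    limit 2. *)
Lemma cc_conv m : \sum_(i < m.+1) cc i * cc (m - i) = 4 * cc m.+1.
Proof.
have := dc_conv m.+1; rewrite big_ord_recl mul1r => h.
rewrite {1}/cc; under eq_bigr do rewrite -mulrA mulrBl.
rewrite -mulr_sumr sumrB dc_conv.
have -> : \sum_(i < m.+1) dd i.+1 * cc (m - i) = 2 * dd m.+2 - cc m.+1.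
  by rewrite -h subn0 addrAC subrr add0r.
by rewrite /cc /=; ring.
Qed.

End CentralBinomial.

(** * An explicit supersolution of the loop recursion *)

Section Supersolution.
Variables (R : realFieldType) (al nu lam : R) (P : nat).
Hypotheses (al0 : 0 < al) (al1 : al <= 1) (P0 : (0 < P)%N).
Hypotheses (nuP : nu * P%:R = al) (lam0 : 0 < lam) (lam2 : lam ^+ 2 = al * nu).
Local Notation dd := (dd R).
Local Notation cc := (cc R).

(** The factor attached to one loop. The Catalan part solves the splitting recursion exactly; the
    slack [nu = al / P] keeps even loops away from 0, which merging requires. Odd loops get the
    scale [lam], so that a product of two odd factors has order [al * nu]. *)
Definition hh k : R := if odd k then lam * dd k./2 else cc k./2 + nu.

Lemma hhE k : hh k = if odd k then lam * dd k./2 else cc k./2 + nu.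
Proof. by []. Qed.

Lemma hh_even k : hh k.*2 = cc k + nu.
Proof. by rewrite /hh odd_double doubleK. Qed.

Lemma hh_odd k : hh k.*2.+1 = lam * dd k.
Proof. by rewrite /hh /= odd_double /= uphalf_double. Qed.

Lemma nu_gt0 : 0 < nu.
Proof. by have := al0; rewrite -nuP pmulr_lgt0 // ltr0n. Qed.
Local Hint Resolve nu_gt0 : core.

Lemma hh_gt0 k : 0 < hh k.
Proof.
rewrite /hh; case: odd; first by rewrite mulr_gt0 ?dd_gt0.
by rewrite addr_gt0 ?cc_gt0.
Qed.

Lemma nuk k : (k <= P)%N -> nu * k%:R <= al.
Proof. by move=> kP; rewrite -nuP ler_wpM2l ?ler_nat // ltW. Qed.

Lemma sum_double (F : nat -> R) j :
  \sum_(a < j.*2) F a = \sum_(i < j) (F i.*2 + F i.*2.+1).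
Proof.
elim: j => [|j IH]; first by rewrite !big_ord0.
by rewrite doubleS !big_ord_recr /= IH addrA.
Qed.

(** For odd [k] the Catalan convolution is exact, the cross terms give at most [4 nu] by [sum_cc],
    and the terms in [nu ^+ 2] and [lam ^+ 2] at most [al * nu] each. For even [k] the mixed
    convolution is exact, and the terms in [nu] are absorbed because [nu] times the length is at
    most [al]. *)
Lemma hh_conv k : (k < P)%N ->
  \sum_(a < k) hh a * hh (k.-1 - a) <= 4 * (1 + al) * hh k.+1.
Proof.
move=> kP; rewrite -(odd_double_half k); case: odd (odd_double_half k) => /= ek;
  set j := k./2 in ek *.
  rewrite add1n -doubleS hh_even big_ord_recr /= (sum_double (fun a => hh a * hh (j.*2 - a))).
  have -> : (j.*2 - j.*2 = 0.*2)%N by lia.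
  have e1 : \sum_(i < j) (hh i.*2 * hh (j.*2 - i.*2) + hh i.*2.+1 * hh (j.*2 - i.*2.+1)) =
    \sum_(i < j) (cc i + nu) * (cc (j - i) + nu) + \sum_(i < j) lam ^+ 2 * (dd i * dd (j.-1 - i)).
    rewrite -big_split /=; apply: eq_bigr => i _; have ij := ltn_ord i.
    have -> : (j.*2 - i.*2 = (j - i).*2)%N by lia.
    have -> : (j.*2 - i.*2.+1 = (j.-1 - i).*2.+1)%N by lia.
    by rewrite !hh_even !hh_odd; ring.
  have e2 : \sum_(i < j) (cc i + nu) * (cc (j - i) + nu) + hh j.*2 * hh 0.*2 =
    \sum_(i < j.+1) (cc i * cc (j - i) + nu * cc i + nu * cc (j - i) + nu ^+ 2).
    rewrite big_ord_recr /= !hh_even subnn; congr (_ + _); last by ring.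
    by apply: eq_bigr => i _; ring.
  rewrite e1 -addrA [X in _ + X]addrC addrA e2 !big_split /= cc_conv.
  rewrite -[\sum_(i < j.+1) nu * cc i]mulr_sumr -[\sum_(i < j.+1) nu * cc (j - i)]mulr_sumr.
  rewrite -[\sum_(i < j) lam ^+ 2 * _]mulr_sumr.
  have -> : \sum_(i < j.+1) cc (j - i) = \sum_(i < j.+1) cc i.
    rewrite (reindex_inj rev_ord_inj); apply: eq_bigr => i _.
    by rewrite /= subSS subKn // -ltnS.
  rewrite sumr_const card_ord sum_cc lam2.
  have h1 : \sum_(i < j) dd i * dd (j.-1 - i) <= 1.
    by case: (j) => [|j']; [rewrite big_ord0|rewrite dd_conv].
  have h2 : nu * j.+1%:R <= al by apply: nuk; lia.
  have h3 : nu ^+ 2 *+ j.+1 <= al * nu.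
    have -> : nu ^+ 2 *+ j.+1 = (nu * j.+1%:R) * nu by rewrite -[_ *+ _]mulr_natr; ring.
    by rewrite ler_wpM2r // ltW.
  have h4 : al * nu * \sum_(i < j) dd i * dd (j.-1 - i) <= al * nu.
    by rewrite ler_piMr // mulr_ge0 ?ltW.
  have d0 := dd_gt0 R j.+1; have n0 := nu_gt0; have c0 := cc_gt0 R j.+1.
  have := mulr_gt0 n0 d0; have := mulr_gt0 al0 c0; have := mulr_gt0 al0 n0.
  by lra.
rewrite add0n hh_odd (sum_double (fun a => hh a * hh (j.*2.-1 - a))).
have -> : \sum_(i < j) (hh i.*2 * hh (j.*2.-1 - i.*2) + hh i.*2.+1 * hh (j.*2.-1 - i.*2.+1)) =
    lam * (\sum_(i < j) (cc i * dd (j.-1 - i) + nu * dd (j.-1 - i)) +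
           \sum_(i < j) (dd i * cc (j.-1 - i) + nu * dd i)).
  rewrite -big_split /= mulr_sumr; apply: eq_bigr => i _; have ij := ltn_ord i.
  have -> : (j.*2.-1 - i.*2 = (j.-1 - i).*2.+1)%N by lia.
  have -> : (j.*2.-1 - i.*2.+1 = (j.-1 - i).*2)%N by lia.
  by rewrite !hh_even !hh_odd; ring.
rewrite mulrCA ler_pM2l //.
case: j ek => [|j] ek; first by rewrite !big_ord0 addr0 mulr_ge0 //= ?mulr1; have := al0; lra.
rewrite !big_split /= cd_conv dc_conv.
rewrite -[\sum_(i < j.+1) nu * dd i]mulr_sumr -[\sum_(i < j.+1) nu * dd (j - i)]mulr_sumr.
have -> : \sum_(i < j.+1) dd (j - i) = \sum_(i < j.+1) dd i.
  rewrite (reindex_inj rev_ord_inj); apply: eq_bigr => i _.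
  by rewrite /= subSS subKn // -ltnS.
rewrite sum_dd -/(dd j.+1).
have h2 : nu * j.+1%:R <= al by apply: nuk; lia.
have d0 := dd_gt0 R j.+1.
have : 0 <= (al - nu * j.+1%:R) * dd j.+1 by rewrite mulr_ge0 ?subr_ge0 // ltW.
by lra.
Qed.

Lemma hh_shift k : (0 < k)%N -> hh k.-1 <= 4 * hh k.+1.
Proof.
move=> k0; rewrite -(odd_double_half k); case: odd (odd_double_half k) => /= ek;
  set j := k./2 in ek *.
  rewrite add1n -doubleS !hh_even; have := cc_le4 R j; have := nu_gt0; lra.
case: j ek => [|j] ek; first by lia.
rewrite add0n doubleS /= -doubleS !hh_odd mulrCA ler_pM2l //.
by have := dd_le2 R j; have := dd_gt0 R j.+1; lra.
Qed.

(** If [m] or [k + 1] is even, its factor is at least [nu] and monotonicity does the rest. If both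
    are odd, the right side is [3 dd_i dd_j >= 3 / (2 (i + j) + 1)], while the Catalan part is at
    most [2 / (2 (i + j) + 1)] and [nu] at most [1 / (2 (i + j) + 1)]: hence the 3. *)
Lemma hh_merge m k : (0 < m)%N -> (m + k < P)%N ->
  hh (m + k - 1) <= 3 / (al * nu) * (hh m * hh k.+1).
Proof.
move=> m0 mkP.
have n0 := nu_gt0.
have an0 : 0 < al * nu by rewrite mulr_gt0.
pose X := 3 / (al * nu); rewrite -/X.
have X0 : 0 < X by rewrite divr_gt0.
have Xnu : 1 <= X * nu.
  have -> : X * nu = 3 / al by rewrite /X; field; rewrite !lt0r_neq0.
  by rewrite ler_pdivlMr // mul1r; have := al1; lra.
have Xlam : X * lam ^+ 2 = 3.
  by rewrite lam2 /X; field; rewrite !lt0r_neq0.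
have key a b c : 0 <= a -> nu <= b -> c <= a -> c <= X * (b * a).
  move=> a0 nb ca; apply: (le_trans ca); rewrite mulrA ler_peMl //.
  by apply: (le_trans Xnu); rewrite ler_pM2l.
have ev a : nu <= hh a.*2 by rewrite hh_even lerDr ltW ?cc_gt0.
rewrite -(odd_double_half k); case: odd (odd_double_half k) => /= ek; set j := k./2 in ek *.
  rewrite [hh m * _]mulrC; apply: key; first by rewrite ltW ?hh_gt0.
    by rewrite add1n -doubleS.
  rewrite -(odd_double_half m); case: odd (odd_double_half m) => /= em; set i := m./2 in em *.
    have -> : (1 + i.*2 + (1 + j.*2) - 1 = (i + j).*2.+1)%N by lia.
    by rewrite add1n !hh_odd ler_pM2l // dd_anti // leq_addr.
  have -> : (0 + i.*2 + (1 + j.*2) - 1 = (i + j).*2)%N by lia.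
  by rewrite add0n !hh_even lerD2r cc_anti // leq_addr.
rewrite add0n hh_odd.
rewrite -(odd_double_half m); case: odd (odd_double_half m) => /= em; set i := m./2 in em *; last first.
  apply: key; [by rewrite mulr_ge0 ?ltW ?dd_gt0|by rewrite add0n|].
  have -> : (0 + i.*2 + j.*2 - 1 = (i + j - 1).*2.+1)%N by lia.
  by rewrite hh_odd ler_pM2l // dd_anti //; lia.
have -> : (1 + i.*2 + j.*2 - 1 = (i + j).*2)%N by lia.
rewrite add1n hh_odd hh_even.
have -> : X * (lam * dd i * (lam * dd j)) = 3 * (dd i * dd j) by rewrite -Xlam; ring.
have s1 := cc_le_inv R (i + j).
have s2 : nu * (2 * (i + j)%:R + 1) <= 1.
  have -> : 2 * (i + j)%:R + 1 = (2 * (i + j) + 1)%N%:R :> R by rewrite (natrD _ (2 * (i + j))) natrM.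
  by apply: (le_trans (nuk _)) => //; lia.
have hi := dd_lower R i; have hj := dd_lower R j.
have a0 := dd_gt0 R i; have b0 := dd_gt0 R j.
move: s1 s2; rewrite -natr1 !natrD; set x := i%:R : R; set y := j%:R : R => s1 s2.
have x0 : 0 <= x by exact: ler0n.
have y0 : 0 <= y by exact: ler0n.
have c0 := cc_gt0 R (i + j).
move: (dd i) (dd j) (cc (i + j)) a0 b0 c0 hi hj s1 => a b c a0 b0 c0 hi hj s1.
have ab : 1 <= (2 * (x + y) + 1) * (a * b).
  have h : 1 <= ((4 * x + 1) * a ^+ 2) * ((4 * y + 1) * b ^+ 2).
    by rewrite -[leLHS]mulr1; apply: ler_pM.
  have h2 : ((4 * x + 1) * a ^+ 2) * ((4 * y + 1) * b ^+ 2) <= ((2 * (x + y) + 1) * (a * b)) ^+ 2.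
    have -> : ((2 * (x + y) + 1) * (a * b)) ^+ 2 =
      ((4 * x + 1) * a ^+ 2) * ((4 * y + 1) * b ^+ 2) + 4 * (x - y) ^+ 2 * (a * b) ^+ 2 by ring.
    by rewrite lerDl; apply: mulr_ge0; [apply: mulr_ge0|]; rewrite ?sqr_ge0.
  rewrite -(@ler_pXn2r _ 2) ?nnegrE ?expr1n ?(le_trans h) //.
  by rewrite !mulr_ge0 // ?ltW // ?mulr_gt0 //; lra.
have t0 : 0 < 2 * (x + y) + 1 by lra.
rewrite -(ler_pM2l t0).
have : (2 * (x + y) + 1) * c <= 2 by nra.
by lra.
Qed.

End Supersolution.

(** * Comparison of closed walk sums with the supersolution *)

Section LoopBound.
Variables (R : realFieldType) (al nu lam : R) (P : nat).
Hypotheses (al0 : 0 < al) (al1 : al <= 1) (P0 : (0 < P)%N).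
Hypotheses (nuP : nu * P%:R = al) (lam0 : 0 < lam) (lam2 : lam ^+ 2 = al * nu).
Local Notation hh := (hh nu lam).
Let nu0 : 0 < nu := nu_gt0 al0 P0 nuP.
Let hh0 k : 0 < hh k := hh_gt0 al0 P0 nuP lam0 k.

Variable (th : R).
Hypotheses (th0 : 0 < th) (th2 : th ^+ 2 = 4 + 14 * al).

Definition super (K : R) (ns : seq nat) : R := K * th ^+ sumn ns * \prod_(m <- ns) hh m.

Lemma prod_hh_gt0 ns : 0 < \prod_(m <- ns) hh m.
Proof. by elim: ns => [|m ns IH]; rewrite ?big_nil // big_cons mulr_gt0 ?hh0. Qed.

Let th_ge0 : 0 <= th := ltW th0.
Let hh_ge0 k : 0 <= hh k := ltW (hh0 k).
Let prod_hh_ge0 ns : 0 <= \prod_(m <- ns) hh m := ltW (prod_hh_gt0 ns).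

Lemma super_ge0 K ns : 0 <= K -> 0 <= super K ns.
Proof. by move=> K0; rewrite /super !mulr_ge0 ?exprn_ge0 ?prod_hh_ge0. Qed.

Lemma le_bumps k ns (F G : seq nat -> R) :
  (forall ns', size ns' = size ns -> (sumn ns' + 1 = sumn ns + k)%N -> F ns' <= G ns') ->
  bumps k ns F <= bumps k ns G.
Proof.
elim: ns F G => [|m ns IH] F G FG //=; apply: lerD.
  case: m FG => [|m] FG; first by rewrite muln0 !mul0r.
  by rewrite ler_wpM2l ?ler0n //; apply: FG => //=; lia.
by apply: IH => ns' s1 s2; apply: FG => /=; lia.
Qed.

Lemma bumps_super K k ns : 0 <= K -> (sumn ns + k < P)%N ->
  th ^+ 2 * bumps k ns (super K) <=
  (2 * sumn ns)%:R * (3 / (al * nu)) * (super K ns * (th ^+ k.+1 * hh k.+1)).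
Proof.
have X0 : 0 < 3 / (al * nu) by rewrite divr_gt0 // mulr_gt0 ?nu0.
have hm m := hh_merge al0 al1 P0 nuP lam0 lam2 (m := m) (k := k).
move: (3 / (al * nu)) X0 hm => X X0 hm.
(* The induction is over all [K], which absorbs the factors of the loops already passed. *)
elim: ns K => [|m ns IH] K K0 sP /=; first by rewrite mulr0 muln0 !mul0r.
have e a : super K (m :: a) = super (K * th ^+ m * hh m) a.
  by rewrite /super big_cons /= exprD; ring.
rewrite (eq_bumps _ _ e) mulrDr mulnDr natrD !mulrDl; apply: lerD; last first.
  rewrite e; apply: IH; last by rewrite /= in sP; lia.
  by rewrite !mulr_ge0 ?exprn_ge0 ?hh_ge0.
case: m e sP => [|m] e sP; first by rewrite muln0 !mul0r mulr0.
rewrite [leLHS]mulrCA -[leRHS]mulrA ler_wpM2l ?ler0n // /super /= !big_cons.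
have {}hm : hh (m.+1 + k - 1) <= X * (hh m.+1 * hh k.+1).
  by apply: hm => //; rewrite /= in sP; lia.
have -> : th ^+ 2 * (K * th ^+ (m.+1 + k - 1 + sumn ns) * (hh (m.+1 + k - 1) * \prod_(j <- ns) hh j)) =
  (K * th ^+ (m.+1 + sumn ns) * th ^+ k.+1 * \prod_(j <- ns) hh j) * hh (m.+1 + k - 1).
  have -> : th ^+ (m.+1 + k - 1 + sumn ns) = th ^+ (m + k + sumn ns) by congr (_ ^+ _); lia.
  have -> : K * th ^+ (m.+1 + sumn ns) * th ^+ k.+1 = K * th ^+ (m + k + sumn ns) * th ^+ 2.
    by rewrite -!mulrA -!exprD; congr (_ * _ ^+ _); lia.
  by ring.
apply: (le_trans (ler_wpM2l _ hm)).
  by rewrite !mulr_ge0 ?exprn_ge0 ?prod_hh_ge0.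
rewrite le_eqVlt; apply/orP; left; apply/eqP.
by rewrite exprD; ring.
Qed.

Variables (n : nat) (s2 : 'I_n * 'I_n -> R) (q : R) (f : seq ('I_n * 'I_n) -> R).
Hypotheses (s2_ge0 : forall e, 0 <= s2 e) (s2_le : forall e, s2 e <= q)
  (s2_row : forall u, \sum_x s2 (edge u x) <= 1).
Hypotheses (pf : perm_inv f) (f_ge0 : forall l, 0 <= f l)
  (f_wick : forall e l, f (e :: l) <= s2 e * hit e l f).
Hypotheses (q0 : 0 <= q) (Pq : P%:R * q <= al ^+ 2).

(** Relative to the bound, splitting costs [4 (1 + al)], the forward pairing [4 al^2] and merging
    [6 al^2], the last two by [P q <= al^2]. Their sum is at most [4 + 14 al = th^2], the factor
    gained for the two removed steps. *)
Lemma ztr_super ns : (0 < size ns)%N -> (sumn ns <= P)%N ->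
  ztr s2 f ns <= super (n%:R * f [::]) ns.
Proof.
set K := n%:R * f [::].
have K0 : 0 <= K by rewrite mulr_ge0 ?ler0n.
(* Splitting removes two steps and adds one loop, so the total length plus the number of loops
   decreases. *)
have [N] := ubnP (sumn ns + size ns); elim: N ns => // N IH ns nsN s0 sP.
case: ns nsN s0 sP => [|[|k] ns] // nsN _ sP.
  have hh01 : 1 <= hh 0.
    rewrite -[0%N]/(0.*2) hh_even; have := cc_dd R 0; rewrite mul1r => ->.
    by rewrite lerDl ltW ?nu0.
  case: ns nsN sP => [|m ns] nsN sP.
    rewrite ztr0 /super /= big_seq1 expr0 mulr1 -/K.
    by rewrite ler_peMr.
  apply: (le_trans (ztr_pop _ _ _ _ _)) => //.
  apply: (le_trans (IH (m :: ns) _ _ _)) => //; first by rewrite /= in nsN *; lia.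
  have -> : super K [:: 0, m & ns] = hh 0 * super K (m :: ns).
    by rewrite /super /= !big_cons add0n; ring.
  by rewrite ler_peMl // super_ge0.
rewrite /= in nsN sP.
apply: (le_trans (ztr_rec s2_ge0 s2_le pf f_ge0 f_wick _ _)).
have B1 : \sum_(a < k) ztr s2 f (nat_of_ord a :: (k.-1 - a)%N :: ns) <=
   \sum_(a < k) super K (nat_of_ord a :: (k.-1 - a)%N :: ns).
  apply: ler_sum => a _; have ak := ltn_ord a; apply: IH => //=; clear -ak nsN sP; lia.
have B2 : k%:R * q * ztr s2 f (k.-1 :: ns) <= k%:R * q * super K (k.-1 :: ns).
  case: k nsN sP {B1} => [|k] nsN sP; first by rewrite !mul0r.
  by rewrite ler_wpM2l ?mulr_ge0 ?ler0n //; apply: IH => //=; clear -nsN sP; lia.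
have B3 : q ^+ 2 * bumps k ns (ztr s2 f) <= q ^+ 2 * bumps k ns (super K).
  have [/size0nil ->|ns0] := posnP (size ns); first by rewrite /= mulr0.
  rewrite ler_wpM2l ?sqr_ge0 //; apply: le_bumps => ns' e1 e2.
  by apply: IH; clear -e1 e2 nsN sP ns0; lia.
apply: (le_trans (lerD (lerD B1 B2) B3)).
have t2 : 0 < th ^+ 2 by rewrite exprn_gt0.
rewrite -(ler_pM2l t2) !mulrDr.
pose A := super K ns * th ^+ k.+1.
have A0 : 0 <= A by rewrite mulr_ge0 ?super_ge0 ?exprn_ge0.
have C1 : th ^+ 2 * \sum_(a < k) super K (nat_of_ord a :: (k.-1 - a)%N :: ns) =
   A * \sum_(a < k) hh a * hh (k.-1 - a).
  rewrite !mulr_sumr; apply: eq_bigr => a _; have ak := ltn_ord a.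
  rewrite /A /super /= !big_cons.
  have e1 : (a + (k.-1 - a + sumn ns) = k.-1 + sumn ns)%N by clear -ak; lia.
  have e2 : k.+1 = (k.-1 + 2)%N by clear -ak; lia.
  rewrite e1 e2 [th ^+ (_ + 2)]exprD.
  by rewrite exprD; ring.
have C2 : th ^+ 2 * (k%:R * q * super K (k.-1 :: ns)) = A * (k%:R * q * hh k.-1).
  case: k nsN sP {B1 B2 B3 C1} @A A0 => [|k] nsN sP A A0; first by rewrite !mul0r !mulr0.
  rewrite /A /super /= !big_cons.
  have e2 : k.+2 = (k + 2)%N by rewrite addn2.
  rewrite e2 [th ^+ (_ + 2)]exprD.
  by rewrite exprD; ring.
have skP : (sumn ns + k < P)%N by clear -sP; lia.
have C3 := @bumps_super K k ns K0 skP.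
have C4 : super K (k.+1 :: ns) = A * hh k.+1.
  by rewrite /A /super /= big_cons exprD; ring.
rewrite C1 C2 C4.
have D1 : A * (\sum_(a < k) hh a * hh (k.-1 - a)) <= A * (4 * (1 + al) * hh k.+1).
  by rewrite ler_wpM2l //; apply: (hh_conv al0 al1 P0 nuP lam0 lam2); clear -sP; lia.
have kP : k%:R <= P%:R :> R by rewrite ler_nat; clear -sP; lia.
have h0 := hh0 k.+1.
have D2 : A * (k%:R * q * hh k.-1) <= A * (4 * al ^+ 2 * hh k.+1).
  rewrite ler_wpM2l //; case: (posnP k) => [->|kp].
    by rewrite !mul0r; apply: mulr_ge0 => //; rewrite mulr_ge0 ?sqr_ge0.
  have -> : 4 * al ^+ 2 * hh k.+1 = al ^+ 2 * (4 * hh k.+1) by ring.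
  apply: ler_pM; rewrite ?mulr_ge0 ?ler0n //; last exact: (hh_shift al0 al1 P0 nuP lam0).
  by apply: le_trans Pq; rewrite ler_wpM2r.
have D3 : th ^+ 2 * (q ^+ 2 * bumps k ns (super K)) <= A * (6 * al ^+ 2 * hh k.+1).
  rewrite mulrCA; apply: (le_trans (ler_wpM2l _ C3)); first by rewrite sqr_ge0.
  have -> : q ^+ 2 * ((2 * sumn ns)%:R * (3 / (al * nu)) * (super K ns * (th ^+ k.+1 * hh k.+1))) =
     (A * hh k.+1) * (q ^+ 2 * ((2 * sumn ns)%:R * (3 / (al * nu)))) by rewrite /A; ring.
  have -> : A * (6 * al ^+ 2 * hh k.+1) = (A * hh k.+1) * (6 * al ^+ 2) by ring.
  have Ah0 : 0 <= A * hh k.+1 by exact: mulr_ge0.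
  rewrite ler_wpM2l //.
  have n0 := nu0; have p0 : 0 < P%:R :> R by rewrite ltr0n.
  have -> : 3 / (al * nu) = 3 * P%:R / al ^+ 2.
    by rewrite -nuP; field; rewrite !lt0r_neq0.
  have sq : (P%:R * q) ^+ 2 <= (al ^+ 2) ^+ 2.
    have aa : 0 <= al ^+ 2 by exact: sqr_ge0.
    have pq : 0 <= P%:R * q by rewrite mulr_ge0 ?ler0n.
    by rewrite ler_pXn2r ?nnegrE.
  have sP' : (sumn ns)%:R <= P%:R :> R by rewrite ler_nat; clear -sP; lia.
  have -> : q ^+ 2 * ((2 * sumn ns)%:R * (3 * P%:R / al ^+ 2)) =
    6 * (q ^+ 2 * P%:R * (sumn ns)%:R) / al ^+ 2 by rewrite natrM; ring.
  rewrite ler_pdivrMr ?exprn_gt0 // -!mulrA ler_pM2l //.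
  apply: (@le_trans _ _ ((P%:R * q) ^+ 2)); last first.
    by apply: (le_trans sq); rewrite le_eqVlt; apply/orP; left; apply/eqP; ring.
  rewrite -subr_ge0.
  have h : 0 <= q ^+ 2 * P%:R * (P%:R - (sumn ns)%:R).
    by rewrite mulr_ge0 ?subr_ge0 // mulr_ge0 ?sqr_ge0 ?ler0n.
  by apply: (le_trans h); rewrite le_eqVlt; apply/orP; left; apply/eqP; ring.
apply: (le_trans (lerD (lerD D1 D2) D3)).
have Ah0 : 0 <= A * hh k.+1 by exact: mulr_ge0.
have c : 4 * (1 + al) + 4 * al ^+ 2 + 6 * al ^+ 2 <= 4 + 14 * al.
  by have := al0; have := al1; nra.
have {}c := ler_wpM2l Ah0 c; rewrite th2.
apply: le_trans (le_trans _ c) _; rewrite le_eqVlt; apply/orP; left; apply/eqP; ring.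
Qed.

Lemma hh_le2 k : hh k <= 2.
Proof.
have p1 : 1 <= P%:R :> R by rewrite ler1n.
have n1 : nu <= 1 by have := nu0; move: nuP al1; nra.
rewrite hhE; case: odd.
  have l1 : lam <= 1.
    rewrite -(@ler_pXn2r _ 2) ?nnegrE ?(ltW lam0) // expr1n lam2.
    by apply: mulr_ile1 => //; exact: ltW.
  have d1 := dd_anti R (leq0n k./2); have d0 := dd_gt0 R k./2.
  by have : lam * dd R k./2 <= 1; [apply: mulr_ile1 => //; exact: ltW|lra].
have := cc_le_inv R k./2; rewrite cc_dd => _.
have := cc_anti R (leq0n k./2); have := cc_dd R 0; rewrite mul1r => -> /=; lra.
Qed.

Lemma walks_le_super : \sum_v walks P v v f <= 2 * n%:R * f [::] * th ^+ P.
Proof.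
rewrite -(ztr_walk s2); apply: (le_trans (ztr_super _ _)); rewrite //= ?addn0 //.
rewrite /super /= addn0 big_seq1.
have -> : 2 * n%:R * f [::] * th ^+ P = n%:R * f [::] * th ^+ P * 2 by ring.
by rewrite ler_wpM2l ?hh_le2 // !mulr_ge0 ?ler0n ?exprn_ge0.
Qed.

End LoopBound.

(** Reduction to row sums at most 1: [s2] is divided by [r2] and a list of length [k] by [r2^(k/2)].
    The Wick inequality is invariant, as it trades two edges for one factor [s2]. *)
Theorem wick_trace_le (R : rcfType) n (s2 : 'I_n * 'I_n -> R) (f : seq ('I_n * 'I_n) -> R)
    (al q r2 : R) (P : nat) :
  0 < al -> al <= 1 -> (0 < P)%N -> 0 < r2 -> 0 <= q -> P%:R * q <= al ^+ 2 ->
  (forall e, 0 <= s2 e) -> (forall e, s2 e <= q * r2) ->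
  (forall u, \sum_x s2 (edge u x) <= r2) ->
  perm_inv f -> (forall l, 0 <= f l) -> (forall e l, f (e :: l) <= s2 e * hit e l f) ->
  \sum_v walks P v v f <= 2 * n%:R * f [::] * Num.sqrt ((4 + 14 * al) * r2) ^+ P.
Proof.
move=> al0 al1 P0 r0 q0 Pq s20 s2q s2r pf f0 fw.
have p0 : 0 < P%:R :> R by rewrite ltr0n.
pose nu := al / P%:R; pose lam := Num.sqrt (al * nu).
have nu0 : 0 < nu by rewrite divr_gt0.
have lam0 : 0 < lam by rewrite sqrtr_gt0 mulr_gt0.
have lam2 : lam ^+ 2 = al * nu by rewrite sqr_sqrtr // ltW // mulr_gt0.
have nuP : nu * P%:R = al by rewrite /nu divfK // lt0r_neq0.
pose th := Num.sqrt (4 + 14 * al).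
have th0 : 0 < th by rewrite sqrtr_gt0; lra.
have th2 : th ^+ 2 = 4 + 14 * al by rewrite sqr_sqrtr //; lra.
pose c := (Num.sqrt r2)^-1.
have r1 : 0 < Num.sqrt r2 by rewrite sqrtr_gt0.
have c0 : 0 < c by rewrite invr_gt0.
have c2 : c ^+ 2 = r2^-1 by rewrite exprVn sqr_sqrtr // ltW.
pose g l := c ^+ size l * f l.
have pg : perm_inv g by move=> l l' p; rewrite /g (perm_size p) (pf _ _ p).
have g0 l : 0 <= g l by rewrite mulr_ge0 // exprn_ge0 // ltW.
pose t2 e := s2 e / r2.
have t20 e : 0 <= t2 e by rewrite divr_ge0 // ltW.
have t2q e : t2 e <= q by rewrite ler_pdivrMr.
have t2r u : \sum_x t2 (edge u x) <= 1 by rewrite -mulr_suml ler_pdivrMr // mul1r.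
have gw e l : g (e :: l) <= t2 e * hit e l g.
  rewrite /g /= exprS.
  apply: (@le_trans _ _ (c * c ^+ size l * (s2 e * hit e l f))).
    by rewrite ler_wpM2l // mulr_ge0 ?exprn_ge0 ?ltW.
  have h := hit_size e l f c.
  have -> : c * c ^+ size l * (s2 e * hit e l f) = s2 e * c * (c ^+ size l * hit e l f) by ring.
  by rewrite -h /t2 -c2 le_eqVlt; apply/orP; left; apply/eqP; ring.
have := walks_le_super al0 al1 P0 nuP lam0 lam2 th0 th2 t20 t2q t2r pg g0 gw q0 Pq.
rewrite {2}/g /= expr0 mul1r => H.
have -> : \sum_v walks P v v f = Num.sqrt r2 ^+ P * \sum_v walks P v v g.
  rewrite mulr_sumr; apply: eq_bigr => v _; rewrite -walksM; apply: eq_walks_size => l sl.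
  by rewrite /g sl mulrA -exprMn divff ?lt0r_neq0 // expr1n mul1r.
rewrite sqrtrM; last by lra.
by rewrite exprMn [leRHS]mulrA [leRHS]mulrC ler_wpM2l // exprn_ge0 // ltW.
Qed.

(** * Norms, traces and mixed moments *)

Lemma cauchy_schwarz_sum (R : realFieldType) (I : finType) (x y : I -> R) :
  (\sum_i x i * y i) ^+ 2 <= (\sum_i x i ^+ 2) * (\sum_i y i ^+ 2).
Proof.
have H : 0 <= \sum_i \sum_j (x i * y j - x j * y i) ^+ 2.
  by apply: sumr_ge0 => i _; apply: sumr_ge0 => j _; exact: sqr_ge0.
suff E : \sum_i \sum_j (x i * y j - x j * y i) ^+ 2 =
   2 * ((\sum_i x i ^+ 2) * (\sum_i y i ^+ 2) - (\sum_i x i * y i) ^+ 2).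
  by move: H; rewrite E pmulr_rge0 // subr_ge0.
have e1 : (\sum_i x i ^+ 2) * (\sum_i y i ^+ 2) = \sum_i \sum_j (x i ^+ 2 * y j ^+ 2).
  by rewrite mulr_suml; apply: eq_bigr => i _; rewrite mulr_sumr.
have e2 : (\sum_i x i ^+ 2) * (\sum_i y i ^+ 2) = \sum_i \sum_j (x j ^+ 2 * y i ^+ 2).
  by rewrite e1 exchange_big.
have e3 : (\sum_i x i * y i) ^+ 2 = \sum_i \sum_j (x i * y i * (x j * y j)).
  by rewrite expr2 mulr_suml; apply: eq_bigr => i _; rewrite mulr_sumr.
rewrite mulrBr mulr_natl mulr2n {1}e1 e2 e3 mulr_sumr -big_split -sumrB /=.
apply: eq_bigr => i _; rewrite mulr_sumr -big_split -sumrB /=.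
by apply: eq_bigr => j _; ring.
Qed.

Section Norm.
Variables (R : rcfType) (n : nat).
Implicit Types (A B : 'M[R]_n) (x y v : 'cV[R]_n).

Definition nrm2 v : R := \sum_i v i ord0 ^+ 2.
Definition nrm v : R := Num.sqrt (nrm2 v).

Lemma nrm2_ge0 v : 0 <= nrm2 v.
Proof. by apply: sumr_ge0 => i _; exact: sqr_ge0. Qed.

Lemma nrm_ge0 v : 0 <= nrm v.
Proof. exact: sqrtr_ge0. Qed.

Lemma sqr_nrm v : nrm v ^+ 2 = nrm2 v.
Proof. by rewrite sqr_sqrtr ?nrm2_ge0. Qed.

Lemma nrmZ c v : nrm (c *: v) = `|c| * nrm v.
Proof.
rewrite /nrm /nrm2; under eq_bigr do rewrite mxE exprMn.
by rewrite -mulr_sumr sqrtrM ?sqr_ge0 // sqrtr_sqr.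
Qed.

Lemma nrm0 : nrm 0 = 0.
Proof. by rewrite -[0](scale0r 0) nrmZ normr0 mul0r. Qed.

Lemma nrmD x y : nrm (x + y) <= nrm x + nrm y.
Proof.
rewrite -(@ler_pXn2r _ 2) ?nnegrE ?addr_ge0 ?nrm_ge0 // sqrrD !sqr_nrm.
have -> : nrm2 (x + y) = nrm2 x + (\sum_i x i ord0 * y i ord0) *+ 2 + nrm2 y.
  rewrite /nrm2 -sumrMnl -!big_split /=; apply: eq_bigr => i _.
  by rewrite mxE sqrrD.
rewrite lerD2r lerD2l lerMn2r /=.
apply: (le_trans (ler_norm _)); rewrite -(@ler_pXn2r _ 2) ?nnegrE ?mulr_ge0 ?nrm_ge0 //.
by rewrite real_normK ?num_real // exprMn !sqr_nrm cauchy_schwarz_sum.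
Qed.

Lemma nrm_sum (I : Type) (r : seq I) (F : I -> 'cV[R]_n) :
  nrm (\sum_(i <- r) F i) <= \sum_(i <- r) nrm (F i).
Proof.
elim: r => [|i r IH]; first by rewrite !big_nil nrm0.
by rewrite !big_cons (le_trans (nrmD _ _)) // lerD2l.
Qed.

Lemma nrm2_mul A v : A^T = A -> nrm2 (A *m v) = \sum_i v i ord0 * (A *m (A *m v)) i ord0.
Proof.
move=> As; rewrite /nrm2.
transitivity (\sum_i \sum_j A i j * v j ord0 * (A *m v) i ord0).
  by apply: eq_bigr => i _; rewrite expr2 {1}mxE mulr_suml.
rewrite exchange_big; apply: eq_bigr => j _; rewrite [in RHS]mxE mulr_sumr.
apply: eq_bigr => i _ /=.
by rewrite -[in A i j]As mxE; ring.
Qed.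

Lemma nrm2_mul_sq A v : A^T = A -> nrm2 (A *m v) ^+ 2 <= nrm2 v * nrm2 ((A *m A) *m v).
Proof.
move=> As; rewrite nrm2_mul // -mulmxA.
exact: (cauchy_schwarz_sum (fun i => v i ord0) (fun i => (A *m (A *m v)) i ord0)).
Qed.

Lemma trmxX A k : A^T = A -> (A ^+ k)^T = A ^+ k.
Proof.
move=> As; elim: k => [|k IH]; first by rewrite expr0 trmx1.
by rewrite {1}exprS trmx_mul IH As exprSr.
Qed.

(** Repeated squaring by Cauchy-Schwarz stands in for the spectral theorem; it is what forces powers
    of two as exponents. *)
Lemma nrm2_pow A v l : A^T = A -> nrm2 v = 1 ->
  nrm2 (A *m v) ^+ (2 ^ l) <= nrm2 (A ^+ (2 ^ l) *m v).
Proof.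
move=> As v1; elim: l => [|l IH]; first by rewrite expn0 !expr1.
rewrite expnSr exprM.
apply: (@le_trans _ _ (nrm2 (A ^+ (2 ^ l) *m v) ^+ 2)).
  by rewrite ler_pXn2r ?nnegrE ?exprn_ge0 ?nrm2_ge0.
apply: (le_trans (nrm2_mul_sq _ (trmxX _ As))).
by rewrite v1 mul1r exprM expr2.
Qed.

Lemma nrm2_frob A v : nrm2 (A *m v) <= (\sum_i \sum_j A i j ^+ 2) * nrm2 v.
Proof.
rewrite {1}/nrm2 mulr_suml; apply: ler_sum => i _; rewrite mxE.
exact: (cauchy_schwarz_sum (fun j => A i j) (fun j => v j ord0)).
Qed.

Lemma frob_trace A : A^T = A -> \sum_i \sum_j A i j ^+ 2 = \tr (A *m A).
Proof.
move=> As; apply: eq_bigr => i _; rewrite mxE; apply: eq_bigr => j _.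
by rewrite expr2 -[in X in _ = _ * X]As mxE.
Qed.

Lemma trace_pow_ge0 A l : A^T = A -> 0 <= \tr (A ^+ (2 ^ l.+1)).
Proof.
move=> As; rewrite expnSr exprM expr2 -frob_trace ?trmxX //.
by apply: sumr_ge0 => i _; apply: sumr_ge0 => j _; exact: sqr_ge0.
Qed.

Lemma nrm_pow_le_trace A v l : A^T = A -> nrm v = 1 ->
  nrm (A *m v) ^+ (2 ^ l.+1) <= \tr (A ^+ (2 ^ l.+1)).
Proof.
move=> As v1; have v2 : nrm2 v = 1 by rewrite -sqr_nrm v1 expr1n.
rewrite expnS exprM sqr_nrm (le_trans (nrm2_pow l As v2)) //.
rewrite (le_trans (nrm2_frob _ _)) // v2 mulr1 frob_trace ?trmxX //.
by rewrite mul2n -addnn exprD.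
Qed.

Fixpoint root2 l (a : R) : R := if l is l'.+1 then Num.sqrt (root2 l' a) else a.

Lemma root2_ge0 l a : 0 <= a -> 0 <= root2 l a.
Proof. by case: l => //= l _; exact: sqrtr_ge0. Qed.

Lemma root2K l a : 0 <= a -> root2 l a ^+ (2 ^ l) = a.
Proof.
move=> a0; elim: l => [|l IH]; first by rewrite expr1.
by rewrite expnS exprM sqr_sqrtr ?root2_ge0.
Qed.

(** The Schatten norm of order [2 ^ l.+1] of a symmetric matrix. *)
Definition trnorm l A := root2 l.+1 (\tr (A ^+ (2 ^ l.+1))).

Lemma trnorm_ge0 l A : A^T = A -> 0 <= trnorm l A.
Proof. by move=> As; rewrite root2_ge0 ?trace_pow_ge0. Qed.

Lemma trnormK l A : A^T = A -> trnorm l A ^+ (2 ^ l.+1) = \tr (A ^+ (2 ^ l.+1)).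
Proof. by move=> As; rewrite root2K ?trace_pow_ge0. Qed.

Lemma nrm_mul_le l A v : A^T = A -> nrm (A *m v) <= trnorm l A * nrm v.
Proof.
move=> As; have [v0|v0] := eqVneq (nrm v) 0.
  have -> : v = 0.
    apply/matrixP => i j; rewrite (ord1 j) mxE; apply/eqP.
    move: v0; rewrite /nrm /nrm2 => /eqP; rewrite sqrtr_eq0 => h.
    have h2 : \sum_i v i ord0 ^+ 2 == 0.
      by rewrite eq_le h sumr_ge0 // => k _; exact: sqr_ge0.
    move: h2; rewrite psumr_eq0; last by move=> k _; exact: sqr_ge0.
    by move=> /allP /(_ i (mem_index_enum _)); rewrite sqrf_eq0.
  by rewrite mulmx0 nrm0 mulr0.
have vp : 0 < nrm v by rewrite lt_neqAle eq_sym v0 nrm_ge0.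
pose w := (nrm v)^-1 *: v.
have w1 : nrm w = 1 by rewrite nrmZ ger0_norm ?invr_ge0 ?nrm_ge0 // mulVf.
have -> : nrm (A *m v) = nrm (A *m w) * nrm v.
  by rewrite /w -scalemxAr nrmZ ger0_norm ?invr_ge0 ?nrm_ge0 // mulrAC mulVf // mul1r.
rewrite ler_wpM2r ?nrm_ge0 //.
rewrite -(@ler_pXn2r _ (2 ^ l.+1)) ?expn_gt0 // ?nnegrE ?nrm_ge0 ?trnorm_ge0 //.
by rewrite trnormK // nrm_pow_le_trace.
Qed.

Lemma trace_le_norm A c k : A^T = A -> 0 <= c ->
  (forall v, nrm (A *m v) <= c * nrm v) -> \tr (A ^+ (2 * k)) <= n%:R * c ^+ (2 * k).
Proof.
move=> As c0 Ac.
have pw m v : nrm (A ^+ m *m v) <= c ^+ m * nrm v.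
  elim: m => [|m IH]; first by rewrite !expr0 mul1mx mul1r.
  rewrite exprS -mulmxA (le_trans (Ac _)) // exprS -mulrA ler_wpM2l //.
rewrite mul2n -addnn exprD -(frob_trace (trmxX k As)).
have -> : n%:R * c ^+ (k + k) = \sum_(j < n) c ^+ (k + k).
  by rewrite sumr_const card_ord mulr_natl.
rewrite exchange_big; apply: ler_sum => j _.
have -> : \sum_i (A ^+ k) i j ^+ 2 = nrm2 (A ^+ k *m delta_mx j ord0).
  by apply: eq_bigr => i _; rewrite -colE mxE.
have d1 : nrm (delta_mx j ord0) = 1.
  rewrite /nrm /nrm2 (bigD1 j) //= big1 ?mxE ?eqxx ?expr1n ?addr0 ?sqrtr1 //.
  by move=> i ij; rewrite mxE (negPf ij) expr0n.
rewrite -sqr_nrm exprD -expr2 ler_pXn2r ?nnegrE ?nrm_ge0 ?exprn_ge0 //.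
by have := pw k (delta_mx j ord0); rewrite d1 mulr1.
Qed.

(** With [a] and [b] the Schatten norms, [a + b] is at most [(1 + t) a] if [b <= t a], and at most
    [(1 + 1/t) b] otherwise. A small [t] barely affects the leading part, and [B] pays a constant
    per step. The factor [n] passes from the norm back to the trace. *)
Lemma trace_add_le A B l (t : R) : A^T = A -> B^T = B -> 0 < t ->
  \tr ((A + B) ^+ (2 ^ l.+1)) <=
  n%:R * ((1 + t) ^+ (2 ^ l.+1) * \tr (A ^+ (2 ^ l.+1)) +
          (1 + t^-1) ^+ (2 ^ l.+1) * \tr (B ^+ (2 ^ l.+1))).
Proof.
move=> As Bs t0.
have AB : (A + B)^T = A + B by rewrite linearD /= As Bs.
have a0 := trnorm_ge0 l As; have b0 := trnorm_ge0 l Bs.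
have := @trace_le_norm (A + B) (trnorm l A + trnorm l B) (2 ^ l) AB (addr_ge0 a0 b0).
rewrite -expnS => H; apply: (le_trans (H _)).
  move=> v; rewrite mulmxDl mulrDl (le_trans (nrmD _ _)) // lerD //; exact: nrm_mul_le.
rewrite ler_wpM2l ?ler0n // -!trnormK // -!exprMn.
have ti : 0 < t^-1 by rewrite invr_gt0.
have pos c : 0 <= c -> 0 <= c ^+ (2 ^ l.+1) by exact: exprn_ge0.
case: (leP (trnorm l B) (t * trnorm l A)) => h.
  rewrite -[leLHS]addr0 lerD //; last by rewrite pos // mulr_ge0 //; lra.
  by rewrite ler_pXn2r ?nnegrE ?expn_gt0 ?mulr_ge0 ?addr_ge0 //; lra.
rewrite -[leLHS]add0r lerD //; first by rewrite pos // mulr_ge0 //; lra.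
rewrite ler_pXn2r ?nnegrE ?expn_gt0 ?mulr_ge0 ?addr_ge0 //; try lra.
rewrite mulrDl mul1r addrC lerD2l -(ler_pM2l t0) mulrA divff ?lt0r_neq0 // mul1r.
exact: ltW.
Qed.

Lemma jensen_pow2 (I : finType) (k x : I -> R) l : (forall i, 0 <= k i) -> \sum_i k i = 1 ->
  (forall i, 0 <= x i) -> (\sum_i k i * x i) ^+ (2 ^ l) <= \sum_i k i * x i ^+ (2 ^ l).
Proof.
move=> k0 k1 x0; elim: l => [|l IH].
  by rewrite expr1; apply: ler_sum => i _; rewrite expr1.
rewrite expnSr exprM.
apply: (@le_trans _ _ ((\sum_i k i * x i ^+ (2 ^ l)) ^+ 2)).
  rewrite ler_pXn2r ?nnegrE ?exprn_ge0 ?sumr_ge0 // => i _; rewrite mulr_ge0 ?exprn_ge0 //.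
have := cauchy_schwarz_sum (fun i => Num.sqrt (k i)) (fun i => Num.sqrt (k i) * x i ^+ (2 ^ l)).
have -> : \sum_i Num.sqrt (k i) * (Num.sqrt (k i) * x i ^+ (2 ^ l)) = \sum_i k i * x i ^+ (2 ^ l).
  by apply: eq_bigr => i _; rewrite mulrA -expr2 sqr_sqrtr.
have -> : \sum_i Num.sqrt (k i) ^+ 2 = 1.
  by rewrite -k1; apply: eq_bigr => i _; rewrite sqr_sqrtr.
rewrite mul1r => /le_trans; apply; apply: ler_sum => i _.
by rewrite exprMn sqr_sqrtr // exprM.
Qed.

(** The operator norm of [A] is at most the average of the Schatten norms of the [F i], to which the
    scalar inequality for powers of two applies. *)
Lemma trace_jensen (I : finType) (k : I -> R) (F : I -> 'M[R]_n) A l :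
  (forall i, 0 <= k i) -> \sum_i k i = 1 -> (forall i, (F i)^T = F i) ->
  A = \sum_i k i *: F i ->
  \tr (A ^+ (2 ^ l.+1)) <= n%:R * \sum_i k i * \tr (F i ^+ (2 ^ l.+1)).
Proof.
move=> k0 k1 Fs AE.
have As : A^T = A.
  by rewrite AE linear_sum /=; apply: eq_bigr => i _; rewrite linearZ /= Fs.
have x0 i : 0 <= trnorm l (F i) by exact: trnorm_ge0.
pose c := \sum_i k i * trnorm l (F i).
have c0 : 0 <= c by apply: sumr_ge0 => i _; rewrite mulr_ge0.
have := @trace_le_norm A c (2 ^ l) As c0; rewrite -expnS => H; apply: (le_trans (H _)).
  move=> v; rewrite AE mulmx_suml (le_trans (nrm_sum _ _)) // mulr_suml; apply: ler_sum => i _.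
  by rewrite -scalemxAl nrmZ ger0_norm // -mulrA ler_wpM2l // nrm_mul_le.
rewrite ler_wpM2l ?ler0n // (le_trans (jensen_pow2 _ k0 k1 x0)) //.
by apply: ler_sum => i _; rewrite trnormK.
Qed.

Definition emx (a : 'I_n * 'I_n -> R) : 'M[R]_n := \matrix_(u, v) a (edge u v).

Lemma emx_sym a : (emx a)^T = emx a.
Proof. by apply/matrixP => i j; rewrite !mxE edgeC. Qed.

Lemma emx_pow a k (u v : 'I_n) : (emx a ^+ k) u v = walks k u v (fun l => \prod_(e <- l) a e).
Proof.
elim: k u => [|k IH] u.
  by rewrite expr0 /= big_nil mxE; case: eqP.
rewrite exprS mxE /=; apply: eq_bigr => x _; rewrite mxE IH -walksM.
by apply: eq_walks => l; rewrite big_cons.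
Qed.

Lemma emx_trace a k : \tr (emx a ^+ k) = \sum_v walks k v v (fun l => \prod_(e <- l) a e).
Proof. by apply: eq_bigr => v _; rewrite emx_pow. Qed.

End Norm.

(** * Mixed moments and their realisation on finite product spaces *)

Section Moments.
Variables (R : rcfType) (n : nat).
Local Notation E := ('I_n * 'I_n)%type.
Implicit Types (mu : nat -> R) (sg : E -> R) (l : seq E).

Lemma le_walks_size k (u v : 'I_n) (f g : seq E -> R) :
  (forall l, size l = k -> f l <= g l) -> walks k u v f <= walks k u v g.
Proof.
move=> fg; rewrite walks_size [leRHS]walks_size; apply: le_walks => l.
by case: eqP => // /fg.
Qed.

(** The expectation of the product over [l] of [sg e * y_e], for independent [y_e] with moments
    [mu]. Being defined from [mu] alone, it allows sequences of moments to be compared order by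
    order. *)
Definition mom mu sg l : R := \prod_e (mu (count_mem e l) * sg e ^+ count_mem e l).

Lemma prod_count (g : E -> R) l : \prod_(e <- l) g e = \prod_e g e ^+ count_mem e l.
Proof.
elim: l => [|a l IH]; first by rewrite big_nil big1 // => e _; rewrite expr0.
rewrite big_cons IH (bigD1 a) //= [RHS](bigD1 a) //= eqxx exprS -mulrA; congr (_ * (_ * _)).
by apply: eq_bigr => e ea; rewrite eq_sym (negPf ea).
Qed.

Lemma mom_perm mu sg : perm_inv (mom mu sg).
Proof. by move=> l l' /permP p; apply: eq_bigr => e _; rewrite p. Qed.

Lemma mom_ge0 mu sg l : (forall m, 0 <= mu m) -> (forall e, 0 <= sg e) -> 0 <= mom mu sg l.
Proof. by move=> m0 s0; apply: prodr_ge0 => e _; rewrite mulr_ge0 ?exprn_ge0. Qed.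

Lemma mom_nil mu sg : mu 0%N = 1 -> mom mu sg [::] = 1.
Proof. by move=> m0; apply: big1 => e _; rewrite /= m0 mul1r. Qed.

Lemma le_mom N mu mu' sg l : (forall e, 0 <= sg e) ->
  (forall m, (m <= N)%N -> `|mu m| <= mu' m) -> (size l <= N)%N ->
  `|mom mu sg l| <= mom mu' sg l.
Proof.
move=> s0 mm lN; rewrite normr_prod; apply: ler_prod => e _.
rewrite normr_ge0 normrM (ger0_norm (exprn_ge0 _ _)) //= ler_wpM2r ?exprn_ge0 //.
by apply: mm; apply: leq_trans lN; exact: count_size.
Qed.

Lemma mom_cons mu sg e l : mom mu sg (e :: l) =
  mu (count_mem e l).+1 * sg e ^+ (count_mem e l).+1 *
  \prod_(e' | e' != e) (mu (count_mem e' l) * sg e' ^+ count_mem e' l).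
Proof.
rewrite /mom (bigD1 e) //= eqxx add1n; congr (_ * _).
by apply: eq_bigr => e' ne; rewrite eq_sym (negPf ne).
Qed.

(** [hit] counts the [m] remaining occurrences of [e], which is the factor in the hypothesis on
    [mu]. For [m = 0] that hypothesis makes the first moment vanish. *)
Lemma mom_wick mu sg e l : (forall m, 0 <= mu m) -> (forall e, 0 <= sg e) ->
  (forall m, mu m.+1 <= m%:R * mu m.-1) ->
  mom mu sg (e :: l) <= sg e ^+ 2 * hit e l (mom mu sg).
Proof.
move=> m0 s0 mw; rewrite mom_cons hit_perm_inv; last exact: mom_perm.
have [el|el] := boolP (e \in l); last first.
  rewrite (count_memPn el) mul0r mulr0; have /le_anti -> : (mu 1 <= 0 <= mu 1)%O.
    by rewrite m0 (le_trans (mw 0)) // mul0r.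
  by rewrite !mul0r.
have pl := perm_to_rem el.
have cE e' : count_mem e' l = ((e == e') + count_mem e' (rem e l))%N by rewrite (permP pl).
have := cE e; rewrite eqxx add1n; move: (count_mem e l) => c cc.
rewrite /mom [in leRHS](bigD1 e) //=.
have -> : \prod_(e' | e' != e) (mu (count_mem e' (rem e l)) * sg e' ^+ count_mem e' (rem e l)) =
   \prod_(e' | e' != e) (mu (count_mem e' l) * sg e' ^+ count_mem e' l).
  by apply: eq_bigr => e' ne; rewrite cE eq_sym (negPf ne).
move: (count_mem e (rem e l)) cc => c' ->.
set Q := \prod_(_ | _) _.
have Q0 : 0 <= Q by apply: prodr_ge0 => e' _; rewrite mulr_ge0 ?exprn_ge0.
have -> : sg e ^+ 2 * (c'.+1%:R * (mu c' * sg e ^+ c' * Q)) =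
   (c'.+1%:R * mu c') * (sg e ^+ c'.+2 * Q) by rewrite !exprS; ring.
have S0 : 0 <= sg e ^+ c'.+2 * Q by apply: mulr_ge0 => //; exact: exprn_ge0.
by rewrite -mulrA; apply: ler_wpM2r => //; exact: (mw c'.+1).
Qed.

Section Product.
Variables (O : finType) (ka : O -> R).

Definition wt (w : {ffun E -> O}) : R := \prod_e ka (w e).

Lemma sum_wt_prod (G : E -> O -> R) :
  \sum_w wt w * \prod_e G e (w e) = \prod_e \sum_o ka o * G e o.
Proof.
rewrite (bigA_distr_bigA (fun e o => ka o * G e o)); apply: eq_bigr => w _.
by rewrite -big_split.
Qed.

Lemma sum_wt_mom (y : O -> R) sg l :
  \sum_w wt w * \prod_(e <- l) (sg e * y (w e)) = mom (fun m => \sum_o ka o * y o ^+ m) sg l.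
Proof.
under eq_bigr do rewrite prod_count.
rewrite (sum_wt_prod (fun e o => (sg e * y o) ^+ count_mem e l)).
apply: eq_bigr => e _; rewrite mulr_suml; apply: eq_bigr => o _.
by rewrite exprMn; ring.
Qed.

Lemma sum_wt_mom2 (y : O -> R) sg l :
  \sum_w \sum_w' wt w * wt w' * \prod_(e <- l) (sg e * (y (w e) - y (w' e))) =
  mom (fun m => \sum_o \sum_o' ka o * ka o' * (y o - y o') ^+ m) sg l.
Proof.
have H w : \sum_w' wt w * wt w' * \prod_(e <- l) (sg e * (y (w e) - y (w' e))) =
   wt w * \prod_e \sum_o' ka o' * (sg e * (y (w e) - y o')) ^+ count_mem e l.
  rewrite -(sum_wt_prod (fun e o' => (sg e * (y (w e) - y o')) ^+ count_mem e l)) mulr_sumr.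
  by apply: eq_bigr => w' _; rewrite prod_count mulrA.
under eq_bigr do rewrite H.
rewrite (sum_wt_prod (fun e o => \sum_o' ka o' * (sg e * (y o - y o')) ^+ count_mem e l)).
apply: eq_bigr => e _; rewrite mulr_suml; apply: eq_bigr => o _.
rewrite mulr_sumr mulr_suml; apply: eq_bigr => o' _.
by rewrite exprMn; ring.
Qed.

Hypotheses (ka0 : forall o, 0 <= ka o) (ka1 : \sum_o ka o = 1).

Lemma wt_ge0 w : 0 <= wt w.
Proof. exact: prodr_ge0. Qed.

Lemma sum_wt : \sum_w wt w = 1.
Proof.
transitivity (\sum_w wt w * \prod_(e : E) (fun _ _ => 1) e (w e)).
  by apply: eq_bigr => w _; rewrite big1 ?mulr1.
rewrite (sum_wt_prod (fun _ _ => 1)); apply: big1 => e _; rewrite -[RHS]ka1; apply: eq_bigr => o _; by rewrite mulr1.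
Qed.

Definition tmom mu sg k := \sum_v walks k v v (mom mu sg).

Lemma tmom_trace (y : O -> R) sg k : tmom (fun m => \sum_o ka o * y o ^+ m) sg k =
  \sum_w wt w * \tr (emx (fun e => sg e * y (w e)) ^+ k).
Proof.
under [RHS]eq_bigr do rewrite emx_trace mulr_sumr.
rewrite exchange_big; apply: eq_bigr => v _.
under eq_walks do rewrite -sum_wt_mom.
by rewrite walks_sum; apply: eq_bigr => w _; rewrite walksM.
Qed.

(** The matrices of [a] and [d] are separated pointwise on the product space. Since [d] is centred,
    its matrix is the average of its differences with an independent copy, so Jensen replaces [d] by
    a symmetric variable at the cost of a second factor [n]. *)
Lemma tmom_add_le (a d : O -> R) sg (l P : nat) (t : R) : \sum_o ka o * d o = 0 -> 0 < t ->
  P = (2 ^ l.+1)%N ->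
  tmom (fun m => \sum_o ka o * (a o + d o) ^+ m) sg P <=
  n%:R * ((1 + t) ^+ P * tmom (fun m => \sum_o ka o * a o ^+ m) sg P +
          (1 + t^-1) ^+ P * (n%:R *
    tmom (fun m => \sum_o \sum_o' ka o * ka o' * (d o - d o') ^+ m) sg P)).
Proof.
move=> d0 t0 PE; rewrite !tmom_trace.
pose A w := emx (fun e => sg e * a ((w : {ffun E -> O}) e)).
pose D w := emx (fun e => sg e * d ((w : {ffun E -> O}) e)).
have -> : tmom (fun m => \sum_o \sum_o' ka o * ka o' * (d o - d o') ^+ m) sg P =
   \sum_w wt w * \sum_w' wt w' * \tr ((D w - D w') ^+ P).
  transitivity (\sum_w \sum_w' wt w * wt w' *
     \tr (emx (fun e => sg e * (d (w e) - d (w' e))) ^+ P)).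
    under [RHS]eq_bigr do under eq_bigr do rewrite emx_trace mulr_sumr.
    under [RHS]eq_bigr do rewrite exchange_big /=.
    rewrite exchange_big; apply: eq_bigr => v _.
    under eq_walks do rewrite -sum_wt_mom2.
    rewrite walks_sum; apply: eq_bigr => w _; rewrite walks_sum; apply: eq_bigr => w' _.
    by rewrite walksM.
  apply: eq_bigr => w _; rewrite mulr_sumr; apply: eq_bigr => w' _; rewrite mulrA.
  congr (_ * \tr (_ ^+ _)); apply/matrixP => u v; rewrite !mxE; ring.
have E1 w : wt w * \tr (emx (fun e => sg e * (a (w e) + d (w e))) ^+ P) <=
   n%:R * ((1 + t) ^+ P * (wt w * \tr (A w ^+ P)) + (1 + t^-1) ^+ P *
     (n%:R * (wt w * \sum_w' wt w' * \tr ((D w - D w') ^+ P)))).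
  have -> : emx (fun e => sg e * (a (w e) + d (w e))) = A w + D w.
    by apply/matrixP => u v; rewrite !mxE; ring.
  have TA : \tr ((A w + D w) ^+ P) <= n%:R * ((1 + t) ^+ P * \tr (A w ^+ P) +
      (1 + t^-1) ^+ P * \tr (D w ^+ P)).
    by rewrite PE; apply: trace_add_le => //; exact: emx_sym.
  apply: (le_trans (ler_wpM2l (wt_ge0 w) TA)).
  have J : \tr (D w ^+ P) <= n%:R * \sum_w' wt w' * \tr ((D w - D w') ^+ P).
    rewrite PE; apply: (@trace_jensen _ _ _ wt (fun w' => D w - D w')).
    - exact: wt_ge0.
    - exact: sum_wt.
    - by move=> w'; rewrite linearB /= !emx_sym.
    apply/matrixP => u v; rewrite summxE.
    have z : \sum_w' wt w' * (sg (edge u v) * d (w' (edge u v))) = 0.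
      have := sum_wt_mom d sg [:: edge u v]; rewrite mom_cons /= => Z.
      under eq_bigr => w' _ do rewrite -[_ * d _](big_seq1 *%R (edge u v) (fun e => sg e * d (w' e))).
      rewrite Z; under eq_bigr do rewrite expr1.
      by rewrite d0 !mul0r.
    transitivity (D w u v * (\sum_w' wt w') - \sum_w' wt w' * (sg (edge u v) * d (w' (edge u v)))).
      by rewrite sum_wt mulr1 z subr0.
    rewrite mulr_sumr -sumrB; apply: eq_bigr => w' _; rewrite !mxE; ring.
  have p2 : 0 <= wt w * (n%:R * (1 + t^-1) ^+ P).
    rewrite !mulr_ge0 ?ler0n ?wt_ge0 ?exprn_ge0 // addr_ge0 // invr_ge0 ltW //.
  have {}J := ler_wpM2l p2 J.
  rewrite -subr_ge0 in J; rewrite -subr_ge0; apply: (le_trans J).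
  by rewrite le_eqVlt; apply/orP; left; apply/eqP; ring.
apply: (@le_trans _ _ (\sum_w n%:R * ((1 + t) ^+ P * (wt w * \tr (A w ^+ P)) + (1 + t^-1) ^+ P *
     (n%:R * (wt w * \sum_w' wt w' * \tr ((D w - D w') ^+ P)))))).
  by apply: ler_sum => w _; exact: E1.
by rewrite -mulr_sumr big_split /= -!mulr_sumr.
Qed.

End Product.

Lemma le_tmom N mu mu' sg k : (forall e, 0 <= sg e) ->
  (forall m, (m <= N)%N -> `|mu m| <= mu' m) -> (k <= N)%N ->
  `|tmom mu sg k| <= tmom mu' sg k.
Proof.
move=> s0 mm kN; rewrite /tmom.
have lm l : size l = k -> `|mom mu sg l| <= mom mu' sg l.
  by move=> sl; apply: (le_mom s0 mm); rewrite sl.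
rewrite ler_norml -sumrN; apply/andP; split; apply: ler_sum => v _.
  rewrite -mulN1r -walksM; apply: le_walks_size => l /lm.
  by rewrite ler_norml mulN1r => /andP[].
by apply: le_walks_size => l /lm; rewrite ler_norml => /andP[].
Qed.

End Moments.

(** * Moments of weighted sums of Bernoulli variables *)

Section Bernoulli.
Variables (R : rcfType) (n : nat) (q : R).
Hypotheses (q0 : 0 <= q) (q1 : q <= 1).
Local Notation E := ('I_n * 'I_n)%type.
Implicit Types (b : {ffun E -> bool}).

Definition kb (x : bool) : R := if x then q else 1 - q.

Lemma kb_ge0 x : 0 <= kb x.
Proof. by case: x => //=; rewrite subr_ge0. Qed.

Lemma sum_kb : \sum_x kb x = 1.
Proof. by rewrite big_bool /= addrC subrK. Qed.

Definition setb (e : E) b := [ffun x => if x == e then true else b x].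
Definition flipb (e : E) b := [ffun x => if x == e then ~~ b x else b x].

Lemma flipbK e : involutive (flipb e).
Proof. by move=> b; apply/ffunP => x; rewrite !ffunE; case: eqP => // _; rewrite negbK. Qed.

(** Configurations are paired by flipping bit [e]. The value of [G] where the bit is set is bounded
    by [H] at both members of the pair, which have weights [q] and [1 - q]. *)
Lemma bernoulli_cond e (G H : {ffun E -> bool} -> R) : (forall b, G (setb e b) <= H b) ->
  \sum_b wt kb b * ((b e)%:R * G b) <= q * \sum_b wt kb b * H b.
Proof.
move=> GH; pose W b := \prod_(x | x != e) kb (b x).
have W0 b : 0 <= W b by apply: prodr_ge0 => x _; exact: kb_ge0.
have wE b : wt kb b = kb (b e) * W b by rewrite /wt (bigD1 e).
have fe b : flipb e b e = ~~ b e by rewrite ffunE eqxx.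
have fW b : W (flipb e b) = W b by apply: eq_bigr => x /negPf xe; rewrite ffunE xe.
rewrite (bigID (fun b => b e)) /= [X in _ + X]big1 ?addr0; last first.
  by move=> b /negPf ->; rewrite mul0r mulr0.
rewrite [in leRHS](bigID (fun b => b e)) /=.
rewrite [X in q * (_ + X)](reindex_inj (inv_inj (flipbK e))) /=.
rewrite [X in q * (_ + X)](eq_bigl (fun b : {ffun E -> bool} => b e)); last by move=> b; rewrite fe negbK.
rewrite -big_split /= mulr_sumr; apply: ler_sum => b be.
rewrite !wE fe fW be /= mul1r -mulrA ler_wpM2l //.
have s1 : setb e b = b by apply/ffunP => x; rewrite ffunE; case: eqP => // ->.
have s2 : setb e (flipb e b) = b.
  by apply/ffunP => x; rewrite !ffunE; case: eqP => // ->.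
have h1 : G b <= H b by rewrite -{1}s1.
have h2 : G b <= H (flipb e b) by rewrite -{1}s2.
have -> : W b * G b = q * W b * G b + (1 - q) * W b * G b by ring.
by apply: lerD; rewrite ler_wpM2l // mulr_ge0 // subr_ge0.
Qed.

Variables (s : 'I_n -> R) (g : 'I_n -> E) (ss S : R).
Hypotheses (g_inj : injective g) (s0 : forall x, 0 <= s x) (s_le : forall x, s x <= ss)
  (ss0 : 0 <= ss) (sS : \sum_x s x <= S).

Definition rho b := \sum_x s x * (b (g x))%:R.

Lemma rho_ge0 b : 0 <= rho b.
Proof. by apply: sumr_ge0 => x _; rewrite mulr_ge0 ?ler0n. Qed.

(** Size biasing: one factor [rho] is expanded. Requiring the bit of [g x] to be set costs [q] and
    raises the other factors by at most [ss], which is moved into [c]; hence the induction over all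
    [c]. *)
Lemma rho_moment k c : 0 <= c ->
  \sum_b wt kb b * (rho b + c) ^+ k <= (q * S + c + k%:R * ss) ^+ k.
Proof.
have S0 : 0 <= S by apply: le_trans sS; exact: sumr_ge0.
have w0 b : 0 <= wt kb b by apply: wt_ge0; exact: kb_ge0.
elim: k c => [|k IH] c c0.
  rewrite expr0; under eq_bigr do rewrite expr0 mulr1.
  by rewrite sum_wt // sum_kb.
pose B c := \sum_b wt kb b * (rho b + c) ^+ k.
have -> : \sum_b wt kb b * (rho b + c) ^+ k.+1 =
  \sum_x s x * (\sum_b wt kb b * ((b (g x))%:R * (rho b + c) ^+ k)) + c * B c.
  under [X in _ = X + _]eq_bigr do rewrite mulr_sumr.
  rewrite exchange_big /= /B mulr_sumr -big_split /=; apply: eq_bigr => b _.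
  rewrite exprS mulrDl mulrDr; congr (_ + _); last by ring.
  by rewrite {1}/rho mulr_suml mulr_sumr; apply: eq_bigr => x _; ring.
have cs0 : 0 <= c + ss by exact: addr_ge0.
have Bc : B c <= B (c + ss).
  apply: ler_sum => b _; rewrite ler_wpM2l // lerXn2r ?nnegrE ?addr_ge0 ?rho_ge0 //.
  by rewrite lerD2l lerDl.
have hx x : \sum_b wt kb b * ((b (g x))%:R * (rho b + c) ^+ k) <= q * B (c + ss).
  apply: bernoulli_cond => b; rewrite lerXn2r ?nnegrE ?addr_ge0 ?rho_ge0 //.
  rewrite addrA [leRHS]addrAC lerD2r /rho.
  apply: (@le_trans _ _ (\sum_y (s y * (b (g y))%:R + (y == x)%:R * ss))).
    apply: ler_sum => y _; rewrite ffunE (inj_eq g_inj).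
    case: eqP => [_|_]; last by rewrite mul0r addr0.
    by rewrite mulr1 mul1r ler_wpDl ?mulr_ge0 ?ler0n.
  rewrite big_split /= lerD2l -mulr_suml.
  by rewrite (bigD1 x) //= eqxx big1 ?addr0 ?mul1r // => y /negPf ->.
have B0 : 0 <= B (c + ss).
  by apply: sumr_ge0 => b _; rewrite mulr_ge0 ?exprn_ge0 ?addr_ge0 ?rho_ge0.
apply: (@le_trans _ _ (S * (q * B (c + ss)) + c * B (c + ss))).
  apply: lerD; last by rewrite ler_wpM2l.
  apply: (@le_trans _ _ (\sum_x s x * (q * B (c + ss)))).
    by apply: ler_sum => x _; rewrite ler_wpM2l.
  by rewrite -mulr_suml ler_wpM2r // mulr_ge0.
have -> : S * (q * B (c + ss)) + c * B (c + ss) = (q * S + c) * B (c + ss) by ring.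
have k0 : 0 <= k%:R * ss by rewrite mulr_ge0 ?ler0n.
have e : q * S + (c + ss) + k%:R * ss = q * S + c + k.+1%:R * ss by rewrite -natr1; ring.
have qs : 0 <= q * S by rewrite mulr_ge0.
rewrite exprS; apply: ler_pM => //; first by rewrite addr_ge0.
  by rewrite lerDl mulr_ge0 ?ler0n.
by rewrite -e; exact: IH.
Qed.

End Bernoulli.

(** * Sparse Gaussian weights, conditionally on their support *)

Section Quench.
Variables (R : rcfType).

(** Moments of the standard Gaussian, for which the Wick inequality is an equality. *)
Fixpoint gam (m : nat) : R := match m with 0 => 1 | 1 => 0 | m'.+2 => m'.+1%:R * gam m' end.

Lemma gamS m : gam m.+1 = m%:R * gam m.-1.
Proof. by case: m => [|m]; rewrite ?mul0r. Qed.

Lemma gam_ge0 m : 0 <= gam m.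
Proof.
have : 0 <= gam m /\ 0 <= gam m.+1; last by case.
elim: m => [|m [IH1 IH2]]; first by rewrite /= ler01.
by split => //; rewrite gamS mulr_ge0 ?ler0n.
Qed.

Lemma gam_odd m : odd m -> gam m = 0.
Proof.
have : (odd m -> gam m = 0) /\ (odd m.+1 -> gam m.+1 = 0); last by case.
elim: m => [|m [IH1 IH2]]; first by split.
by split => // mo; rewrite gamS /= IH1 ?mulr0 //; move: mo; rewrite /= negbK.
Qed.

(** Moments of [M b g] with [b] a Bernoulli variable of parameter [q] and [g] an independent
    standard Gaussian; order 0 is apart because [b ^+ 0 = 1]. *)
Definition zeta (q M : R) m := if m == 0%N then 1 else q * M ^+ m * gam m.

(** Given the mask, the weights are Gaussian with the masked variances, and [wick_trace_le] with
    [al = 1] gives 4 + 14 = 18. The largest row sum is replaced by the sum over all rows, which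
    costs [n]. In [rho_moment] the terms [q M^2], the shift [t1] and [p M^2 ss] add up to at most
    [3 t1], and 54 = 18 * 3. *)
Lemma tmom_zeta_le n (sg : 'I_n * 'I_n -> R) (q M ss t1 : R) p :
  (forall e, 0 <= sg e) -> (forall e, sg e ^+ 2 <= ss) ->
  (forall u, \sum_x sg (edge u x) ^+ 2 <= 1) ->
  0 <= q -> q <= 1 -> 0 <= M -> 0 < t1 -> (0 < p)%N -> q * M ^+ 2 <= t1 ->
  (2 * p)%:R * (M ^+ 2 * ss) <= t1 ->
  tmom (zeta q M) sg (2 * p) <= 2 * n%:R ^+ 2 * (54 * t1) ^+ p.
Proof.
move=> sg0 sgss sgr q0 q1 M0 t10 p0 qM PM.
have [n0|n0] := posnP n.
  have n0' : n%:R = 0 :> R by rewrite n0.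
  rewrite /tmom big1 ?n0' ?expr0n ?mulr0 ?mul0r // => v.
  by have := ltn_ord v; rewrite {2}n0.
pose sb (b : {ffun 'I_n * 'I_n -> bool}) e := if b e then M * sg e else 0.
have sb0 b e : 0 <= sb b e by rewrite /sb; case: ifP => // _; rewrite mulr_ge0.
have momE l : mom (zeta q M) sg l = \sum_b wt (kb q) b * mom gam (sb b) l.
  rewrite (sum_wt_prod (kb q) (fun e x => gam (count_mem e l) *
    (if x then M * sg e else 0) ^+ count_mem e l)).
  apply: eq_bigr => e _; rewrite big_bool /= /zeta.
  case: (count_mem e l) => [|m] /=; first by rewrite !expr0 !mulr1 addrC subrK.
  by rewrite [0 ^+ _]expr0n /= !mulr0 addr0 exprMn; ring.
have w0 b : 0 <= wt (kb q) b by apply: wt_ge0; exact: kb_ge0.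
rewrite /tmom; under eq_bigr do under eq_walks do rewrite momE.
under eq_bigr do rewrite walks_sum.
rewrite exchange_big /=.
have u0 : 'I_n := Ordinal n0.
have ss0 : 0 <= ss by apply: le_trans (sgss (u0, u0)); exact: sqr_ge0.
pose rb u b := rho (fun x => M ^+ 2 * sg (edge u x) ^+ 2) (edge u) b.
have Mss0 : 0 <= M ^+ 2 * ss by rewrite mulr_ge0 ?sqr_ge0.
have per b : \sum_v walks (2 * p) v v (mom gam (sb b)) <=
    2 * n%:R * 18 ^+ p * \sum_u (rb u b + t1) ^+ p.
  pose um := [arg max_(u > u0) rb u b]%O.
  have um_max u : rb u b <= rb um b.
    by rewrite /um; case: arg_maxP => // i _; apply.
  have rb0 u : 0 <= rb u b by apply: rho_ge0 => x; rewrite mulr_ge0 ?sqr_ge0.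
  (* All row sums may vanish for a given mask; adding [t1] keeps [r2] positive and comparable with
     the entries. *)
  pose r2 := rb um b + t1.
  have r20 : 0 < r2 by rewrite ltr_wpDl.
  have := @wick_trace_le R n (fun e => sb b e ^+ 2) (mom gam (sb b)) 1 (M ^+ 2 * ss / t1) r2 (2 * p).
  rewrite mom_nil // !mulr1 => H.
  have {}H : \sum_v walks (2 * p) v v (mom gam (sb b)) <= 2 * n%:R * Num.sqrt ((4 + 14) * r2) ^+ (2 * p).
    apply: H => //.
    - by rewrite muln_gt0.
    - by rewrite divr_ge0 // ltW.
    - by rewrite mulrA ler_pdivrMr // expr1n mul1r.
    - by move=> e; exact: sqr_ge0.
    - move=> e; apply: (@le_trans _ _ (M ^+ 2 * ss)).
        rewrite /sb; case: ifP => _; last by rewrite expr0n.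
        by rewrite exprMn ler_wpM2l ?sqr_ge0.
      rewrite -mulrA ler_peMr // mulrC ler_pdivlMr // mul1r /r2 lerDr //.
    - move=> u; apply: (@le_trans _ _ (rb u b)); last by rewrite /r2 ler_wpDr // ltW.
      apply: ler_sum => x _; rewrite /sb; case: ifP => _; last by rewrite expr0n mulr0.
      by rewrite exprMn mulr1.
    - exact: mom_perm.
    - by move=> l; apply: mom_ge0 => //; exact: gam_ge0.
    - move=> e l; apply: mom_wick => //; first exact: gam_ge0.
      by move=> m; rewrite gamS.
  apply: (le_trans H); rewrite exprM sqr_sqrtr; last by apply: mulr_ge0; [lra|exact: ltW].
  have -> : 4 + 14 = 18 :> R by ring.
  rewrite exprMn mulrA ler_wpM2l //.
  rewrite (bigD1 um) //= lerDl; apply: sumr_ge0 => u _.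
  by rewrite exprn_ge0 // addr_ge0 // ltW.
apply: (@le_trans _ _ (\sum_b wt (kb q) b * (2 * n%:R * 18 ^+ p * \sum_u (rb u b + t1) ^+ p))).
  apply: ler_sum => b _; under eq_bigr do rewrite walksM.
  by rewrite -mulr_sumr ler_wpM2l.
have -> : \sum_b wt (kb q) b * (2 * n%:R * 18 ^+ p * \sum_u (rb u b + t1) ^+ p) =
  2 * n%:R * 18 ^+ p * \sum_u \sum_b wt (kb q) b * (rb u b + t1) ^+ p.
  rewrite exchange_big /= mulr_sumr; apply: eq_bigr => b _.
  by rewrite mulrCA; congr (_ * _); rewrite mulr_sumr.
apply: (@le_trans _ _ (2 * n%:R * 18 ^+ p * \sum_(u < n) (3 * t1) ^+ p)); last first.
  rewrite sumr_const card_ord -mulr_natr le_eqVlt; apply/orP; left; apply/eqP.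
  have -> : 54 * t1 = 18 * (3 * t1) by ring.
  by rewrite [in RHS]exprMn; ring.
rewrite ler_wpM2l ?mulr_ge0 ?ler0n ?exprn_ge0 //; apply: ler_sum => u _.
apply: (le_trans (@rho_moment R n q q0 q1 _ _ (M ^+ 2 * ss) (M ^+ 2) _ _ _ _ _ p t1 _)) => //.
- move=> x y /edge_eq [[]|[]] // h1 h2.
  by rewrite h2 h1.
- by move=> x; rewrite mulr_ge0 ?sqr_ge0.
- by move=> x; rewrite ler_wpM2l ?sqr_ge0.
- by rewrite -mulr_sumr ler_piMr ?sqr_ge0.
- exact: ltW.
have p2 : 0 <= p%:R * (M ^+ 2 * ss) by rewrite mulr_ge0 ?ler0n.
rewrite lerXn2r ?nnegrE //.
- by rewrite addr_ge0 // addr_ge0 ?(ltW t10) // mulr_ge0 ?sqr_ge0.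
- by rewrite mulr_ge0 ?(ltW t10).
rewrite natrM in PM; lra.
Qed.

End Quench.

Lemma expr_even_ge0 (R : realDomainType) (x : R) m : ~~ odd m -> 0 <= x ^+ m.
Proof.
move=> mo; rewrite -(odd_double_half m) (negPf mo) add0n -mul2n exprM.
by rewrite exprn_ge0 // sqr_ge0.
Qed.

(* The law of [dv] is a mixture over [k] of centred two-point laws of size
   [M * sqrt k] and mass [q / 2 ^ k]: its moments of order [m >= 3] dominate
   [(C * sqrt m) ^ m] while its variance is of order [q * M ^ 2]. *)
Section Law.
Variables (R : rcfType) (P : nat) (q M : R).
Hypotheses (q0 : 0 <= q) (q1 : q <= 1) (M0 : 0 <= M).
Local Notation O := ('I_P.+1 * bool)%type.

Definition pk (k : nat) : R :=
  if k == 0%N then 1 - q * (1 - (2 ^+ P)^-1) else q * (2 ^+ k)^-1.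
Definition kd (o : O) : R := pk o.1 * (if o.2 then 3^-1 else 2 / 3).
Definition dv (o : O) : R := M * Num.sqrt (o.1 : nat)%:R * (if o.2 then 2 else -1).
Definition ky (x : bool * O) : R := 2^-1 * kd x.2.
Definition av (x : bool * O) : R := if x.1 then 1 else -1.
Definition dl m := \sum_o kd o * dv o ^+ m.

Lemma pow2V_ge0 k : 0 <= (2 ^+ k)^-1 :> R.
Proof. by rewrite invr_ge0 exprn_ge0. Qed.

Lemma pow2V_le1 k : (2 ^+ k)^-1 <= 1 :> R.
Proof. by rewrite invf_le1 ?exprn_gt0 // exprn_ege1 // ler1n. Qed.

Lemma pk_ge0 k : 0 <= pk k.
Proof.
rewrite /pk; case: eqP => _; last by rewrite mulr_ge0 ?pow2V_ge0.
rewrite subr_ge0; apply: mulr_ile1 => //; rewrite ?subr_ge0 ?pow2V_le1 //.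
Qed.

Lemma sum_pow2V k : \sum_(i < k) (2 ^+ i.+1)^-1 = 1 - (2 ^+ k)^-1 :> R.
Proof.
elim: k => [|k IH]; first by rewrite big_ord0 expr0 invr1 subrr.
rewrite big_ord_recr IH /= exprS invfM.
by move: ((2 ^+ k)^-1) => a; field.
Qed.

Lemma sum_pk : \sum_(k < P.+1) pk k = 1.
Proof.
rewrite big_ord_recl.
have -> : \sum_(i < P) pk (lift ord0 i) = q * \sum_(i < P) (2 ^+ i.+1)^-1.
  by rewrite mulr_sumr; apply: eq_bigr.
by rewrite sum_pow2V /pk /= subrK.
Qed.

Lemma sum_O (F : O -> R) : \sum_o F o = \sum_k (F (k, true) + F (k, false)).
Proof.
transitivity (\sum_(p : O) F (p.1, p.2)); first by apply: eq_bigr => -[].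
rewrite -(pair_bigA _ (fun k b => F (k, b))) /=; apply: eq_bigr => k _.
by rewrite big_bool.
Qed.

Lemma sum_yO (F : bool * O -> R) : \sum_x F x = \sum_o (F (true, o) + F (false, o)).
Proof.
transitivity (\sum_(p : bool * O) F (p.1, p.2)); first by apply: eq_bigr => -[].
rewrite -(pair_bigA _ (fun b o => F (b, o))) /= big_bool /=.
by rewrite big_split.
Qed.

Lemma kd_ge0 o : 0 <= kd o.
Proof. by rewrite mulr_ge0 ?pk_ge0 //; case: o.2; rewrite ?invr_ge0 ?divr_ge0. Qed.

Lemma sum_kd : \sum_o kd o = 1.
Proof. by rewrite sum_O -[RHS]sum_pk; apply: eq_bigr => k _; rewrite /kd /=; field. Qed.

Lemma ky_ge0 x : 0 <= ky x.
Proof. by rewrite mulr_ge0 ?kd_ge0 ?invr_ge0. Qed.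

Lemma sum_ky : \sum_x ky x = 1.
Proof. by rewrite sum_yO -[RHS]sum_kd; apply: eq_bigr => o _; rewrite /ky /=; field. Qed.

Lemma dlE m : dl m = \sum_(k < P.+1) pk k * (M * Num.sqrt k%:R) ^+ m * ((2 ^+ m + 2 * (-1) ^+ m) / 3).
Proof.
rewrite /dl sum_O; apply: eq_bigr => k _; rewrite /kd /dv /=.
by rewrite ![(_ * _ * _) ^+ m]exprMn; field.
Qed.

Lemma dl0 : dl 0 = 1.
Proof. by rewrite /dl; under eq_bigr do rewrite expr0 mulr1; exact: sum_kd. Qed.

Lemma dl1 : dl 1 = 0.
Proof. by rewrite dlE; apply: big1 => k _; rewrite !expr1; ring. Qed.

(** This is a moment of the centred law on 2 and -1 with masses 1/3 and 2/3. The asymmetry is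
    deliberate: odd moments of [xi] must be dominated too, and those of a symmetric law vanish. *)
Lemma skew_ge0 m : (0 < m)%N -> 0 <= (2 ^+ m + 2 * (-1) ^+ m) / 3 :> R.
Proof.
case: m => // m _; rewrite divr_ge0 // exprS.
have : 1 <= 2 ^+ m :> R by rewrite exprn_ege1 // ler1n.
by rewrite -signr_odd; case: odd => /=; rewrite ?expr1 ?expr0; lra.
Qed.

Lemma dl_ge0 m : 0 <= dl m.
Proof.
case: m => [|m]; first by rewrite dl0.
rewrite dlE; apply: sumr_ge0 => k _; rewrite mulr_ge0 ?skew_ge0 //.
by rewrite mulr_ge0 ?pk_ge0 // exprn_ge0 // mulr_ge0 ?sqrtr_ge0.
Qed.

(** Only the component [k = m] is kept: its size contains [sqrt m], and its mass [q / 2 ^ m] turns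
    [M] into [M / 2]. *)
Lemma dl_lower m : (3 <= m)%N -> (m <= P)%N -> q * (M / 2) ^+ m * Num.sqrt m%:R ^+ m <= dl m.
Proof.
move=> m3 mP; rewrite dlE.
have mP1 : (m < P.+1)%N by rewrite ltnS.
rewrite (bigD1 (Ordinal mP1)) //= -[leLHS]addr0; apply: lerD; last first.
  apply: sumr_ge0 => k _; rewrite mulr_ge0 ?skew_ge0 //; last by lia.
  by rewrite mulr_ge0 ?pk_ge0 // exprn_ge0 // mulr_ge0 ?sqrtr_ge0.
have m0 : m == 0%N = false by apply/eqP; lia.
rewrite /pk m0 exprMn [(_ * Num.sqrt _) ^+ _]exprMn exprVn.
have h : 1 <= (2 ^+ m + 2 * (-1) ^+ m) / 3 :> R.
  rewrite ler_pdivlMr // mul1r; have -> : m = (3 + (m - 3))%N by lia.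
  rewrite exprD; have : 1 <= 2 ^+ (m - 3) :> R by rewrite exprn_ege1 // ler1n.
  by rewrite -signr_odd; case: odd => /=; rewrite ?expr1 ?expr0; lra.
have -> : q * (M ^+ m * (2 ^+ m)^-1) * Num.sqrt m%:R ^+ m = q * (2 ^+ m)^-1 * (M ^+ m * Num.sqrt m%:R ^+ m) by ring.
apply: ler_peMr => //.
by rewrite !mulr_ge0 ?pow2V_ge0 ?exprn_ge0 ?sqrtr_ge0.
Qed.

(** In the binomial expansion the odd moments of the sign vanish and all other terms are
    nonnegative, so any single one is a lower bound. *)
Lemma ymom_ge m i : ~~ odd i -> (i <= m)%N ->
  dl (m - i) * 'C(m, i)%:R <= \sum_x ky x * (av x + dv x.2) ^+ m.
Proof.
move=> io im.
have -> : \sum_x ky x * (av x + dv x.2) ^+ m =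
   \sum_(i < m.+1) dl (m - i) * 'C(m, i)%:R * ((1 + (-1) ^+ i) / 2).
  rewrite sum_yO; under [RHS]eq_bigr do rewrite /dl mulr_suml mulr_suml.
  rewrite [RHS]exchange_big; apply: eq_bigr => o _; rewrite /ky /av /=.
  rewrite ![_ + dv o]addrC !exprDn !mulr_sumr -big_split /=; apply: eq_bigr => j _.
  rewrite expr1n -[_ * 1 *+ _]mulr_natr -[_ * (-1) ^+ j *+ _]mulr_natr.
  move: (kd o) (dv o ^+ _) ((-1) ^+ j) ('C(m, j)%:R) => a b c e.
  by field.
have im1 : (i < m.+1)%N by rewrite ltnS.
rewrite (bigD1 (Ordinal im1)) //= -[leLHS]addr0; apply: lerD.
  by rewrite -signr_odd (negPf io) expr0 (_ : (1 + 1) / 2 = 1) ?mulr1 //; field.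
apply: sumr_ge0 => j _; apply: mulr_ge0; first by rewrite mulr_ge0 ?dl_ge0 ?ler0n.
rewrite divr_ge0 //.
by rewrite -signr_odd; case: odd => /=; rewrite ?expr1 ?expr0; lra.
Qed.

Lemma amom m : \sum_x ky x * av x ^+ m = (~~ odd m)%:R.
Proof.
rewrite sum_yO; transitivity (\sum_o kd o * (~~ odd m)%:R).
  apply: eq_bigr => o _; rewrite /ky /av /= expr1n -signr_odd.
  by case: odd; rewrite /= ?expr1 ?expr0; field.
by rewrite -mulr_suml sum_kd mul1r.
Qed.

Lemma pow_diff_le (k : nat) j : k.+1%:R ^+ j.+1 <= k%:R ^+ j.+1 + j.+1%:R * k.+1%:R ^+ j :> R.
Proof.
elim: j => [|j IH]; first by rewrite !expr1 expr0 mul1r natr1.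
rewrite exprS (le_trans (ler_wpM2l _ IH)) ?ler0n //.
have h : k%:R ^+ j.+1 <= k.+1%:R ^+ j.+1 :> R by rewrite lerXn2r ?nnegrE ?ler0n ?ler_nat.
rewrite [in leRHS]exprS -[j.+2%:R]natr1 [in leRHS]mulrDl mul1r mulrDr.
have -> : k.+1%:R * (j.+1%:R * k.+1%:R ^+ j) = j.+1%:R * k.+1%:R ^+ j.+1 :> R by rewrite exprS; ring.
have -> : k.+1%:R * k%:R ^+ j.+1 = k%:R * k%:R ^+ j.+1 + k%:R ^+ j.+1 :> R by rewrite -natr1; ring.
by lra.
Qed.

Definition Aj j : R := \sum_(k < P) (2 ^+ k.+1)^-1 * k.+1%:R ^+ j.

(** Summation by parts: shifting the index halves the weights, and [pow_diff_le] bounds the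
    increments of the power. *)
Lemma Aj_rec j : Aj j.+1 <= 2 * j.+1%:R * Aj j.
Proof.
have h : Aj j.+1 <= 2^-1 * Aj j.+1 + j.+1%:R * Aj j; last by lra.
apply: (@le_trans _ _ (\sum_(k < P) (2 ^+ k.+1)^-1 * k%:R ^+ j.+1 + j.+1%:R * Aj j)).
  rewrite /Aj mulr_sumr -big_split; apply: ler_sum => k _ /=.
  apply: (le_trans (ler_wpM2l (pow2V_ge0 _) (pow_diff_le k j))).
  by rewrite mulrDr lerD2l le_eqVlt; apply/orP; left; apply/eqP; ring.
rewrite lerD2r /Aj; case: (P) => [|p]; first by rewrite !big_ord0 mulr0.
rewrite big_ord_recl /= expr0n /= mulr0 add0r mulr_sumr [leRHS]big_ord_recr /=.
rewrite -[leLHS]addr0; apply: lerD; last by rewrite !mulr_ge0 ?pow2V_ge0 ?exprn_ge0 ?ler0n ?invr_ge0.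
apply: ler_sum => k _; rewrite /bump /= add1n exprS invfM.
by rewrite mulrA.
Qed.

(** Geometric moments of order [j] grow like a factorial, that is, like Gaussian moments of order
    [2 j]. Sizes [sqrt k] with geometric masses thus remain comparable with a Gaussian. *)
Lemma Aj_le j : Aj j <= 2 ^+ j * gam R (2 * j).
Proof.
elim: j => [|j IH].
  rewrite muln0 /= expr0 mulr1 /Aj; under eq_bigr do rewrite expr0 mulr1.
  by rewrite sum_pow2V lerBlDr lerDl pow2V_ge0.
apply: (le_trans (Aj_rec j)).
have -> : (2 * j.+1 = (2 * j).+2)%N by lia.
have g0 := gam_ge0 R (2 * j).
have e0 : 0 <= 2 ^+ j :> R by rewrite exprn_ge0.
have jl : j.+1%:R <= (2 * j).+1%:R :> R by rewrite ler_nat; lia.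
rewrite exprS [gam _ _]/= -!mulrA ler_pM2l // [leRHS]mulrCA.
apply: ler_pM => //.
by apply: sumr_ge0 => k _; rewrite mulr_ge0 ?pow2V_ge0 ?exprn_ge0 ?ler0n.
Qed.

Lemma dl_upper j : dl (2 * j.+1) <= q * (4 * M) ^+ (2 * j.+1) * gam R (2 * j.+1).
Proof.
rewrite dlE; set m := (2 * j.+1)%N.
have m0 : (m == 0%N) = false by [].
rewrite big_ord_recl sqrtr0 mulr0 expr0n m0 mulr0 mul0r add0r.
have m1 : (-1) ^+ m = 1 :> R by rewrite /m exprM -signr_odd /= expr0 expr1n.
rewrite m1 mulr1.
have t2 : 1 <= 2 ^+ m :> R by rewrite exprn_ege1 // ler1n.
apply: (@le_trans _ _ (\sum_(k < P) q * M ^+ m * 2 ^+ m * ((2 ^+ k.+1)^-1 * k.+1%:R ^+ j.+1))).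
  apply: ler_sum => k _; rewrite lift0 /pk [_ == 0%N]/= exprMn.
  have -> : Num.sqrt k.+1%:R ^+ m = k.+1%:R ^+ j.+1 :> R.
    by rewrite /m exprM sqr_sqrtr ?ler0n.
  have -> : q * (2 ^+ k.+1)^-1 * (M ^+ m * k.+1%:R ^+ j.+1) * ((2 ^+ m + 2) / 3) =
    (q * M ^+ m * ((2 ^+ k.+1)^-1 * k.+1%:R ^+ j.+1)) * ((2 ^+ m + 2) / 3) by ring.
  have -> : q * M ^+ m * 2 ^+ m * ((2 ^+ k.+1)^-1 * k.+1%:R ^+ j.+1) =
    (q * M ^+ m * ((2 ^+ k.+1)^-1 * k.+1%:R ^+ j.+1)) * 2 ^+ m by ring.
  rewrite ler_wpM2l //; last by rewrite ler_pdivrMr //; lra.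
  by rewrite !mulr_ge0 ?pow2V_ge0 ?exprn_ge0 ?ler0n.
rewrite -mulr_sumr.
apply: (@le_trans _ _ (q * M ^+ m * 2 ^+ m * (2 ^+ m * gam R m))).
  rewrite ler_wpM2l ?mulr_ge0 ?exprn_ge0 // (le_trans (Aj_le _)) //.
  by rewrite ler_wpM2r ?gam_ge0 // ler_weXn2l ?ler1n // /m; lia.
rewrite le_eqVlt; apply/orP; left; apply/eqP.
have -> : (4 * M) ^+ m = 2 ^+ m * 2 ^+ m * M ^+ m.
  by rewrite -!exprMn; congr (_ ^+ _); ring.
by move: (2 ^+ m) (M ^+ m) (gam R m) => a b c; ring.
Qed.

(** Odd orders cancel by exchanging the two copies. For even orders 16 = 4 * 2 * 2: the 4 of
    [dl_upper], a 2 from the power of a difference, and a 2 that absorbs the remaining factor 2, as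
    [2 <= 2 ^ m]. *)
Lemma d2mom_le m : \sum_x \sum_y ky x * ky y * (dv x.2 - dv y.2) ^+ m <= zeta q (16 * M) m.
Proof.
rewrite /zeta; case: eqP => [->|/eqP m0].
  under eq_bigr do under eq_bigr do rewrite expr0 mulr1.
  by under eq_bigr do rewrite -mulr_sumr sum_ky mulr1; rewrite sum_ky.
have [mo|me] := boolP (odd m).
  rewrite gam_odd // mulr0.
  suff : \sum_x \sum_y ky x * ky y * (dv x.2 - dv y.2) ^+ m =
    - \sum_x \sum_y ky x * ky y * (dv x.2 - dv y.2) ^+ m by lra.
  rewrite {1}exchange_big -sumrN; apply: eq_bigr => x _; rewrite -sumrN; apply: eq_bigr => y _.
  by rewrite -opprB exprNn -signr_odd mo expr1; ring.
have dlk : \sum_x ky x * dv x.2 ^+ m = dl m.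
  by rewrite sum_yO; apply: eq_bigr => o _; rewrite /ky /=; field.
have key (a b : R) : (a - b) ^+ m <= 2 ^+ m * (a ^+ m + b ^+ m).
  have ev (z : R) : z ^+ m = `|z| ^+ m.
    by rewrite -normrX ger0_norm // expr_even_ge0.
  rewrite ev (ev a) (ev b).
  have t : `|a - b| <= `|a| + `|b| by exact: ler_normB.
  apply: (le_trans (lerXn2r _ _ _ t)); rewrite ?nnegrE ?addr_ge0 //.
  case: (leP `|a| `|b|) => ab.
    apply: (@le_trans _ _ ((2 * `|b|) ^+ m)).
      by rewrite lerXn2r ?nnegrE ?addr_ge0 ?mulr_ge0 //; lra.
    by rewrite exprMn ler_wpM2l ?exprn_ge0 // lerDr exprn_ge0.
  apply: (@le_trans _ _ ((2 * `|a|) ^+ m)).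
    by rewrite lerXn2r ?nnegrE ?addr_ge0 ?mulr_ge0 //; lra.
  by rewrite exprMn ler_wpM2l ?exprn_ge0 // lerDl exprn_ge0.
apply: (@le_trans _ _ (\sum_x \sum_y ky x * ky y * (2 ^+ m * (dv x.2 ^+ m + dv y.2 ^+ m)))).
  apply: ler_sum => x _; apply: ler_sum => y _; apply: ler_wpM2l; [by rewrite mulr_ge0 ?ky_ge0|exact: key].
have -> : \sum_x \sum_y ky x * ky y * (2 ^+ m * (dv x.2 ^+ m + dv y.2 ^+ m)) = 2 ^+ m * (2 * dl m).
  transitivity (\sum_x (2 ^+ m * (ky x * dv x.2 ^+ m) + 2 ^+ m * (ky x * dl m))).
    apply: eq_bigr => x _; rewrite -dlk.
    transitivity (2 ^+ m * (ky x * dv x.2 ^+ m) * (\sum_y ky y) + 2 ^+ m * (ky x * \sum_y ky y * dv y.2 ^+ m)).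
      rewrite [ky x * \sum_y _]mulr_sumr !mulr_sumr -big_split; apply: eq_bigr => y _ /=; ring.
    by rewrite sum_ky mulr1.
  rewrite big_split -!mulr_sumr -mulr_suml /= dlk sum_ky; ring.
have -> : m = (2 * (m./2.-1.+1))%N by rewrite -[LHS]odd_double_half (negPf me); lia.
set j := m./2.-1.
apply: (@le_trans _ _ (2 ^+ (2 * j.+1) * (2 * (q * (4 * M) ^+ (2 * j.+1) * gam R (2 * j.+1))))).
  by rewrite ler_wpM2l ?exprn_ge0 // ler_wpM2l // dl_upper.
set k := (2 * j.+1)%N.
have t2 : 2 <= 2 ^+ k :> R by rewrite -[leLHS]expr1 ler_weXn2l ?ler1n // /k; lia.
have -> : (16 * M) ^+ k = 2 ^+ k * 2 ^+ k * (4 * M) ^+ k.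
  by rewrite -!exprMn; congr (_ ^+ _); ring.
have -> : q * (2 ^+ k * 2 ^+ k * (4 * M) ^+ k) * gam R k =
   2 ^+ k * (2 ^+ k * (q * (4 * M) ^+ k * gam R k)).
  by move: (2 ^+ k) ((4 * M) ^+ k) (gam R k) => a b c; ring.
rewrite ler_wpM2l ?exprn_ge0 // ler_wpM2r //.
apply: mulr_ge0; last exact: gam_ge0.
by apply: mulr_ge0 => //; apply: exprn_ge0; exact: mulr_ge0.
Qed.

End Law.

(** The sign part has squared norm about [4 + 14 al], and the perturbation is made so small that
    even after amplification its squared norm is at most 4. The power [n ^ 4] is the product of the
    factor of the separation, that of Jensen, and the [n ^ 2] of [tmom_zeta_le]. *)
Proposition tmom_upper (R : rcfType) (C ep : R) : 0 < C -> 0 < ep -> ep <= 1 ->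
  exists2 c : R, 0 < c & forall n (sg : 'I_n * 'I_n -> R) (mu : nat -> R) l P,
    P = (2 ^ l.+1)%N -> (forall e, 0 <= sg e) ->
    (forall u, \sum_x sg (edge u x) ^+ 2 <= 1) -> (forall e, P%:R * sg e ^+ 2 <= c) ->
    mu 0%N = 1 -> mu 1%N = 0 -> mu 2%N = 1 ->
    (forall m, (3 <= m)%N -> `|mu m| <= (C * Num.sqrt m%:R) ^+ m) ->
    tmom mu sg P <= 4 * n%:R ^+ 4 * (2 + ep) ^+ P.
Proof.
move=> C0 ep0 ep1.
(* Small enough for [(1 + t)^2 (4 + 14 al) <= (2 + ep)^2]. *)
pose t := ep / 8; pose al := ep / 16.
have t0 : 0 < t by rewrite divr_gt0.
have al0 : 0 < al by rewrite divr_gt0.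
have al1 : al <= 1 by rewrite /al ler_pdivrMr //; lra.
have ti0 : 0 < 1 + t^-1 by rewrite addr_gt0 // invr_gt0.
(* Solves [(1 + 1/t)^2 * 54 t1 = 4], where [54 t1] is the rate in [tmom_zeta_le]. *)
pose t1 := 4 / 54 / (1 + t^-1) ^+ 2.
have t10 : 0 < t1 by rewrite !divr_gt0 // exprn_gt0.
have t1E : (1 + t^-1) ^+ 2 * (54 * t1) = 4.
  by rewrite /t1; move: (1 + t^-1) ti0 => z z0; field; rewrite lt0r_neq0.
have bal : (1 + t) ^+ 2 * (4 + 14 * al) <= (2 + ep) ^+ 2.
  have e3 : ep ^+ 3 <= ep by rewrite exprS ler_piMr ?(ltW ep0) // exprn_ile1 // ltW.
  have -> : (1 + t) ^+ 2 * (4 + 14 * al) =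
      4 + 15 / 8 * ep + 9 / 32 * ep ^+ 2 + 7 / 512 * ep ^+ 3 by rewrite /t /al; field.
  have -> : (2 + ep) ^+ 2 = 4 + 4 * ep + ep ^+ 2 by ring.
  by have := sqr_ge0 ep; lra.
pose e1 := t1 / 256.
have e10 : 0 < e1 by rewrite divr_gt0.
(* One summand for each requirement: positivity of [M], [e1 <= M] for [q <= 1], [2 C <= M] and
   [8 C^3 <= M e1]. *)
pose M := 1 + e1 + 2 * C + 8 * C ^+ 3 / e1.
have c3 : 0 < 8 * C ^+ 3 / e1 by rewrite divr_gt0 // mulr_gt0 // exprn_gt0.
have M1 : 1 <= M by rewrite /M; lra.
have M0 : 0 < M by lra.
have MC : 2 * C <= M by rewrite /M; lra.
have MC3 : 8 * C ^+ 3 <= M * e1.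
  by rewrite -ler_pdivrMr // /M; lra.
pose q := e1 / M ^+ 2.
have M20 : 0 < M ^+ 2 by rewrite exprn_gt0.
have q0 : 0 <= q by rewrite ltW // divr_gt0.
have q1 : q <= 1.
  rewrite ler_pdivrMr // mul1r; have h : e1 <= M by rewrite /M; lra.
  by rewrite expr2 (le_trans h) // ler_peMl // ltW.
have qM : q * (16 * M) ^+ 2 <= t1.
  have -> : q * (16 * M) ^+ 2 = 256 * e1 by rewrite /q; field; rewrite lt0r_neq0.
  by rewrite /e1 mulrC divfK ?pnatr_eq0.
have HC m : (3 <= m)%N -> C ^+ m <= q * (M / 2) ^+ m.
  move=> m3; have C20 : 0 < 2 * C by rewrite mulr_gt0.
  have -> : m = (3 + (m - 3))%N by rewrite subnKC.
  (* With [q M^2 = e1] fixed and small, [q M^3 = e1 M] is as large as desired. Higher orders then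
     follow from [C <= M / 2]. *)
  have h1 : C ^+ 3 <= q * (M / 2) ^+ 3.
    have -> : q * (M / 2) ^+ 3 = M * e1 / 8 by rewrite /q; field; rewrite lt0r_neq0.
    by rewrite ler_pdivlMr // mulrC.
  rewrite !exprD mulrA; apply: ler_pM; rewrite ?exprn_ge0 ?(ltW C0) //.
  have : C <= M / 2 by rewrite ler_pdivlMr // mulrC.
  by move=> h; rewrite lerXn2r ?nnegrE ?(ltW C0) ?divr_ge0 ?(ltW M0).
pose c := Num.min (al ^+ 2) (t1 / (16 * M) ^+ 2).
have M16 : 0 < (16 * M) ^+ 2 by rewrite exprn_gt0 // mulr_gt0.
exists c; first by rewrite lt_min exprn_gt0 // divr_gt0.
move=> n sg mu l P PE sg0 sgr sgc mu0 mu1 mu2 mub.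
have P0 : (0 < P)%N by rewrite PE expn_gt0.
have Pr0 : 0 < P%:R :> R by rewrite ltr0n.
pose ss := c / P%:R.
have sgss e : sg e ^+ 2 <= ss by rewrite ler_pdivlMr // mulrC.
have Pss : P%:R * ss = c by rewrite /ss mulrC divfK // lt0r_neq0.
have dom : `|tmom mu sg P| <= tmom (fun m => \sum_(x : bool * ('I_P.+1 * bool)) ky q x * (av R x + dv M x.2) ^+ m) sg P.
  apply: (le_tmom (N := P)) => // m mP.
  (* Up to order 2 the sign suffices, the first moment being 0; from order 3 on only the
     perturbation is used. *)
  have [m3|] := leqP 3 m; last first.
    have yg := @ymom_ge R P q M q0 q1 (ltW M0) m.
    case: m mP yg => [|[|[|m]]] // mP yg _.
    - by rewrite mu0 normr1; have := yg 0%N isT isT; rewrite dl0 // bin0 mulr1.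
    - by rewrite mu1 normr0; have := yg 0%N isT isT; rewrite dl1 // mul0r.
    - by rewrite mu2 normr1; have := yg 2%N isT isT; rewrite dl0 // binn mulr1.
  apply: (le_trans (mub m m3)); rewrite exprMn.
  apply: (@le_trans _ _ (dl P q M m)); last first.
    by have := @ymom_ge R P q M q0 q1 (ltW M0) m 0 isT isT; rewrite subn0 bin0 mulr1.
  apply: le_trans (dl_lower q0 q1 (ltW M0) m3 mP).
  by rewrite ler_wpM2r ?exprn_ge0 ?sqrtr_ge0 // HC.
apply: (le_trans (ler_norm _)); apply: (le_trans dom).
apply: (le_trans (@tmom_add_le R n _ (@ky R P q) (ky_ge0 q0 q1) (sum_ky _ _) (@av R P)
   (fun x => dv M x.2) sg l P t _ t0 PE)).
  rewrite sum_yO -[RHS](dl1 P q M) /dl; apply: eq_bigr => o _.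
  by rewrite /ky /= expr1; field.
have hA : tmom (fun m => \sum_(x : bool * ('I_P.+1 * bool)) ky q x * av R x ^+ m) sg P <=
    2 * n%:R * Num.sqrt (4 + 14 * al) ^+ P.
  have := @wick_trace_le R n (fun e => sg e ^+ 2) (mom (fun m => \sum_(x : bool * ('I_P.+1 * bool)) ky q x * av R x ^+ m) sg)
     al ss 1 P.
  have am m : \sum_(x : bool * ('I_P.+1 * bool)) ky q x * av R x ^+ m = (~~ odd m)%:R by exact: amom.
  rewrite mom_nil ?am // !mulr1; apply => //.
  - by rewrite divr_ge0 // le_min sqr_ge0 divr_ge0 // ltW.
  - by rewrite Pss /c ge_min lexx.
  - by move=> e; exact: sqr_ge0.
  - exact: mom_perm.
  - by move=> l'; apply: mom_ge0 => // m; rewrite am ler0n.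
  - move=> e l'; apply: mom_wick => // m; rewrite !am ?ler0n //.
    case: m => [|m] /=; first by rewrite mul0r.
    by rewrite negbK; case: odd; rewrite ?mulr0 ?mulr1 ?ler1n.
have hD : tmom (fun m => \sum_(x : bool * ('I_P.+1 * bool)) \sum_(y : bool * ('I_P.+1 * bool)) ky q x * ky q y * (dv M x.2 - dv M y.2) ^+ m) sg P <=
    2 * n%:R ^+ 2 * (54 * t1) ^+ (2 ^ l).
  apply: (@le_trans _ _ (tmom (zeta q (16 * M)) sg P)).
    apply: le_trans (ler_norm _) _; apply: (le_tmom (N := P)) => // m _.
    rewrite ger0_norm ?d2mom_le //; first exact: ltW.
    have [mo|me] := boolP (odd m).
      suff : \sum_(x : bool * ('I_P.+1 * bool)) \sum_(y : bool * ('I_P.+1 * bool)) ky q x * ky q y * (dv M x.2 - dv M y.2) ^+ m =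
        - \sum_(x : bool * ('I_P.+1 * bool)) \sum_(y : bool * ('I_P.+1 * bool)) ky q x * ky q y * (dv M x.2 - dv M y.2) ^+ m by lra.
      rewrite {1}exchange_big -sumrN; apply: eq_bigr => x _; rewrite -sumrN; apply: eq_bigr => y _.
      by rewrite -opprB exprNn -signr_odd mo expr1; ring.
    apply: sumr_ge0 => x _; apply: sumr_ge0 => y _.
    by rewrite mulr_ge0 ?expr_even_ge0 // mulr_ge0 ?ky_ge0.
  rewrite PE expnS; apply: (@tmom_zeta_le R n sg q (16 * M) ss) => //.
  - by rewrite mulr_ge0 // ltW.
  - by rewrite expn_gt0.
  - rewrite -expnS -PE mulrCA Pss -ler_pdivlMl // mulrC /c ge_min lexx orbT //.
have [n0|n0] := posnP n.
  have n0' : n%:R = 0 :> R by rewrite n0.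
  by rewrite n0' expr0n /= mulr0 !mul0r.
have n1 : 1 <= n%:R :> R by rewrite ler1n.
have T0 : 0 <= (2 + ep) ^+ P by rewrite exprn_ge0 // addr_ge0 // ltW.
have bA : (1 + t) ^+ P * Num.sqrt (4 + 14 * al) ^+ P <= (2 + ep) ^+ P.
  have s0 : 0 <= (1 + t) * Num.sqrt (4 + 14 * al) by rewrite mulr_ge0 ?sqrtr_ge0 //; lra.
  rewrite -exprMn lerXn2r ?nnegrE //; first by lra.
  rewrite -(@ler_pXn2r _ 2) ?nnegrE //; last by lra.
  by rewrite exprMn sqr_sqrtr //; lra.
have bD : (1 + t^-1) ^+ P * (54 * t1) ^+ (2 ^ l) <= (2 + ep) ^+ P.
  rewrite PE expnS exprM -exprMn t1E exprM lerXn2r ?nnegrE //.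
    by rewrite sqr_ge0.
  have -> : (2 + ep) ^+ 2 = 4 + 4 * ep + ep ^+ 2 by ring.
  by have := sqr_ge0 ep; lra.
have tp : 0 <= (1 + t) ^+ P by rewrite exprn_ge0 //; lra.
have tip : 0 <= (1 + t^-1) ^+ P by rewrite exprn_ge0 // ltW.
apply: (@le_trans _ _ (n%:R * ((1 + t) ^+ P * (2 * n%:R * Num.sqrt (4 + 14 * al) ^+ P) +
    (1 + t^-1) ^+ P * (n%:R * (2 * n%:R ^+ 2 * (54 * t1) ^+ (2 ^ l)))))).
  rewrite ler_wpM2l ?ler0n // lerD // ler_wpM2l // ler_wpM2l ?ler0n //.
have -> : n%:R * ((1 + t) ^+ P * (2 * n%:R * Num.sqrt (4 + 14 * al) ^+ P) +
    (1 + t^-1) ^+ P * (n%:R * (2 * n%:R ^+ 2 * (54 * t1) ^+ (2 ^ l)))) =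
  2 * n%:R ^+ 2 * ((1 + t) ^+ P * Num.sqrt (4 + 14 * al) ^+ P) +
  2 * n%:R ^+ 4 * ((1 + t^-1) ^+ P * (54 * t1) ^+ (2 ^ l)).
  move: ((1 + t) ^+ P) (Num.sqrt _ ^+ P) ((1 + t^-1) ^+ P) ((54 * t1) ^+ _) => a b c' d; ring.
have n24 : n%:R ^+ 2 <= n%:R ^+ 4 :> R by rewrite ler_weXn2l.
have n40 : 0 <= n%:R ^+ 4 :> R by rewrite exprn_ge0 ?ler0n.
have n20 : 0 <= n%:R ^+ 2 :> R by rewrite exprn_ge0 ?ler0n.
have -> : 4 * n%:R ^+ 4 * (2 + ep) ^+ P = 2 * n%:R ^+ 4 * (2 + ep) ^+ P + 2 * n%:R ^+ 4 * (2 + ep) ^+ P.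
  by move: ((2 + ep) ^+ P) => a; ring.
apply: lerD; last by rewrite ler_wpM2l // mulr_ge0.
apply: (@le_trans _ _ (2 * n%:R ^+ 2 * (2 + ep) ^+ P)); first by rewrite ler_wpM2l // mulr_ge0.
by rewrite ler_wpM2r // ler_wpM2l.
Qed.

(** * Self-avoiding walks *)

Section SelfAvoiding.
Variables (R : rcfType) (n : nat).
Local Notation E := ('I_n * 'I_n)%type.
Local Notation fn := ('I_n -> seq E -> R).
Implicit Types (u v x y : 'I_n) (U : seq 'I_n) (l : seq E) (g h : fn).

(* Sum of [g endpoint edges] over the self-avoiding walks of length [k] from [u]
   that avoid [U]. *)
Fixpoint saw k u U g : R :=
  if k is k'.+1 then
    \sum_(x | x \notin u :: U) saw k' x (u :: U) (fun v l => g v (edge u x :: l))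
  else g u [::].

Definition avoids U v l := (v \notin U) && all (fun e : E => (e.1 \notin U) && (e.2 \notin U)) l.

Lemma edge_avoid U u x : u \notin U -> x \notin U ->
  ((edge u x).1 \notin U) && ((edge u x).2 \notin U).
Proof. by rewrite /edge; case: ifP => _ -> ->. Qed.

Lemma eq_saw_in k u U g h : u \notin U ->
  (forall v l, avoids U v l -> g v l = h v l) -> saw k u U g = saw k u U h.
Proof.
elim: k u U g h => [|k IH] u U g h uU gh /=; first by apply: gh; rewrite /avoids uU.
apply: eq_bigr => x xU; apply: IH => // v l /andP[].
rewrite inE negb_or => /andP[vu vU] al; apply: gh; rewrite /avoids vU /= edge_avoid //=.
  by apply: sub_all al => e; rewrite !inE !negb_or => /andP[/andP[_ ->] /andP[_ ->]].
by move: xU; rewrite inE negb_or => /andP[].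
Qed.

Lemma eq_saw k u U g h : (forall v l, g v l = h v l) -> saw k u U g = saw k u U h.
Proof.
elim: k u U g h => [|k IH] u U g h gh /=; first exact: gh.
by apply: eq_bigr => x xU; apply: IH => v l; exact: gh.
Qed.

Lemma saw_sum (I : Type) (r : seq I) (P : pred I) k u U (F : I -> fn) :
  saw k u U (fun v l => \sum_(i <- r | P i) F i v l) = \sum_(i <- r | P i) saw k u U (F i).
Proof.
elim: k u U F => [|k IH] u U F //=.
by under eq_bigr do rewrite IH; rewrite exchange_big.
Qed.

Lemma sawM k u U c g : saw k u U (fun v l => c * g v l) = c * saw k u U g.
Proof.
elim: k u U g => [|k IH] u U g //=.
by rewrite mulr_sumr; apply: eq_bigr => x _; rewrite IH.
Qed.

Lemma saw0 k u U : saw k u U (fun _ _ => 0) = 0.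
Proof. by elim: k u U => [|k IH] u U //=; rewrite big1. Qed.

Lemma sawD k u U g h : saw k u U (fun v l => g v l + h v l) = saw k u U g + saw k u U h.
Proof.
elim: k u U g h => [|k IH] u U g h //=.
by under eq_bigr do rewrite IH; rewrite big_split.
Qed.

Lemma sawB k u U g h : saw k u U (fun v l => g v l - h v l) = saw k u U g - saw k u U h.
Proof.
rewrite sawD; congr (_ + _); rewrite -mulN1r -sawM; apply: eq_saw => v l.
by rewrite mulN1r.
Qed.

Lemma saw_norm k u U g : `|saw k u U g| <= saw k u U (fun v l => `|g v l|).
Proof.
elim: k u U g => [|k IH] u U g //=.
by apply: (le_trans (ler_norm_sum _ _ _)); apply: ler_sum => x _; exact: IH.
Qed.

Lemma le_saw k u U g h : (forall v l, g v l <= h v l) -> saw k u U g <= saw k u U h.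
Proof.
elim: k u U g h => [|k IH] u U g h gh /=; first exact: gh.
by apply: ler_sum => x _; apply: IH => v l; exact: gh.
Qed.

Lemma saw_walks k u U g : (forall v l, 0 <= g v l) ->
  saw k u U g <= \sum_v walks k u v (g v).
Proof.
elim: k u U g => [|k IH] u U g g0 /=.
  by rewrite (bigD1 u) //= eqxx lerDl sumr_ge0 // => v _; case: ifP.
rewrite exchange_big [leRHS](bigID (fun x => x \notin u :: U)) /=.
rewrite -[leLHS]addr0; apply: lerD.
  by apply: ler_sum => x _; apply: IH => v l; exact: g0.
by apply: sumr_ge0 => x _; apply: sumr_ge0 => v _; apply: walks_ge0 => l; exact: g0.
Qed.

Variables (mu : nat -> R) (sg : E -> R).
Hypotheses (mu0 : mu 0%N = 1) (mu1 : mu 1%N = 0) (mu2 : mu 2%N = 1).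
Local Notation Em := (mom mu sg).

Lemma mom_single e l : e \notin l -> Em (e :: l) = 0.
Proof. by move=> el; rewrite mom_cons (count_memPn el) mu1 !mul0r. Qed.

Lemma mom_double e l : e \notin l -> Em (e :: e :: l) = sg e ^+ 2 * Em l.
Proof.
move=> el; rewrite mom_cons /= eqxx (count_memPn el) mu2 mul1r; congr (_ * _).
rewrite /mom [RHS](bigD1 e) //= (count_memPn el) mu0 mul1r expr0 mul1r.
by apply: eq_bigr => e' /negPf ne; rewrite eq_sym ne.
Qed.

(** The total squared weight of the self-avoiding walks. By [saw_same] it is the expected squared
    norm of the vector of their sums. *)
Fixpoint mass k u U : R :=
  if k is k'.+1 then \sum_(x | x \notin u :: U) sg (edge u x) ^+ 2 * mass k' x (u :: U) else 1.

Lemma avoids_edge u U v l x : avoids (u :: U) v l -> edge u x \notin l.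
Proof.
move=> /andP[_ /allP al]; apply/negP => /al; rewrite /edge.
by case: ifP => _ /=; rewrite !inE eqxx // andbF.
Qed.

Lemma edge_inj u x x' : edge u x = edge u x' -> x = x'.
Proof. by move=> /edge_eq [[]|[]] // h1 h2; rewrite h2. Qed.

Lemma avoids_v u U v l : avoids (u :: U) v l -> v != u.
Proof. by move=> /andP[]; rewrite inE negb_or => /andP[]. Qed.

Lemma avoids_edge_vv u U v l v' l' x :
  avoids (u :: U) v l -> avoids (u :: U) v' l' -> edge u x != edge v v'.
Proof.
move=> /avoids_v vu /avoids_v v'u; apply/eqP => /edge_eq [[h _]|[h _]].
  by rewrite h eqxx in vu.
by rewrite h eqxx in v'u.
Qed.

(** If the first steps differ, or only one walk moves on, the expectation vanishes or the ends
    disagree: later edges avoid [u], so a first edge that is not shared occurs once and [mu 1 = 0]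
    applies. A common first edge contributes [sg ^+ 2]. *)
Lemma saw_same k k' u U : u \notin U ->
  saw k u U (fun v l => saw k' u U (fun v' l' => (v == v')%:R * Em (l ++ l'))) =
  (k == k')%:R * mass k u U.
Proof.
elim: k k' u U => [|k IH] [|k'] u U uU /=.
- by rewrite eqxx mul1r mom_nil // mulr1.
- rewrite mul0r big1 // => x xU; rewrite -[RHS](saw0 k' x (u :: U)).
  apply: eq_saw_in => // v l /avoids_v; rewrite eq_sym => /negPf ->.
  by rewrite mul0r.
- rewrite mul0r big1 // => x xU; rewrite -[RHS](saw0 k x (u :: U)).
  by apply: eq_saw_in => // v l /avoids_v /negPf ->; rewrite mul0r.
rewrite mulr_sumr; apply: eq_bigr => x xU.
transitivity (saw k x (u :: U) (fun v l => saw k' x (u :: U) (fun v' l' =>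
   sg (edge u x) ^+ 2 * ((v == v')%:R * Em (l ++ l'))))).
  apply: eq_saw_in => // v l avl; rewrite (bigD1 x) //= [X in _ + X]big1 ?addr0.
    apply: eq_saw_in => // v' l' avl'; rewrite mulrCA; congr (_ * _).
    rewrite -mom_double; last by rewrite mem_cat negb_or (avoids_edge _ avl) (avoids_edge _ avl').
    by apply: mom_perm; rewrite perm_cons -cat1s perm_catCA.
  move=> x' /andP[x'U x'x]; rewrite -[RHS](saw0 k' x' (u :: U)).
  apply: eq_saw_in => // v' l' avl'; rewrite mom_single ?mulr0 // mem_cat inE !negb_or.
  rewrite (avoids_edge _ avl) /= (avoids_edge _ avl') /= andbT.
  by apply: contra_neq x'x => /edge_inj.
under eq_saw => v l do rewrite sawM.
by rewrite sawM IH // eqSS; ring.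
Qed.

(** From length 2 on, the added edge closes a cycle in which the first edge occurs only once. *)
Lemma saw_adj0 k u U : u \notin U ->
  saw k u U (fun v l => Em (edge u v :: l)) = (k == 1%N)%:R * mass 1 u U.
Proof.
case: k => [|[|k]] uU /=.
- by rewrite mul0r mom_single.
- rewrite mul1r; apply: eq_bigr => x _.
  by rewrite mulr1 mom_double // mom_nil // mulr1.
rewrite mul0r big1 // => x xU; rewrite big1 // => y yU.
rewrite -[RHS](saw0 k y (x :: u :: U)).
apply: eq_saw_in => // v l avl.
have vx := avoids_v avl.
have avl2 : avoids (u :: U) v l.
  move/andP: avl => [h1 h2]; apply/andP; split.
    by move: h1; rewrite inE negb_or => /andP[].
  by apply: sub_all h2 => e; rewrite ![_ \in x :: _]inE !negb_or => /andP[/andP[_ ->] /andP[_ ->]].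
rewrite (@mom_perm _ _ _ _ _ (edge u x :: edge u v :: edge x y :: l)).
  rewrite mom_single // !inE !negb_or (avoids_edge _ avl2) andbT.
  apply/andP; split; first by apply: contra_neq vx => /edge_inj ->.
  apply/eqP => /edge_eq [[h _]|[h _]].
    by move: xU; rewrite -h inE eqxx.
  by move: yU; rewrite -h !inE eqxx orbT.
by rewrite -[edge u v :: _]cat1s -[edge u x :: _]cat1s perm_catCA.
Qed.

(** As in [saw_same], the walks must share their steps while both go on; the linking edge must then
    double the last step of the longer walk. *)
Lemma saw_adj k k' u U : u \notin U ->
  saw k u U (fun v l => saw k' u U (fun v' l' => Em (edge v v' :: l ++ l'))) =
  (k' == k.+1)%:R * mass k' u U + (k == k'.+1)%:R * mass k u U.
Proof.
elim: k k' u U => [|k IH] k' u U uU.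
  rewrite [saw 0 _ _ _]/= saw_adj0 // [0%N == _]eq_sym /= mul0r addr0.
  by case: eqP => [->|_]; rewrite ?mul0r.
case: k' => [|k'].
  transitivity (saw k.+1 u U (fun v l => Em (edge u v :: l))).
    by apply: (@eq_saw k.+1) => v l; rewrite [saw 0 _ _ _]/= cats0 edgeC.
  rewrite saw_adj0 //= mul0r add0r.
  by case: eqP => [[->]|_]; rewrite ?mul0r.
rewrite /= !eqSS !mulr_sumr -big_split /=; apply: eq_bigr => x xU.
transitivity (saw k x (u :: U) (fun v l => saw k' x (u :: U) (fun v' l' =>
   sg (edge u x) ^+ 2 * Em (edge v v' :: l ++ l')))).
  apply: eq_saw_in => // v l avl; rewrite (bigD1 x) //= [X in _ + X]big1 ?addr0.
    apply: eq_saw_in => // v' l' avl'; rewrite -mom_double; last first.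
      rewrite inE mem_cat !negb_or (avoids_edge _ avl) (avoids_edge _ avl').
      by rewrite (avoids_edge_vv _ avl avl').
    apply: mom_perm; rewrite -[edge v v' :: edge u x :: _]cat1s -[_ :: _ :: edge v v' :: _]cat1s.
    rewrite -[edge u x :: l ++ _]cat1s perm_catCA /= perm_cons.
    rewrite -[edge u x :: l']cat1s -[edge u x :: _ :: _]cat1s -!cat_cons perm_sym.
    by rewrite perm_catCA.
  move=> x' /andP[x'U x'x]; rewrite -[RHS](saw0 k' x' (u :: U)).
  apply: eq_saw_in => // v' l' avl'.
  rewrite (@mom_perm _ _ _ _ _ (edge u x :: edge v v' :: l ++ edge u x' :: l')).
    rewrite mom_single // !inE mem_cat inE !negb_or.
    rewrite (avoids_edge _ avl) /= (avoids_edge _ avl') /= andbT (avoids_edge_vv _ avl avl') /=.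
    by apply: contra_neq x'x => /edge_inj.
  by rewrite -[edge v v' :: _]cat1s -[edge u x :: l ++ _]cat1s -[_ :: edge v v' :: _]cat1s perm_catCA.
under eq_saw => v l do rewrite sawM.
by rewrite sawM IH //; ring.
Qed.

Variable (ss : R).
Hypotheses (sgr : forall u, \sum_x sg (edge u x) ^+ 2 = 1) (sgss : forall e, sg e ^+ 2 <= ss).

Lemma mass_ge0 k u U : 0 <= mass k u U.
Proof.
elim: k u U => [|k IH] u U //=.
by apply: sumr_ge0 => x _; rewrite mulr_ge0 ?sqr_ge0.
Qed.

Lemma mass_le1 k u U : mass k u U <= 1.
Proof.
elim: k u U => [|k IH] u U //=; rewrite -(sgr u) [leRHS](bigID (fun x => x \notin u :: U)) /=.
rewrite -[leLHS]addr0; apply: lerD; last by apply: sumr_ge0 => x _; exact: sqr_ge0.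
by apply: ler_sum => x _; rewrite ler_piMr ?sqr_ge0.
Qed.

(** In each of the [k] steps at most [size U + k] vertices are forbidden, and each removes at most
    [ss] from a row sum equal to 1. *)
Lemma mass_lower k u U : 1 - (k * (size U + k))%:R * ss <= mass k u U.
Proof.
have ss0 : 0 <= ss by apply: le_trans (sgss (u, u)); exact: sqr_ge0.
elim: k u U => [|k IH] u U /=; first by rewrite mul0r subr0.
pose b : R := 1 - (k * ((size U).+1 + k))%:R * ss.
have hb : 1 - (k.+1 * (size U + k.+1))%:R * ss <= b.
  by rewrite lerD2l lerN2 ler_wpM2r // ler_nat; lia.
(* The bounds of the first step and of the rest are multiplied below, which needs [b] to be
   positive. *)
have [b0|b0] := leP b 0.
  by apply: (le_trans hb); apply: (le_trans b0); apply: (mass_ge0 k.+1).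
have S1 : 1 - (size U).+1%:R * ss <= \sum_(x | x \notin u :: U) sg (edge u x) ^+ 2.
  rewrite lerBlDr -[leLHS](sgr u) [leLHS](bigID (fun x => x \notin u :: U)) /= lerD2l.
  apply: (@le_trans _ _ (\sum_(x | ~~ (x \notin u :: U)) ss)); first by apply: ler_sum.
  rewrite sumr_const -[leLHS]mulr_natl ler_wpM2r // ler_nat.
  have -> : #|[pred x | ~~ (x \notin u :: U)]| = #|mem (u :: U)|.
    by apply: eq_card => x; rewrite inE negbK.
  exact: card_size.
apply: (@le_trans _ _ ((\sum_(x | x \notin u :: U) sg (edge u x) ^+ 2) * b)).
  apply: (@le_trans _ _ ((1 - (size U).+1%:R * ss) * b)); last by rewrite ler_wpM2r // ltW.
  rewrite mulrBl mul1r lerBrDl.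
  have bs : (size U).+1%:R * ss * b <= (size U).+1%:R * ss.
    by rewrite ler_piMr ?mulr_ge0 ?ler0n // /b lerBlDr lerDl mulr_ge0 ?ler0n.
  apply: (le_trans (lerD bs (lexx _))).
  have h : ((size U).+1 + k * ((size U).+1 + k))%:R <= (k.+1 * (size U + k.+1))%:R :> R.
    by rewrite ler_nat; clear; lia.
  by have := ler_wpM2r ss0 h; rewrite natrD mulrDl /b; lra.
rewrite mulr_suml; apply: ler_sum => x _; rewrite ler_wpM2l ?sqr_ge0 //.
exact: (IH x (u :: U)).
Qed.

End SelfAvoiding.

(** * Fourth moments *)

Section Centred.
Variables (R : rcfType) (n : nat) (mu : nat -> R) (sg : 'I_n * 'I_n -> R).
Hypotheses (mu0 : mu 0%N = 1) (mu1 : mu 1%N = 0).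
Hypothesis sg0 : forall e, 0 <= sg e.
Local Notation E := ('I_n * 'I_n)%type.
Local Notation Em := (mom mu sg).
Implicit Types (l acc : seq E) (ls : seq (seq E)).

(* Expectation of [X acc * prod_(l <- ls) (X l - Em l)]. *)
Fixpoint cen ls acc : R :=
  if ls is l :: ls' then cen ls' (l ++ acc) - Em l * cen ls' acc else Em acc.

Lemma eq_cen ls ls' acc acc' : all2 perm_eq ls ls' -> perm_eq acc acc' ->
  cen ls acc = cen ls' acc'.
Proof.
elim: ls ls' acc acc' => [|l ls IH] [|l' ls'] acc acc' //=; first by move=> _; exact: mom_perm.
move=> /andP[p ps] pa; rewrite (mom_perm _ _ p) (IH ls' _ (l' ++ acc')) ?(IH ls' _ acc') //.
exact: perm_cat.
Qed.

Lemma all2_perm_refl ls : all2 perm_eq ls ls.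
Proof. by elim: ls => //= l ls ->; rewrite perm_refl. Qed.

Lemma cen_swap l1 l2 ls acc : cen [:: l1, l2 & ls] acc = cen [:: l2, l1 & ls] acc.
Proof.
rewrite /= (@eq_cen ls ls (l2 ++ l1 ++ acc) (l1 ++ l2 ++ acc)) ?all2_perm_refl //; first by ring.
by rewrite perm_catCA.
Qed.

Lemma mom_count1 e l : count_mem e l = 1%N -> Em l = 0.
Proof. by move=> h; rewrite /mom (bigD1 e) //= h mu1 !mul0r. Qed.

Lemma cen_count1 e ls acc : count_mem e (flatten ls ++ acc) = 1%N -> cen ls acc = 0.
Proof.
elim: ls acc => [|l ls IH] acc /=; first exact: mom_count1.
move=> h; rewrite IH; last by rewrite -h !count_cat addnCA addnA.
have [h1|h1] := eqVneq (count_mem e l) 1%N; first by rewrite (mom_count1 h1) mul0r subr0.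
by rewrite IH ?mulr0 ?subr0 //; move: h h1; rewrite !count_cat;
  move: (count _ l) (count _ (flatten ls)) (count _ acc) => a b c; lia.
Qed.

Lemma mom_disjoint l m : ~~ has (mem m) l -> Em (l ++ m) = Em l * Em m.
Proof.
move=> lm; rewrite /mom -big_split; apply: eq_bigr => e _ /=; rewrite count_cat.
have [el|el] := boolP (e \in l).
  have em : e \notin m by apply/negP => em; move/negP: lm; apply; apply/hasP; exists e.
  by rewrite (count_memPn em) addn0 mu0 expr0 !mulr1.
by rewrite (count_memPn el) add0n mu0 expr0 !mul1r.
Qed.

(** The factor of [l] is then independent of all the others, and it is centred. *)
Lemma cen_disjoint l ls acc : ~~ has (mem (flatten ls ++ acc)) l -> cen (l :: ls) acc = 0.
Proof.
suff H : ~~ has (mem (flatten ls ++ acc)) l -> cen ls (l ++ acc) = Em l * cen ls acc.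
  by move=> /H /= ->; rewrite subrr.
elim: ls acc => [|m ls IH] acc h /=; first exact: mom_disjoint.
rewrite (@eq_cen ls ls (m ++ l ++ acc) (l ++ m ++ acc)) ?all2_perm_refl //; last first.
  by rewrite perm_catCA.
rewrite !IH; first by ring.
- apply: contra h => /hasP[e el em]; apply/hasP; exists e => //.
  by move: em; rewrite /= !mem_cat => /orP[->|->]; rewrite ?orbT.
- apply: contra h => /hasP[e el em]; apply/hasP; exists e => //.
  by move: em; rewrite /= !mem_cat => /or3P[->|->|->]; rewrite ?orbT.
Qed.

Variables (b : R) (N : nat).
Hypotheses (b1 : 1 <= b) (mub : forall m, (m <= N)%N -> `|mu m| <= b).

Lemma mom_bound l : (size l <= N)%N -> `|Em l| <= b ^+ size l * \prod_(e <- l) sg e.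
Proof.
move=> lN; rewrite /mom normr_prod.
have -> : b ^+ size l * \prod_(e <- l) sg e = \prod_(e <- l) (b * sg e).
  by rewrite big_split /= big_const_seq count_predT iter_mulr_1.
rewrite prod_count; apply: ler_prod => e _; rewrite normr_ge0 normrM exprMn.
rewrite (ger0_norm (exprn_ge0 _ (sg0 e))) /= ler_wpM2r ?exprn_ge0 //.
case hc: (count_mem e l) => [|c]; first by rewrite mu0 normr1.
apply: (@le_trans _ _ b); last by rewrite ler_eXnr.
by apply: mub; rewrite -hc; apply: leq_trans lN; exact: count_size.
Qed.

Lemma cen_bound ls acc : (size (flatten ls ++ acc) <= N)%N ->
  `|cen ls acc| <= 2 ^+ size ls * (b ^+ size (flatten ls ++ acc) * \prod_(e <- flatten ls ++ acc) sg e).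
Proof.
elim: ls acc => [|l ls IH] acc /= hN; first by rewrite mul1r mom_bound.
apply: (le_trans (ler_normB _ _)).
have s1 : size (flatten ls ++ l ++ acc) = size ((l ++ flatten ls) ++ acc).
  by rewrite !size_cat; lia.
have h1 := IH (l ++ acc) ltac:(by rewrite s1).
have h2 := IH acc ltac:(move: hN; rewrite !size_cat; lia).
have h3 := @mom_bound l ltac:(move: hN; rewrite !size_cat; lia).
rewrite s1 in h1; rewrite normrM.
have p0 m : 0 <= \prod_(e <- m) sg e by apply: prodr_ge0.
have e1 : \prod_(e <- flatten ls ++ l ++ acc) sg e = \prod_(e <- (l ++ flatten ls) ++ acc) sg e.
  by apply: perm_big; rewrite -catA perm_catCA.
rewrite e1 in h1.
have h4 := ler_pM (normr_ge0 _) (normr_ge0 _) h3 h2.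
have e2 : b ^+ size l * \prod_(e <- l) sg e *
   (2 ^+ size ls * (b ^+ size (flatten ls ++ acc) * \prod_(e <- flatten ls ++ acc) sg e)) =
   2 ^+ size ls * (b ^+ size ((l ++ flatten ls) ++ acc) * \prod_(e <- (l ++ flatten ls) ++ acc) sg e).
  by rewrite -catA [size (l ++ _)]size_cat exprD [in RHS]big_cat /=; ring.
rewrite e2 in h4; rewrite exprS -mulrA mulr_natl mulr2n; exact: lerD.
Qed.

End Centred.

(** * Clusters of closed walks *)

Section ClusterBound.
Variables (R : rcfType) (n : nat) (sg : 'I_n * 'I_n -> R) (Lm : nat).
Hypotheses (sg0 : forall e, 0 <= sg e) (sg1 : forall e, sg e <= 1)
  (sgr : forall u, \sum_x sg (edge u x) ^+ 2 <= 1).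
Local Notation E := ('I_n * 'I_n)%type.
Implicit Types (l m : seq E) (u v x y : 'I_n) (V : seq 'I_n) (f g : seq E -> R).

Definition verts l : seq 'I_n := flatten [seq [:: e.1; e.2] | e <- l].
Definition meets l m := has (mem m) l.
Definition Wy y f := \sum_(k < Lm) walks k y y f.
Definition Cw f := \sum_u Wy u f.

Lemma le_Wy y f g : (forall l, (size l < Lm)%N -> f l <= g l) -> Wy y f <= Wy y g.
Proof.
move=> fg; apply: ler_sum => k _; apply: le_walks_size => l sl.
by apply: fg; rewrite sl.
Qed.

Lemma le_Cw f g : (forall l, (size l < Lm)%N -> f l <= g l) -> Cw f <= Cw g.
Proof. by move=> fg; apply: ler_sum => u _; exact: le_Wy. Qed.

Lemma eq_Cw f g : f =1 g -> Cw f = Cw g.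
Proof. by move=> fg; apply: eq_bigr => u _; apply: eq_bigr => k _; exact: eq_walks. Qed.

Lemma WyM y c f : Wy y (fun l => c * f l) = c * Wy y f.
Proof. by rewrite /Wy mulr_sumr; apply: eq_bigr => k _; rewrite walksM. Qed.

Lemma CwM c f : Cw (fun l => c * f l) = c * Cw f.
Proof. by rewrite /Cw mulr_sumr; apply: eq_bigr => k _; rewrite WyM. Qed.

Lemma CwD f g : Cw (fun l => f l + g l) = Cw f + Cw g.
Proof.
rewrite /Cw -big_split; apply: eq_bigr => u _; rewrite /Wy -big_split.
by apply: eq_bigr => k _; rewrite walksD.
Qed.

Lemma Wy_sum (I : Type) (r : seq I) y (F : I -> seq E -> R) :
  Wy y (fun l => \sum_(i <- r) F i l) = \sum_(i <- r) Wy y (F i).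
Proof. by rewrite /Wy; under eq_bigr do rewrite walks_sum; rewrite exchange_big. Qed.

Lemma Wy_ge0 y f : (forall l, 0 <= f l) -> 0 <= Wy y f.
Proof. by move=> f0; apply: sumr_ge0 => k _; exact: walks_ge0. Qed.

Lemma Cw_ge0 f : (forall l, 0 <= f l) -> 0 <= Cw f.
Proof. by move=> f0; apply: sumr_ge0 => u _; exact: Wy_ge0. Qed.

Lemma Cw_swap (F : seq E -> seq E -> R) :
  Cw (fun l => Cw (F l)) = Cw (fun l' => Cw (fun l => F l l')).
Proof.
have W1 u (G : 'I_n -> seq E -> R) : Wy u (fun l => \sum_v G v l) = \sum_v Wy u (G v).
  exact: Wy_sum.
have W2 u v : Wy u (fun l => Wy v (F l)) = Wy v (fun l' => Wy u (fun l => F l l')).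
  rewrite /Wy; under eq_bigr do rewrite walks_sum.
  under [RHS]eq_bigr do rewrite walks_sum.
  rewrite exchange_big; apply: eq_bigr => k _; apply: eq_bigr => k' _.
  by rewrite walks_swap.
rewrite /Cw; under eq_bigr do rewrite W1.
under [RHS]eq_bigr do rewrite W1.
by rewrite exchange_big; apply: eq_bigr => v _; apply: eq_bigr => u _.
Qed.

Lemma edge_verts u x m : edge u x \in m -> u \in verts m.
Proof.
move=> em; apply/flattenP; exists [:: (edge u x).1; (edge u x).2].
  by apply/mapP; exists (edge u x).
by rewrite /edge; case: ifP => _; rewrite !inE eqxx ?orbT.
Qed.

(** A walk sharing an edge with [m] leaves some vertex [y] of [m] at some time [a]; it is cut
    there. *)
Lemma walks_meets k u v m g : (forall l, 0 <= g l) ->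
  walks k u v (fun l => (meets l m)%:R * g l) <=
  \sum_(a < k) \sum_(y <- verts m)
    walks a u y (fun l1 => walks (k - a) y v (fun l2 => g (l1 ++ l2))).
Proof.
elim: k u g => [|k IH] u g g0.
  by rewrite big_ord0 /=; case: ifP => // _; rewrite mul0r.
rewrite big_ord_recl /=.
apply: (@le_trans _ _ (\sum_x ((edge u x \in m)%:R * walks k x v (fun l => g (edge u x :: l)) +
   walks k x v (fun l => (meets l m)%:R * g (edge u x :: l))))).
  apply: ler_sum => x _; rewrite -walksM -walksD; apply: le_walks => l.
  rewrite -mulrDl ler_wpM2r // /meets /=; case: (edge u x \in m); case: has => //=.
  - by rewrite lerDl.
  - by rewrite addr0.
  - by rewrite add0r.
  - by rewrite addr0.
rewrite big_split /=; apply: lerD.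
  have [uv|uv] := boolP (u \in verts m); last first.
    rewrite big1 ?sumr_ge0 //; first by move=> y _; case: ifP => // _; apply: sumr_ge0 => x _; exact: walks_ge0.
    by move=> x _; case: (boolP (_ \in m)) => [/edge_verts|]; rewrite ?(negPf uv) // mul0r.
  rewrite [leRHS](big_rem u) //= eqxx -[leLHS]addr0; apply: lerD.
    apply: ler_sum => x _; rewrite ler_piMl ?walks_ge0 //; by case: (_ \in m).
  by apply: sumr_ge0 => y _; case: ifP => // _; apply: sumr_ge0 => x _; exact: walks_ge0.
apply: (le_trans (ler_sum _ (fun x _ => IH x _ (fun l => g0 _)))).
rewrite exchange_big; apply: ler_sum => a _; rewrite exchange_big /=.
by apply: ler_sum => y _; rewrite /bump /= add1n subSS.
Qed.

(** A closed walk can be rotated to start at the vertex it shares with [m]. The free root, worth a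
    factor [n], becomes a vertex of [m]; the factor [Lm] counts the rotations. *)
Lemma Cw_meets m g : perm_inv g -> (forall l, 0 <= g l) ->
  Cw (fun l => (meets l m)%:R * g l) <= Lm%:R * \sum_(y <- verts m) Wy y g.
Proof.
move=> pg g0; rewrite /Cw /Wy exchange_big [\sum_(y <- _) _]exchange_big mulr_sumr.
apply: ler_sum => k _ /=.
apply: (le_trans (ler_sum _ (fun u _ => walks_meets k u u m g0))).
rewrite exchange_big /=.
apply: (@le_trans _ _ (\sum_(a < k) \sum_(y <- verts m) walks k y y g)).
  apply: ler_sum => a _; rewrite exchange_big /=; apply: ler_sum => y _.
  have ak := ltnW (ltn_ord a).
  rewrite -[in leRHS](subnK ak) walks_cat le_eqVlt; apply/orP; left; apply/eqP.
  apply: eq_bigr => u _; rewrite walks_swap; apply: eq_walks => l1; apply: eq_walks => l2.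
  by apply: pg; rewrite perm_catC.
rewrite sumr_const card_ord -[leLHS]mulr_natl ler_wpM2r ?ler_nat //; last exact: ltnW.
by apply: sumr_ge0 => y _; exact: walks_ge0.
Qed.

(* Along a list in which every edge occurs at least twice, the first occurrence of an
   edge with an unvisited endpoint can be charged [sg e ^+ 2] and all others [1]. *)
Fixpoint nw V l : R := if l is e :: l' then
  (if (e.1 \in V) && (e.2 \in V) then 1 else sg e ^+ 2) * nw [:: e.1, e.2 & V] l' else 1.
Fixpoint aft V l := if l is e :: l' then aft [:: e.1, e.2 & V] l' else V.
Fixpoint fresh V l := if l is e :: l' then
  (if (e.1 \in V) && (e.2 \in V) then fresh [:: e.1, e.2 & V] l'
   else e :: fresh [:: e.1, e.2 & V] l') else [::].

Lemma nw_ge0 V l : 0 <= nw V l.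
Proof.
by elim: l V => [|e l IH] V //=; rewrite mulr_ge0 //; case: ifP => // _; exact: sqr_ge0.
Qed.

Lemma nw_cat V l m : nw V (l ++ m) = nw V l * nw (aft V l) m.
Proof. by elim: l V => [|e l IH] V /=; rewrite ?mul1r // IH mulrA. Qed.

Lemma aft_sub V l : {subset V <= aft V l}.
Proof. by elim: l V => [|e l IH] V x xV //=; apply: IH; rewrite !inE xV !orbT. Qed.

Lemma verts_aft V l : {subset verts l <= aft V l}.
Proof.
elim: l V => [|e l IH] V x //=; rewrite /verts /= !inE => /or3P[/eqP->|/eqP->|h].
- by apply: aft_sub; rewrite !inE eqxx.
- by apply: aft_sub; rewrite !inE eqxx orbT.
- exact: IH.
Qed.

Lemma size_aft V l : size (aft V l) = (size V + 2 * size l)%N.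
Proof. by elim: l V => [|e l IH] V /=; rewrite ?muln0 ?addn0 // IH /=; lia. Qed.

Lemma size_verts l : size (verts l) = (2 * size l)%N.
Proof. by elim: l => //= e l; rewrite /verts /= => ->; lia. Qed.

Lemma fresh_nw V l : nw V l = \prod_(e <- fresh V l) sg e ^+ 2.
Proof.
elim: l V => [|e l IH] V /=; first by rewrite big_nil.
by case: ifP => _; rewrite ?mul1r IH // big_cons.
Qed.

Lemma fresh_mem V l e : e \in fresh V l -> (e \in l) && ~~ ((e.1 \in V) && (e.2 \in V)).
Proof.
elim: l V => [|a l IH] V //=; rewrite inE; case: ifP => [aV|aV]; last rewrite inE => /orP[/eqP ->|].
- by move=> /IH /andP[-> h]; rewrite orbT /=; apply: contra h => /andP[h1 h2]; rewrite !inE h1 h2 !orbT.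
- by rewrite eqxx aV.
- by move=> /IH /andP[-> h]; rewrite orbT /=; apply: contra h => /andP[h1 h2]; rewrite !inE h1 h2 !orbT.
Qed.

Lemma fresh_uniq V l : uniq (fresh V l).
Proof.
elim: l V => [|a l IH] V //=; case: ifP => _ //=; rewrite IH andbT.
by apply/negP => /fresh_mem /andP[_]; rewrite !inE !eqxx orbT.
Qed.

Definition no1 l := [forall e : E, count_mem e l != 1%N].
Definition Hw l : R := (no1 l)%:R * \prod_(e <- l) sg e.

Lemma Hw_perm : perm_inv Hw.
Proof.
move=> l m p; rewrite /Hw (perm_big _ p); congr (_%:R * _); congr nat_of_bool.
by apply: eq_forallb => e; rewrite (permP p).
Qed.

Lemma Hw_ge0 l : 0 <= Hw l.
Proof. by rewrite mulr_ge0 ?ler0n // prodr_ge0. Qed.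

Lemma Hw_le_nw V l : Hw l <= nw V l.
Proof.
rewrite /Hw; case: (boolP (no1 l)) => [/forallP h|_]; last by rewrite mul0r nw_ge0.
rewrite mul1r fresh_nw prod_count (big_uniq _ (fresh_uniq V l)) /= [leRHS]big_mkcond /=.
apply: ler_prod => e _; rewrite exprn_ge0 //=; case: ifP => [ef|_]; last by rewrite exprn_ile1.
have /fresh_mem /andP[el _] := ef.
have c2 : (2 <= count_mem e l)%N.
  have c0 : (0 < count_mem e l)%N by rewrite -has_count has_pred1.
  by have := h e; move: c0; case: (count_mem e l) => [|[|c]].
by rewrite ler_wiXn2l.
Qed.

(** A step to a visited vertex has weight 1 but at most [size V] targets; steps to new vertices have
    total weight at most 1 by the row sums. Each step thus costs a factor free of [n]. *)
Lemma nw_walks k u V : u \in V ->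
  \sum_v walks k u v (nw V) <= ((size V + 2 * k).+1)%:R ^+ k.
Proof.
elim: k u V => [|k IH] u V uV.
  rewrite expr0 (bigD1 u) //= eqxx big1 ?addr0 // => v; rewrite eq_sym => /negPf ->.
  by [].
rewrite /= exchange_big /=.
pose c : R := ((size V + 2 * k.+1).+1)%:R.
apply: (@le_trans _ _ (\sum_x ((x \in V)%:R + sg (edge u x) ^+ 2) * c ^+ k)).
  apply: ler_sum => x _; under eq_bigr do rewrite walksM.
  rewrite -mulr_sumr; apply: ler_pM.
  - by case: ifP => // _; exact: sqr_ge0.
  - by apply: sumr_ge0 => v _; apply: walks_ge0 => l; exact: nw_ge0.
  - have -> : ((edge u x).1 \in V) && ((edge u x).2 \in V) = (x \in V).
      by rewrite /edge; case: ifP => _ /=; rewrite uV ?andbT.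
    by case: ifP => _; rewrite ?add0r // lerDl sqr_ge0.
  apply: (le_trans (IH x [:: (edge u x).1, (edge u x).2 & V] _)).
    by rewrite /edge; case: ifP => _; rewrite !inE eqxx ?orbT.
  rewrite lerXn2r ?nnegrE ?ler0n // ler_nat /=; lia.
rewrite -mulr_suml exprS ler_wpM2r ?exprn_ge0 ?ler0n // big_split /=.
apply: (@le_trans _ _ ((size V)%:R + 1)); last by rewrite natr1 ler_nat; lia.
apply: lerD => //.
have -> : \sum_x ((x \in V)%:R : R) = #|mem V|%:R.
  rewrite -sum1_card natr_sum [RHS]big_mkcond; apply: eq_bigr => x _.
  by case: (x \in V).
by rewrite ler_nat card_size.
Qed.

Definition beta (m : nat) : R := Lm%:R * ((m + 2 * Lm).+1)%:R ^+ Lm.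

Lemma beta_ge0 (m : nat) : 0 <= beta m.
Proof. by rewrite mulr_ge0 ?exprn_ge0 ?ler0n. Qed.

Lemma Wy_nw y V (m : nat) : y \in V -> (size V <= m)%N -> Wy y (nw V) <= beta m.
Proof.
move=> yV Vm; rewrite /beta.
have -> : Lm%:R * ((m + 2 * Lm).+1)%:R ^+ Lm = \sum_(k < Lm) ((m + 2 * Lm).+1)%:R ^+ Lm :> R.
  by rewrite sumr_const card_ord mulr_natl.
apply: ler_sum => k _; have kL := ltn_ord k.
apply: (@le_trans _ _ (\sum_v walks k y v (nw V))).
  rewrite (bigD1 y) //= lerDl; apply: sumr_ge0 => v _; apply: walks_ge0 => l; exact: nw_ge0.
apply: (le_trans (nw_walks k yV)).
apply: (@le_trans _ _ (((m + 2 * Lm).+1)%:R ^+ k)).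
  by rewrite lerXn2r ?nnegrE ?ler0n // ler_nat; lia.
by rewrite ler_weXn2l ?ler1n // ltnW.
Qed.

Definition cluster_cst : R := (Lm%:R ^+ 2) * ((2 * Lm)%:R * (6 * Lm)%:R) * beta (2 + 6 * Lm) ^+ 4.

(** Only the roots of [l1] and [l3] remain free, hence [n ^ 2]: [Cw_meets] attaches [l2] to [l1],
    and [l4] to one of the other three. Each remaining sum, taken from the inside out, is bounded
    uniformly in [n] by [Wy_nw]. *)
Lemma cluster_bound :
  Cw (fun l1 => Cw (fun l2 => (meets l2 l1)%:R * Cw (fun l3 => Cw (fun l4 =>
    (meets l4 (l1 ++ l2 ++ l3))%:R * Hw (l1 ++ l2 ++ l3 ++ l4))))) <= cluster_cst * n%:R ^+ 2.
Proof.
have Wn y V := @Wy_nw y V (2 + 6 * Lm); rewrite /cluster_cst.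
move: (beta _) (beta_ge0 (2 + 6 * Lm)) Wn => B B0 Wn.
pose c4 : R := Lm%:R * ((6 * Lm)%:R * B).
have c40 : 0 <= c4 by rewrite !mulr_ge0 ?ler0n.
(* Both free roots count as visited from the start, so that every loop begins at a visited vertex
   and [nw] factors along the concatenation. *)
have step4 u1 u3 l1 l2 l3 : (size l1 < Lm)%N -> (size l2 < Lm)%N -> (size l3 < Lm)%N ->
  Cw (fun l4 => (meets l4 (l1 ++ l2 ++ l3))%:R * Hw (l1 ++ l2 ++ l3 ++ l4)) <=
   c4 * nw [:: u1; u3] (l1 ++ l2 ++ l3).
  move=> s1 s2 s3; set m3 := l1 ++ l2 ++ l3.
  have sm : (size m3 <= 3 * Lm)%N by rewrite /m3 !size_cat; lia.
  apply: (@le_trans _ _ (Cw (fun l4 => (meets l4 m3)%:R * Hw (m3 ++ l4)))).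
    by apply: le_Cw => l4 _; rewrite /m3 !catA.
  apply: (le_trans (Cw_meets _ _ _)).
  - exact: perm_inv_catl Hw_perm.
  - by move=> l; exact: Hw_ge0.
  rewrite /c4 -mulrA ler_wpM2l ?ler0n //.
  apply: (@le_trans _ _ (\sum_(y <- verts m3) B * nw [:: u1; u3] m3)).
    rewrite big_seq [leRHS]big_seq; apply: ler_sum => y ym.
    apply: (@le_trans _ _ (Wy y (fun l => nw [:: u1; u3] m3 * nw (aft [:: u1; u3] m3) l))).
      by apply: le_Wy => l _; rewrite -nw_cat; exact: Hw_le_nw.
    rewrite WyM mulrC ler_wpM2r ?nw_ge0 //; apply: Wn; first exact: verts_aft.
    by rewrite size_aft /=; lia.
  have h : (2 * size m3)%:R <= (6 * Lm)%:R :> R by rewrite ler_nat; lia.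
  rewrite big_const_seq count_predT iter_addr_0 size_verts -[leLHS]mulr_natl.
  by apply: le_trans (ler_wpM2r (mulr_ge0 B0 (nw_ge0 _ _)) h) _; rewrite mulrA.
have step3 u1 l1 l2 : (size l1 < Lm)%N -> (size l2 < Lm)%N ->
  Cw (fun l3 => Cw (fun l4 =>
    (meets l4 (l1 ++ l2 ++ l3))%:R * Hw (l1 ++ l2 ++ l3 ++ l4))) <=
  \sum_u3 c4 * B * nw [:: u1; u3] (l1 ++ l2).
  move=> s1 s2; apply: ler_sum => u3 _.
  apply: (@le_trans _ _ (Wy u3 (fun l => (c4 * nw [:: u1; u3] (l1 ++ l2)) * nw (aft [:: u1; u3] (l1 ++ l2)) l))).
    by apply: le_Wy => l3 s3; rewrite -mulrA -nw_cat -catA; exact: step4.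
  rewrite WyM mulrAC ler_wpM2r ?nw_ge0 // ler_wpM2l //; apply: Wn.
    by apply: aft_sub; rewrite !inE eqxx orbT.
  by rewrite size_aft size_cat /=; lia.
pose c2 : R := c4 * B * (Lm%:R * ((2 * Lm)%:R * B)).
have step2 u1 l1 : (size l1 < Lm)%N ->
  Cw (fun l2 => (meets l2 l1)%:R * Cw (fun l3 => Cw (fun l4 =>
    (meets l4 (l1 ++ l2 ++ l3))%:R * Hw (l1 ++ l2 ++ l3 ++ l4)))) <=
  \sum_u3 c2 * nw [:: u1; u3] l1.
  move=> s1; apply: (le_trans (Cw_meets _ _ _)).
  - move=> l l' p; apply: eq_Cw => l3; apply: eq_Cw => l4; congr (_%:R * _).
      congr nat_of_bool; apply: eq_has => e; rewrite /= !mem_cat (perm_mem p).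
      by [].
    by apply: Hw_perm; rewrite perm_cat2l perm_cat2r.
  - move=> l; apply: Cw_ge0 => l3; apply: Cw_ge0 => l4; rewrite mulr_ge0 ?ler0n ?Hw_ge0 //.
  apply: (@le_trans _ _ (Lm%:R * \sum_(y <- verts l1) \sum_u3 c4 * B * (B * nw [:: u1; u3] l1))).
    rewrite ler_wpM2l ?ler0n // big_seq [leRHS]big_seq; apply: ler_sum => y ym.
    apply: (@le_trans _ _ (Wy y (fun l => \sum_u3 (c4 * B * nw [:: u1; u3] l1) * nw (aft [:: u1; u3] l1) l))).
      apply: le_Wy => l2 s2; apply: (le_trans (step3 u1 _ _ s1 s2)).
      by apply: ler_sum => u3 _; rewrite nw_cat mulrA.
    rewrite Wy_sum; apply: ler_sum => u3 _; rewrite WyM -mulrA ler_wpM2l ?mulr_ge0 //.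
    rewrite mulrC ler_wpM2r ?nw_ge0 //; apply: Wn; first exact: verts_aft.
    by rewrite size_aft /=; lia.
  rewrite big_const_seq count_predT iter_addr_0 size_verts -[_ *+ (2 * size l1)]mulr_natr.
  have -> : \sum_u3 c2 * nw [:: u1; u3] l1 =
      Lm%:R * ((\sum_u3 c4 * B * (B * nw [:: u1; u3] l1)) * (2 * Lm)%:R).
    rewrite mulr_suml mulr_sumr; apply: eq_bigr => u3 _; rewrite /c2; ring.
  rewrite ler_wpM2l ?ler0n // ler_wpM2l ?ler_nat //; last by lia.
  by apply: sumr_ge0 => u3 _; rewrite !mulr_ge0 ?nw_ge0.
have c20 : 0 <= c2 by rewrite /c2 !mulr_ge0 ?ler0n.
apply: (@le_trans _ _ (\sum_(u1 < n) \sum_(u3 < n) c2 * B)).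
  apply: ler_sum => u1 _.
  apply: (@le_trans _ _ (Wy u1 (fun l1 => \sum_u3 c2 * nw [:: u1; u3] l1))).
    by apply: le_Wy => l1 s1; exact: step2.
  rewrite Wy_sum; apply: ler_sum => u3 _; rewrite WyM ler_wpM2l //.
  by apply: Wn; rewrite ?inE ?eqxx //=; lia.
rewrite !sumr_const !card_ord -!mulrnA -mulr_natr le_eqVlt; apply/orP; left; apply/eqP.
by rewrite /c2 /c4 natrM; ring.
Qed.

End ClusterBound.

(** * The quadratic form of the self-avoiding walk vectors *)

Section LowerFunctional.
Variables (R : rcfType) (n : nat) (th : R) (K : nat).
Hypothesis th0 : 0 <= th.
Local Notation E := ('I_n * 'I_n)%type.
(** Two walks of length [K] and the linking edge make [2 K + 1] edges, and closed walks are summed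
    over lengths strictly below [Lm]. *)
Local Notation Lm := (2 * K + 2)%N.
Implicit Types (l m : seq E) (u v x y : 'I_n) (g h : seq E -> R).

(* With [f_i] the vector of sums of edge products over self-avoiding walks from
   [i], this is [\sum_i f_i^T (A - th) f_i], linearised in the edge products. *)
Definition Lf g : R := \sum_(i < n) \sum_(k < K.+1) \sum_(k' < K.+1)
  saw k i [::] (fun v l => saw k' i [::] (fun v' l' =>
    g (edge v v' :: l ++ l') - th * ((v == v')%:R * g (l ++ l')))).

Lemma eq_Lf g h : g =1 h -> Lf g = Lf h.
Proof.
move=> gh; apply: eq_bigr => i _; apply: eq_bigr => k _; apply: eq_bigr => k' _.
by apply: eq_saw => v l; apply: eq_saw => v' l'; rewrite !gh.
Qed.

Lemma LfM c g : Lf (fun l => c * g l) = c * Lf g.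
Proof.
rewrite /Lf !mulr_sumr; apply: eq_bigr => i _; rewrite !mulr_sumr; apply: eq_bigr => k _.
rewrite !mulr_sumr; apply: eq_bigr => k' _; rewrite -sawM; apply: eq_saw => v l.
by rewrite -sawM; apply: eq_saw => v' l'; ring.
Qed.

Lemma LfB g h : Lf (fun l => g l - h l) = Lf g - Lf h.
Proof.
rewrite /Lf -sumrB; apply: eq_bigr => i _; rewrite -sumrB; apply: eq_bigr => k _.
rewrite -sumrB; apply: eq_bigr => k' _; rewrite -sawB; apply: eq_saw => v l.
by rewrite -sawB; apply: eq_saw => v' l'; ring.
Qed.

Lemma Lf_le0 (a : E -> R) : (forall v : 'cV[R]_n, nrm (emx a *m v) <= th * nrm v) ->
  Lf (fun l => \prod_(e <- l) a e) <= 0.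
Proof.
move=> ha; apply: sumr_le0 => i _.
pose X l := \prod_(e <- l) a e.
pose f : 'cV[R]_n := \col_x \sum_(k < K.+1) saw k i [::] (fun v l => (v == x)%:R * X l).
have fc (c : 'I_n -> R) : \sum_x f x ord0 * c x = \sum_(k < K.+1) saw k i [::] (fun v l => c v * X l).
  under eq_bigr do rewrite mxE mulr_suml.
  rewrite exchange_big; apply: eq_bigr => k _.
  under eq_bigr do rewrite mulrC -sawM.
  rewrite -saw_sum; apply: eq_saw => v l; rewrite (bigD1 v) //= eqxx mul1r big1 ?addr0 //.
  by move=> x; rewrite eq_sym => /negPf ->; rewrite mul0r mulr0.
have e1 : \sum_(k < K.+1) \sum_(k' < K.+1) saw k i [::] (fun v l => saw k' i [::] (fun v' l' =>
    X (edge v v' :: l ++ l') - th * ((v == v')%:R * X (l ++ l')))) =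
   \sum_x f x ord0 * (emx a *m f) x ord0 - th * nrm2 f.
  rewrite (fc (fun x => (emx a *m f) x ord0)) /nrm2.
  rewrite (eq_bigr (fun i => f i ord0 * f i ord0)) => [|x _]; last by rewrite expr2.
  rewrite (fc (fun x => f x ord0)) mulr_sumr -sumrB; apply: eq_bigr => k _.
  rewrite -sawM -sawB -saw_sum; apply: eq_saw => v l.
  have -> : (emx a *m f) v ord0 = \sum_(k' < K.+1) saw k' i [::] (fun v' l' => a (edge v v') * X l').
    rewrite mxE -fc; apply: eq_bigr => x _.
    by rewrite mxE mulrC.
  rewrite mxE !mulr_suml mulr_sumr -sumrB; apply: eq_bigr => k' _.
  rewrite mulrC -sawM [X in _ = _ - th * X]mulrC -!sawM -sawB; apply: eq_saw => v' l'.
  by rewrite /X big_cons big_cat /= [v' == v]eq_sym; ring.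
rewrite -/X e1 subr_le0.
have cs := cauchy_schwarz_sum (fun x => f x ord0) (fun x => (emx a *m f) x ord0).
have h : (\sum_x f x ord0 * (emx a *m f) x ord0) ^+ 2 <= (th * nrm2 f) ^+ 2.
  apply: (le_trans cs); rewrite -/(nrm2 f) -/(nrm2 (emx a *m f)) -sqr_nrm -[nrm2 (_ *m _)]sqr_nrm -exprMn.
  have := ha f; have := nrm_ge0 f; have := nrm_ge0 (emx a *m f).
  move: (nrm f) (nrm (emx a *m f)) => p q q0 p0 pq.
  rewrite lerXn2r ?nnegrE ?mulr_ge0 ?sqr_ge0 //.
  by rewrite expr2 mulrCA ler_wpM2l.
have [h1|h1] := leP (\sum_x f x ord0 * (emx a *m f) x ord0) 0.
  by apply: (le_trans h1); rewrite mulr_ge0 // nrm2_ge0.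
by rewrite -(@ler_pXn2r _ 2) ?nnegrE ?mulr_ge0 ?nrm2_ge0 // ltW.
Qed.

Section Expectation.
Variables (mu : nat -> R) (sg : E -> R) (ss : R).
Hypotheses (mu0 : mu 0%N = 1) (mu1 : mu 1%N = 0) (mu2 : mu 2%N = 1).
Hypotheses (sgr : forall u, \sum_x sg (edge u x) ^+ 2 = 1) (sgss : forall e, sg e ^+ 2 <= ss).
Local Notation Em := (mom mu sg).

Lemma sum_ord_eq (M a : nat) : \sum_(k < M) ((k : nat) == a)%:R = (a < M)%N%:R :> R.
Proof.
have [aM|Ma] := ltnP a M.
  rewrite (bigD1 (Ordinal aM)) //= eqxx big1 ?addr0 // => k; rewrite -val_eqE /= => /negPf ->.
  by [].
by rewrite big1 // => k _; rewrite ltn_eqF //; apply: leq_trans Ma.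
Qed.

Lemma sum_succ : \sum_(k < K.+1) \sum_(k' < K.+1) ((k' : nat) == k.+1)%:R = K%:R :> R.
Proof.
under eq_bigr do rewrite sum_ord_eq.
rewrite big_ord_recr /= ltnn addr0.
under eq_bigr => k _ do rewrite ltnS ltn_ord.
by rewrite sumr_const card_ord.
Qed.

(** By [saw_adj] the quadratic form only sees lengths that differ by 1, which are [2 K] ordered
    pairs; by [saw_same] the squared norm only sees the [K + 1] pairs of equal lengths. The masses
    lie between [1 - K^2 ss] and 1. *)
Lemma Lf_mom : n%:R * (2 * K%:R * (1 - (K * K)%:R * ss) - th * (K.+1)%:R) <= Lf Em.
Proof.
have -> : n%:R * (2 * K%:R * (1 - (K * K)%:R * ss) - th * (K.+1)%:R) =
   \sum_(i < n) (2 * K%:R * (1 - (K * K)%:R * ss) - th * (K.+1)%:R).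
  by rewrite sumr_const card_ord mulr_natl.
apply: ler_sum => i _.
have ss0 : 0 <= ss by apply: le_trans (sgss (i, i)); exact: sqr_ge0.
set m := 1 - _.
have hm (k : 'I_K.+1) : m <= mass sg k i [::].
  apply: (le_trans _ (mass_lower sgr sgss k i [::])).
  rewrite lerD2l lerN2 ler_wpM2r // ler_nat add0n; have := ltn_ord k; clear; nia.
apply: (@le_trans _ _ (\sum_(k < K.+1) \sum_(k' < K.+1)
   (((k' : nat) == k.+1)%:R * m + ((k : nat) == k'.+1)%:R * m - th * ((k' : nat) == k)%:R))).
  have e1 : \sum_(k < K.+1) \sum_(k' < K.+1) ((k' : nat) == k.+1)%:R * m = K%:R * m.
    by rewrite -sum_succ mulr_suml; apply: eq_bigr => k _; rewrite mulr_suml.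
  have e2 : \sum_(k < K.+1) \sum_(k' < K.+1) ((k : nat) == k'.+1)%:R * m = K%:R * m.
    by rewrite exchange_big /= e1.
  have e3 : \sum_(k < K.+1) \sum_(k' < K.+1) th * ((k' : nat) == k)%:R = th * K.+1%:R.
    under eq_bigr do rewrite -mulr_sumr sum_ord_eq ltn_ord mulr1.
    by rewrite sumr_const card_ord mulr_natr.
  under eq_bigr do rewrite sumrB big_split /=.
  rewrite sumrB big_split /= e1 e2 e3.
  by rewrite le_eqVlt; apply/orP; left; apply/eqP; ring.
apply: ler_sum => k _; apply: ler_sum => k' _.
have -> : saw k i [::] (fun v l => saw k' i [::] (fun v' l' =>
    Em (edge v v' :: l ++ l') - th * ((v == v')%:R * Em (l ++ l')))) =
  saw k i [::] (fun v l => saw k' i [::] (fun v' l' => Em (edge v v' :: l ++ l'))) -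
  th * saw k i [::] (fun v l => saw k' i [::] (fun v' l' => (v == v')%:R * Em (l ++ l'))).
  rewrite -sawM -sawB; apply: eq_saw => v l; rewrite -sawM -sawB; exact: eq_saw.
rewrite saw_adj // saw_same //; apply: lerB.
  by apply: lerD; rewrite ler_wpM2l ?ler0n.
by rewrite ler_wpM2l // [(k : nat) == _]eq_sym ler_piMr ?ler0n // mass_le1.
Qed.

End Expectation.

Lemma walks_close_adj k k' u h : perm_inv h ->
  \sum_v walks k u v (fun l => \sum_v' walks k' u v' (fun l' => h (edge v v' :: l ++ l'))) =
  walks (k + k'.+1) u u h.
Proof.
move=> ph; rewrite walks_cat; apply: eq_bigr => v _; apply: eq_walks => l /=.
apply: eq_bigr => v' _; rewrite walks_rev.
  apply: eq_walks => l'; apply: ph.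
  by rewrite -cat1s -[edge v v' :: l']cat1s perm_catCA.
by move=> l1 l2 p; apply: ph; rewrite perm_cons perm_cat2l.
Qed.

Lemma walks_close k k' u h : perm_inv h ->
  \sum_v walks k u v (fun l => \sum_v' walks k' u v' (fun l' => (v == v')%:R * h (l ++ l'))) =
  walks (k + k') u u h.
Proof.
move=> ph; rewrite walks_cat; apply: eq_bigr => v _; apply: eq_walks => l /=.
rewrite (bigD1 v) //= [X in _ + X]big1 ?addr0.
  rewrite walks_rev; first by apply: eq_walks => l'; rewrite eqxx mul1r.
  by move=> l1 l2 p; congr (_ * _); apply: ph; rewrite perm_cat2l.
by move=> v' /negPf h'; rewrite walksM eq_sym h' mul0r.
Qed.

Definition Lf_cst : R := (K.+1)%:R ^+ 2 * (1 + th).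

Lemma Lf_cst_ge0 : 0 <= Lf_cst.
Proof. by rewrite mulr_ge0 ?exprn_ge0 ?ler0n ?addr_ge0. Qed.

(** For an upper bound self-avoidance may be dropped. Two walks from [i] joined by the extra edge,
    or by their common end, form a closed walk. *)
Lemma Lf_norm g h : (forall l, `|g l| <= h l) -> perm_inv h ->
  `|Lf g| <= Lf_cst * Cw Lm h.
Proof.
move=> gh ph.
have h0 l : 0 <= h l by apply: le_trans (gh l).
rewrite /Cw mulr_sumr; apply: (le_trans (ler_norm_sum _ _ _)); apply: ler_sum => i _.
have W0 : 0 <= Wy Lm i h by exact: Wy_ge0.
have Wle (m : nat) : (m < Lm)%N -> walks m i i h <= Wy Lm i h.
  move=> mL; rewrite /Wy (bigD1 (Ordinal mL)) //= lerDl sumr_ge0 // => k _.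
  exact: walks_ge0.
apply: (@le_trans _ _ (\sum_(k < K.+1) \sum_(k' < K.+1) ((1 + th) * Wy Lm i h))); last first.
  rewrite !sumr_const !card_ord -!mulrnA -[leLHS]mulr_natr /Lf_cst natrM.
  by rewrite le_eqVlt; apply/orP; left; apply/eqP; ring.
apply: (le_trans (ler_norm_sum _ _ _)); apply: ler_sum => k _.
apply: (le_trans (ler_norm_sum _ _ _)); apply: ler_sum => k' _.
apply: (le_trans (saw_norm _ _ _ _)).
apply: (@le_trans _ _ (saw k i [::] (fun v l => saw k' i [::] (fun v' l' =>
   h (edge v v' :: l ++ l')) + th * saw k' i [::] (fun v' l' => (v == v')%:R * h (l ++ l'))))).
  apply: le_saw => v l; apply: (le_trans (saw_norm _ _ _ _)).
  rewrite -sawM -sawD; apply: le_saw => v' l'; apply: (le_trans (ler_normB _ _)).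
  apply: lerD => //; rewrite !normrM (ger0_norm th0) ler_wpM2l //.
  by rewrite ger0_norm ?ler0n // ler_wpM2l ?ler0n.
have hk : (k + k'.+1 < Lm)%N by have := ltn_ord k; have := ltn_ord k'; clear; lia.
rewrite sawD sawM mulrDl mul1r; apply: lerD.
  apply: le_trans (Wle _ hk); rewrite -walks_close_adj //.
  apply: (@le_trans _ _ (saw k i [::] (fun v l => \sum_v' walks k' i v' (fun l' => h (edge v v' :: l ++ l'))))).
    by apply: le_saw => v l; apply: saw_walks.
  apply: saw_walks => v l; apply: sumr_ge0 => v' _; exact: walks_ge0.
rewrite ler_wpM2l //; apply: (@le_trans _ _ (walks (k + k') i i h)); last first.
  by apply: Wle; apply: leq_trans hk; rewrite addnS ltnS leqW.
rewrite -walks_close //.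
apply: (@le_trans _ _ (saw k i [::] (fun v l => \sum_v' walks k' i v' (fun l' => (v == v')%:R * h (l ++ l'))))).
  by apply: le_saw => v l; apply: saw_walks => v' l'; rewrite mulr_ge0 ?ler0n.
apply: saw_walks => v l; apply: sumr_ge0 => v' _; apply: walks_ge0 => l'.
by rewrite mulr_ge0 ?ler0n.
Qed.

Section FourthMoment.
Variables (mu : nat -> R) (sg : E -> R) (b : R).
Hypotheses (mu0 : mu 0%N = 1) (mu1 : mu 1%N = 0) (b1 : 1 <= b).
Hypothesis mub : forall m : nat, (m <= 4 * Lm)%N -> `|mu m| <= b.
Hypotheses (sg0 : forall e, 0 <= sg e) (sg1 : forall e, sg e <= 1)
  (sgr : forall u, \sum_x sg (edge u x) ^+ 2 <= 1).
Local Notation Cn := (cen mu sg).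
Local Notation H4 l1 l2 l3 l4 := (Hw sg (l1 ++ l2 ++ l3 ++ l4)).

Lemma meetsC l m : meets l m = meets m l.
Proof. by apply/hasP/hasP => -[e h1 h2]; exists e. Qed.

Lemma meets_cat l m m' : meets l (m ++ m') = meets l m || meets l m'.
Proof. by rewrite meetsC /meets has_cat -!/(meets _ _) ![meets _ l]meetsC. Qed.

Lemma eq_meets l m m' : perm_eq m m' -> meets l m = meets l m'.
Proof. by move=> p; apply: eq_has => e; rewrite /= (perm_mem p). Qed.

(** Iterated, it brings any list to the front, where [cen_disjoint] applies. *)
Lemma cen4_rot l1 l2 l3 l4 : Cn [:: l1; l2; l3; l4] [::] = Cn [:: l4; l1; l2; l3] [::].
Proof.
have cons l ls acc : cen mu sg (l :: ls) acc = cen mu sg ls (l ++ acc) - mom mu sg l * cen mu sg ls acc by [].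
have sw a c d acc : cen mu sg [:: a; c; d] acc = cen mu sg [:: d; a; c] acc.
  by rewrite [RHS]cen_swap cons [RHS]cons !(cen_swap _ _ c d).
rewrite [RHS]cen_swap.
by rewrite cons [RHS]cons !(sw l2 l3 l4).
Qed.

(** The expectation vanishes if some edge occurs exactly once or some list meets none of the others.
    Otherwise [l1] meets [l2], [l3] or [l4], and in each case a remaining list meets the union of
    the other three. The 16 is [2 ^ 4], one factor 2 for each centring. *)
Lemma cen4_bound l1 l2 l3 l4 :
  (size l1 < Lm)%N -> (size l2 < Lm)%N -> (size l3 < Lm)%N -> (size l4 < Lm)%N ->
  `|Cn [:: l1; l2; l3; l4] [::]| <= 16 * b ^+ (4 * Lm) *
   ((meets l2 l1)%:R * ((meets l4 (l1 ++ l2 ++ l3))%:R * H4 l1 l2 l3 l4) +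
    ((meets l3 l1)%:R * ((meets l4 (l1 ++ l2 ++ l3))%:R * H4 l1 l2 l3 l4) +
     (meets l4 l1)%:R * ((meets l3 (l1 ++ l2 ++ l4))%:R * H4 l1 l2 l3 l4))).
Proof.
move=> s1 s2 s3 s4; set rhs := leRHS.
have H0 : 0 <= H4 l1 l2 l3 l4 by exact: Hw_ge0.
have b0 : 0 <= 16 * b ^+ (4 * Lm) by rewrite mulr_ge0 ?ler0n ?exprn_ge0 // (le_trans ler01).
have rhs0 : 0 <= rhs.
  by rewrite /rhs; apply: mulr_ge0 => //; rewrite !addr_ge0 // mulr_ge0 ?ler0n // mulr_ge0 ?ler0n.
have zero : Cn [:: l1; l2; l3; l4] [::] = 0 -> `|Cn [:: l1; l2; l3; l4] [::]| <= rhs.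
  by move=> ->; rewrite normr0.
case: (boolP (no1 (l1 ++ l2 ++ l3 ++ l4))) => [hno|]; last first.
  rewrite negb_forall => /existsP[e]; rewrite negbK => /eqP he; apply: zero.
  by apply: (@cen_count1 _ _ _ _ mu1 e); rewrite /= !cats0.
case: (boolP (meets l1 (l2 ++ l3 ++ l4))) => [m1|m1]; last first.
  by apply: zero; apply: cen_disjoint => //; rewrite /= !cats0.
case: (boolP (meets l4 (l1 ++ l2 ++ l3))) => [m4|m4]; last first.
  by apply: zero; rewrite cen4_rot; apply: cen_disjoint => //; rewrite /= !cats0.
case: (boolP (meets l3 (l1 ++ l2 ++ l4))) => [m3|m3]; last first.
  apply: zero; rewrite cen4_rot cen4_rot; apply: cen_disjoint => //; rewrite /= !cats0.
  rewrite -/(meets _ _) (@eq_meets _ _ (l1 ++ l2 ++ l4)) //.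
  by rewrite perm_catC catA.
have bd : `|Cn [:: l1; l2; l3; l4] [::]| <= 16 * b ^+ (4 * Lm) * H4 l1 l2 l3 l4.
  have := @cen_bound _ _ _ _ mu0 sg0 b (4 * Lm) b1 mub [:: l1; l2; l3; l4] [::].
  rewrite /= !cats0 => hb; apply: (le_trans (hb _)); first by rewrite !size_cat; clear -s1 s2 s3 s4; lia.
  rewrite /Hw hno mul1r -mulrA.
  have -> : 2 ^+ 4 = 16 :> R by ring.
  rewrite ler_wpM2l ?ler0n // ler_wpM2r ?prodr_ge0 // ler_weXn2l // !size_cat.
  by clear -s1 s2 s3 s4; lia.
apply: (le_trans bd); rewrite /rhs ler_wpM2l // m3 m4 !mul1r.
have := m1; rewrite !meets_cat ![meets l1 _]meetsC.
case: (meets l2 l1); case: (meets l3 l1); case: (meets l4 l1) => //= _;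
 rewrite ?mul1r ?mul0r; lra.
Qed.

Definition fourth_cst : R := Lf_cst ^+ 4 * (16 * b ^+ (4 * Lm) * (3 * cluster_cst R Lm)).

(** The three patterns of [cen4_bound] become the one of [cluster_bound] after exchanging sums;
    hence the 3 in [fourth_cst]. *)
Lemma Lf_fourth :
  Lf (fun l1 => Lf (fun l2 => Lf (fun l3 => Lf (fun l4 => Cn [:: l1; l2; l3; l4] [::])))) <=
  fourth_cst * n%:R ^+ 2.
Proof.
apply: (le_trans (ler_norm _)).
pose Q l1 l2 l3 l4 : R := `|Cn [:: l1; l2; l3; l4] [::]|.
have pQ l1 l2 l3 l4 l1' l2' l3' l4' : perm_eq l1 l1' -> perm_eq l2 l2' -> perm_eq l3 l3' ->
    perm_eq l4 l4' -> Q l1 l2 l3 l4 = Q l1' l2' l3' l4'.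
  by move=> p1 p2 p3 p4; congr (`| _ |); apply: eq_cen => //=; rewrite p1 p2 p3 p4.
have h : `|Lf (fun l1 => Lf (fun l2 => Lf (fun l3 => Lf (fun l4 => Cn [:: l1; l2; l3; l4] [::]))))|
  <= Lf_cst * Cw Lm (fun l1 => Lf_cst * Cw Lm (fun l2 => Lf_cst * Cw Lm (fun l3 =>
     Lf_cst * Cw Lm (fun l4 => Q l1 l2 l3 l4)))).
  apply: Lf_norm => [l1|l l' p]; last first.
    congr (_ * _); apply: eq_Cw => l2; congr (_ * _); apply: eq_Cw => l3; congr (_ * _).
    by apply: eq_Cw => l4; exact: pQ.
  apply: Lf_norm => [l2|l l' p]; last first.
    congr (_ * _); apply: eq_Cw => l3; congr (_ * _).
    by apply: eq_Cw => l4; exact: pQ.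
  apply: Lf_norm => [l3|l l' p]; last first.
    congr (_ * _).
    by apply: eq_Cw => l4; exact: pQ.
  apply: Lf_norm => [l4|l l' p]; last exact: pQ.
  by [].
apply: (le_trans h).
have -> : Lf_cst * Cw Lm (fun l1 => Lf_cst * Cw Lm (fun l2 => Lf_cst * Cw Lm (fun l3 =>
     Lf_cst * Cw Lm (fun l4 => Q l1 l2 l3 l4)))) =
   Lf_cst ^+ 4 * Cw Lm (fun l1 => Cw Lm (fun l2 => Cw Lm (fun l3 => Cw Lm (fun l4 => Q l1 l2 l3 l4)))).
  rewrite CwM; under eq_Cw => l1 do rewrite CwM.
  rewrite CwM; under eq_Cw => l1 do under eq_Cw => l2 do rewrite CwM.
  under eq_Cw => l1 do rewrite CwM.
  by rewrite CwM; ring.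
rewrite /fourth_cst -mulrA ler_wpM2l ?exprn_ge0 ?Lf_cst_ge0 //.
pose T l1 l2 l3 l4 : R := (meets l2 l1)%:R * ((meets l4 (l1 ++ l2 ++ l3))%:R * H4 l1 l2 l3 l4).
pose S (F : seq E -> seq E -> seq E -> seq E -> R) :=
  Cw Lm (fun l1 => Cw Lm (fun l2 => Cw Lm (fun l3 => Cw Lm (fun l4 => F l1 l2 l3 l4)))).
have ST : S T <= cluster_cst R Lm * n%:R ^+ 2.
  apply: le_trans (cluster_bound Lm sg0 sg1 sgr); rewrite le_eqVlt; apply/orP; left; apply/eqP.
  apply: eq_Cw => l1; apply: eq_Cw => l2; rewrite -CwM; apply: eq_Cw => l3.
  by rewrite -CwM; apply: eq_Cw => l4.
have SD F G : S (fun l1 l2 l3 l4 => F l1 l2 l3 l4 + G l1 l2 l3 l4) = S F + S G.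
  rewrite /S -CwD; apply: eq_Cw => l1; rewrite -CwD; apply: eq_Cw => l2.
  by rewrite -CwD; apply: eq_Cw => l3; rewrite -CwD.
have SM c F : S (fun l1 l2 l3 l4 => c * F l1 l2 l3 l4) = c * S F.
  rewrite /S -CwM; apply: eq_Cw => l1; rewrite -CwM; apply: eq_Cw => l2.
  by rewrite -CwM; apply: eq_Cw => l3; rewrite -CwM.
have S2 : S (fun l1 l2 l3 l4 => (meets l3 l1)%:R * ((meets l4 (l1 ++ l2 ++ l3))%:R * H4 l1 l2 l3 l4)) = S T.
  apply: eq_Cw => l1; rewrite Cw_swap; apply: eq_Cw => l3; apply: eq_Cw => l2; apply: eq_Cw => l4.
  rewrite /T; congr (_ * (_%:R * _)).
    by congr nat_of_bool; apply: eq_meets; rewrite perm_cat2l perm_catC.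
  by apply: Hw_perm; rewrite perm_cat2l perm_catCA.
have S3 : S (fun l1 l2 l3 l4 => (meets l4 l1)%:R * ((meets l3 (l1 ++ l2 ++ l4))%:R * H4 l1 l2 l3 l4)) = S T.
  apply: eq_Cw => l1; under eq_Cw => l2 do rewrite Cw_swap.
  rewrite Cw_swap; apply: eq_Cw => l4; apply: eq_Cw => l2; apply: eq_Cw => l3.
  rewrite /T; congr (_ * (_%:R * _)).
    by congr nat_of_bool; apply: eq_meets; rewrite perm_cat2l perm_catC.
  by apply: Hw_perm; rewrite perm_cat2l catA perm_catC.
apply: (@le_trans _ _ (16 * b ^+ (4 * Lm) * (S T + (S T + S T)))).
  rewrite -{2}S2 -{2}S3 -!SD -SM.
  by do 4! (apply: le_Cw => ? ?); exact: cen4_bound.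
have b0 : 0 <= 16 * b ^+ (4 * Lm) by rewrite mulr_ge0 ?ler0n ?exprn_ge0 // (le_trans ler01).
rewrite -[leRHS]mulrA ler_wpM2l //.
by move: (S T) (cluster_cst R Lm) ST => z c; move: (n%:R ^+ 2) => N; lra.
Qed.

End FourthMoment.
End LowerFunctional.

(** * Expectations and independence *)

Local Open Scope classical_set_scope.
Local Open Scope ring_scope.

Section ExpectationPredicate.
Context d (T : measurableType d) (R : realType) (P : probability T R).
Implicit Types (f g : T -> R) (r s c : R).

(** Integrability and value in one predicate, so that means of polynomial expressions follow their
    structure without separate integrability proofs. *)
Definition has_mean f r :=
  P.-integrable setT (EFin \o f) /\ (\int[P]_x (f x)%:E = r%:E)%E.

Lemma eq_has_mean f g r : f =1 g -> has_mean f r -> has_mean g r.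
Proof. by move=> /funext ->. Qed.

Lemma has_mean_measurable f r : has_mean f r -> measurable_fun setT f.
Proof. by move=> [/integrableP[/measurable_EFinP]]. Qed.

Lemma has_mean_sum I (s : seq I) (p : pred I) (F : I -> T -> R) (r : I -> R) :
  (forall i, p i -> has_mean (F i) (r i)) ->
  has_mean (fun t => \sum_(i <- s | p i) F i t) (\sum_(i <- s | p i) r i).
Proof.
move=> h.
elim: s => [|i s IH].
  apply: (@eq_has_mean (cst 0)); first by move=> t; rewrite big_nil.
  rewrite big_nil; split; last by rewrite integral0_eq.
  exact: integrable0.
rewrite big_cons; case: ifP => pi; last first.
  by apply: eq_has_mean IH => t; rewrite big_cons pi.
have [hi1 hi2] := h i pi; have [hs1 hs2] := IH.
apply: (@eq_has_mean (fun t => F i t + \sum_(j <- s | p j) F j t)).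
  by move=> t; rewrite big_cons pi.
split; first exact: (integrableD measurableT hi1 hs1).
by have := integralD measurableT hi1 hs1; rewrite /= hi2 hs2.
Qed.

Lemma has_meanZ c f r : has_mean f r -> has_mean (fun t => c * f t) (c * r).
Proof.
move=> [h1 h2]; split; first exact: (integrableZl measurableT c h1).
by have := integralZl measurableT h1 c; rewrite /= h2.
Qed.

Lemma has_meanD f g r s : has_mean f r -> has_mean g s -> has_mean (fun t => f t + g t) (r + s).
Proof.
move=> [h1 h2] [h3 h4]; split; first exact: (integrableD measurableT h1 h3).
by have := integralD measurableT h1 h3; rewrite /= h2 h4.
Qed.

Lemma has_meanB f g r s : has_mean f r -> has_mean g s -> has_mean (fun t => f t - g t) (r - s).
Proof.
move=> hf hg; have := has_meanD hf (has_meanZ (-1) hg); rewrite mulN1r.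
by apply: eq_has_mean => t; rewrite mulN1r.
Qed.

Lemma has_mean_indic (A : set T) : measurable A -> has_mean \1_A (fine (P A)).
Proof.
move=> mA; split; first exact: integrable_indic.
by rewrite integral_indic // setIT fineK // fin_num_measure.
Qed.

Lemma has_mean_cst c : has_mean (cst c) c.
Proof.
apply: (@eq_has_mean (fun t => c * \1_setT t)); first by move=> t; rewrite indicE in_setT mulr1.
have := has_meanZ c (has_mean_indic (@measurableT _ T)).
by rewrite probability_setT /= mulr1.
Qed.

Lemma has_mean_ge0 f r : measurable_fun setT f -> (forall t, 0 <= f t) ->
  (\int[P]_x (f x)%:E = r%:E)%E -> has_mean f r.
Proof.
move=> mf f0 fr; split=> //; apply/integrableP; split; first exact/measurable_EFinP.
under eq_integral => x _ do rewrite /= ger0_norm //.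
by rewrite fr ltry.
Qed.

Lemma has_mean_le f g r s : has_mean f r -> has_mean g s -> (forall t, f t <= g t) -> r <= s.
Proof.
move=> [h1 h2] [h3 h4] fg; rewrite -lee_fin -h2 -h4.
by apply: le_integral => // t _; rewrite lee_fin.
Qed.

Lemma has_mean_unique f r s : has_mean f r -> has_mean f s -> r = s.
Proof. by move=> [_ h1] [_ h2]; apply: EFin_inj; rewrite -h1 -h2. Qed.

Lemma has_mean_exists f : P.-integrable setT (EFin \o f) -> exists r, has_mean f r.
Proof.
move=> hf; exists (fine (\int[P]_x (f x)%:E)%E); split=> //.
by rewrite fineK //; exact: integral_fune_fin_num.
Qed.

Lemma has_mean_dominated f g s : measurable_fun setT f -> (forall t, `|f t| <= g t) ->
  has_mean g s -> exists2 r, has_mean f r & `|r| <= s.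
Proof.
move=> mf fg hg.
have [r hr] : exists r, has_mean f r.
  apply: has_mean_exists; apply: (le_integrable measurableT _ _ hg.1).
    exact/measurable_EFinP.
  move=> t _ /=; rewrite lee_fin; apply: (le_trans (fg t)).
  exact: ler_norm.
exists r => //; rewrite ler_norml; apply/andP; split.
  rewrite -mulN1r; apply: has_mean_le (has_meanZ (-1) hg) hr _ => t.
  by rewrite mulN1r lerNl (le_trans _ (fg t)) // -normrN ler_norm.
by apply: has_mean_le hr hg _ => t; rewrite (le_trans _ (fg t)) // ler_norm.
Qed.

Lemma has_mean_markov f r a : has_mean f r -> (forall t, 0 <= f t) -> 0 < a ->
  measurable [set t | a <= f t] /\ (P [set t | (a <= f t)%R] <= (r / a)%:E)%E.
Proof.
move=> hf f0 a0.
have mA : measurable [set t | a <= f t].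
  have := has_mean_measurable hf => mf; rewrite -[X in measurable X]setTI.
  have -> : [set t | a <= f t] = f @^-1` `[a, +oo[.
    by apply/seteqP; split => t /=; rewrite in_itv /= andbT.
  exact: mf.
split=> //.
have h := has_meanZ a (has_mean_indic mA).
have : a * fine (P [set t | a <= f t]) <= r.
  apply: has_mean_le h hf _ => t; rewrite indicE.
  by case: (boolP (t \in _)); rewrite ?mulr0 ?mulr1 // inE.
rewrite -[P _]fineK ?fin_num_measure // lee_fin => h1.
by rewrite ler_pdivlMr // mulrC.
Qed.

Lemma has_mean_mono_cvg (F : nat -> T -> R) f (r : nat -> R) :
  (forall n, has_mean (F n) (r n)) -> (forall n t, 0 <= F n t) ->
  (forall t, {homo F^~ t : n m / (n <= m)%N >-> n <= m}) ->
  measurable_fun setT f -> (forall t, F^~ t @ \oo --> f t) ->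
  (r n)%:E @[n --> \oo] --> (\int[P]_x (f x)%:E)%E.
Proof.
move=> hF F0 Fh mf Ff.
have -> : (fun n => (r n)%:E) = (fun n => \int[P]_x (F n x)%:E)%E.
  by apply/funext => n; rewrite (hF n).2.
have := @cvg_monotone_convergence _ _ _ P setT measurableT (fun n t => (F n t)%:E).
have -> : (\int[P]_x limn (fun n => (F n x)%:E) = \int[P]_x (f x)%:E)%E.
  apply: eq_integral => x _; apply/cvg_lim => //.
  by apply: cvg_EFin; [near=> n | exact: Ff].
apply.
- by move=> n; apply/measurable_EFinP; exact: has_mean_measurable (hF n).
- by move=> n t _; rewrite lee_fin.
- by move=> t _ n m nm; rewrite lee_fin; exact: Fh.
Unshelve. all: by end_near.
Qed.

End ExpectationPredicate.

Import HBNNSimple.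

(** One approximation of the identity on nonnegative reals, which by composition serves all the
    factors of a product at once. *)
Lemma simple_approx (R : realType) : exists phi : nat -> R -> R,
  [/\ (forall n x, 0 <= phi n x),
      (forall x, {homo phi^~ x : n m / (n <= m)%N >-> n <= m}),
      (forall x, 0 <= x -> phi^~ x @ \oo --> x) &
      forall n, exists m (c : nat -> R) (B : nat -> set R),
        (forall i, measurable (B i)) /\ forall x, phi n x = \sum_(i < m.+1) c i * \1_(B i) x].
Proof.
pose f : R -> \bar R := fun x : R => (`|x|)%:E.
have mf : measurable_fun [set: R] f by apply/measurable_EFinP; exact: normr_measurable.
pose phi (n : nat) (x : R) : R := (nnsfun_approx measurableT mf n) x.
exists phi; split.
- by move=> n x; exact: fun_ge0.
- by move=> x n m nm; have /lefP := nd_nnsfun_approx measurableT mf nm; exact.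
- move=> x x0.
  have h := @cvg_nnsfun_approx _ _ _ _ measurableT f mf (fun y _ => normr_ge0 y) x I.
  by rewrite /f ger0_norm // in h; have /fine_cvgP[_] := h.
move=> n; pose g := nnsfun_approx measurableT mf n.
pose s := finmap.enum_fset (fset_set (range g)).
exists (size s), (fun i => s`_i), (fun i => g @^-1` [set s`_i]); split.
  by move=> i; exact: measurable_sfunP.
(* The sum has one term more than there are values, so that its index type is never empty; the extra
   coefficient is the default 0 of [nth]. *)
move=> x; rewrite big_ord_recr /= [X in _ + X * _]nth_default // mul0r addr0.
exact: (fimfunEord g).
Qed.

Lemma cvg_prod_in (R : realType) (I : Type) (s : seq I) (p : pred I) (F : I -> nat -> R) (l : I -> R) :
  (forall i, p i -> F i n @[n --> \oo] --> l i) ->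
  (\prod_(i <- s | p i) F i n) @[n --> \oo] --> \prod_(i <- s | p i) l i.
Proof.
move=> h; elim: s => [|i s IH].
  by rewrite big_nil; under eq_fun do rewrite big_nil; exact: cvg_cst.
rewrite big_cons; under eq_fun do rewrite big_cons; case: ifP => // pi.
by apply: cvgM => //; exact: h.
Qed.

Lemma prod_EFin (R : realType) (I : Type) (s : seq I) (p : pred I) (F : I -> R) :
  (\prod_(i <- s | p i) (F i)%:E = (\prod_(i <- s | p i) F i)%R%:E)%E.
Proof.
by elim: s => [|i s IH]; rewrite ?big_nil // !big_cons; case: ifP => // _; rewrite IH EFinM.
Qed.

(** * Expectations of products of independent variables *)

Section Independence.
Context d (T : measurableType d) (R : realType) (P : probability T R).
Variables (I : finType) (A : {set I}) (X : I -> T -> R) (f : I -> R -> R).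
Hypotheses (indep : mutually_independent P A X) (mX : forall i, measurable_fun setT (X i)).

Lemma prod_indic (C : I -> set T) t :
  \prod_(i in A) \1_(C i) t = \1_(\bigcap_(i in [set i | i \in A]) C i) t :> R.
Proof.
have [h|h] := pselect (forall i, i \in A -> C i t).
  rewrite big1 => [|i iA]; rewrite indicE mem_set //; exact: h.
have [i [iA nC]] : exists i, i \in A /\ ~ C i t.
  by apply: contrapT => H; apply: h => i iA; apply: contrapT => nC; apply: H; exists i.
rewrite (bigD1 i) //= indicE memNset // mul0r indicE memNset //.
Qed.

Lemma indep_mean_simple (m : nat) (c : nat -> R) (B : nat -> set R) :
  (forall i, measurable_fun setT (f i)) -> (forall k, measurable (B k)) ->
  has_mean P (fun t => \prod_(i in A) \sum_(k < m.+1) c k * \1_(B k) (f i (X i t)))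
    (\prod_(i in A) \sum_(k < m.+1) c k * fine (P (X i @^-1` (f i @^-1` B k)))).
Proof.
move=> mf mB.
have mfB i k : measurable (f i @^-1` B k) by rewrite -[X in measurable X]setTI; exact: mf.
have mC i k : measurable (X i @^-1` (f i @^-1` B k)).
  by rewrite -[X in measurable X]setTI; exact: mX.
rewrite (big_distr_big ord0).
apply: (@eq_has_mean _ _ _ _ (fun t => \sum_(g in pffun_on ord0 (mem A) (fun _ : 'I_m.+1 => true))
   (\prod_(i in A) c (g i)) * \1_(\bigcap_(i in [set i | i \in A]) (X i @^-1` (f i @^-1` B (g i)))) t)).
  move=> t; rewrite [RHS](big_distr_big ord0) /=; apply: eq_bigr => g _.
  by rewrite -prod_indic -big_split.
apply: has_mean_sum => g _; rewrite big_split /=; apply: has_meanZ.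
have := has_mean_indic P (A := \bigcap_(i in [set i | i \in A]) (X i @^-1` (f i @^-1` B (g i)))).
rewrite (indep (subxx A) (fun i => mfB i (g i))).
rewrite (eq_bigr (fun i => (fine (P (X i @^-1` (f i @^-1` B (g i)))))%:E)) => [|i _]; last first.
  by rewrite fineK // fin_num_measure.
rewrite prod_EFin /=; apply.
by apply: fin_bigcap_measurable.
Qed.

Variables (r : I -> R).
Hypotheses (mf : forall i, measurable_fun setT (f i)) (hr : forall i, has_mean P (f i \o X i) (r i)).

(** Monotone convergence is used twice: in each factor, and for the product, whose approximations
    increase because the factors are nonnegative. *)
Lemma indep_mean_ge0 : (forall i x, 0 <= f i x) ->
  has_mean P (fun t => \prod_(i in A) f i (X i t)) (\prod_(i in A) r i).
Proof.
move=> f0; have [phi [phi0 phih phic phis]] := simple_approx R.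
pose s (n : nat) i := fine (\int[P]_t (phi n (f i (X i t)))%:E)%E.
have mfX i : measurable_fun setT (fun t => f i (X i t)) by exact: measurableT_comp.
have hs n i : has_mean P (fun t => phi n (f i (X i t))) (s n i).
  have [m [c [B [mB E]]]] := phis n.
  have [q hq] : exists q, has_mean P (fun t => phi n (f i (X i t))) q.
    exists (\sum_(k < m.+1) c k * fine (P ((fun t => f i (X i t)) @^-1` B k))).
    apply: (@eq_has_mean _ _ _ _ (fun t => \sum_(k < m.+1) c k * \1_((fun t => f i (X i t)) @^-1` B k) t)).
      by move=> t; rewrite E; apply: eq_bigr => k _.
    apply: has_mean_sum => k _; apply: has_meanZ; apply: has_mean_indic.
    by rewrite -[X in measurable X]setTI; exact: mfX.
  by rewrite /s hq.2 /=.
have hS n : has_mean P (fun t => \prod_(i in A) phi n (f i (X i t))) (\prod_(i in A) s n i).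
  have [m [c [B [mB E]]]] := phis n.
  have := indep_mean_simple m c mf mB.
  have -> : \prod_(i in A) \sum_(k < m.+1) c k * fine (P (X i @^-1` (f i @^-1` B k))) = \prod_(i in A) s n i.
    apply: eq_bigr => i _; apply: has_mean_unique (hs n i).
    apply: (@eq_has_mean _ _ _ _ (fun t => \sum_(k < m.+1) c k * \1_((fun t => f i (X i t)) @^-1` B k) t)).
      by move=> t; rewrite E; apply: eq_bigr => k _.
    apply: has_mean_sum => k _; apply: has_meanZ; apply: has_mean_indic.
    by rewrite -[X in measurable X]setTI; exact: mfX.
  by apply: eq_has_mean => t; apply: eq_bigr => i _; rewrite E.
have cs i : s n i @[n --> \oo] --> r i.
  have := has_mean_mono_cvg (fun n => hs n i) (fun n t => phi0 n _) (fun t => phih _) (mfX i)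
    (fun t => phic _ (f0 i _)).
  by rewrite (hr i).2 => /fine_cvgP[].
have mprod : measurable_fun setT (fun t => \prod_(i in A) f i (X i t)).
  under eq_fun do rewrite -big_enum /=; by apply: measurable_prod.
apply: has_mean_ge0 => //; first by move=> t; exact: prodr_ge0.
have h1 : ((\prod_(i in A) s n i)%:E @[n --> \oo] --> (\int[P]_t (\prod_(i in A) f i (X i t))%:E)%E).
  apply: has_mean_mono_cvg hS _ _ mprod _.
  - by move=> n t; exact: prodr_ge0.
  - move=> t n m nm; apply: ler_prod => i _; rewrite phi0 /=; exact: phih.
  - by move=> t; apply: cvg_prod_in => i _; exact: phic.
apply: (cvg_unique _ h1) => //.
by apply: cvg_EFin; [near=> n|apply: cvg_prod_in => i _; exact: cs].
Unshelve. all: by end_near.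
Qed.

End Independence.

Section SignedIndependence.
Context d (T : measurableType d) (R : realType) (P : probability T R).
Variables (I : finType) (A : {set I}) (X : I -> T -> R) (f : I -> R -> R) (r : I -> R).
Hypotheses (indep : mutually_independent P A X) (mX : forall i, measurable_fun setT (X i)).
Hypotheses (mf : forall i, measurable_fun setT (f i)) (hr : forall i, has_mean P (f i \o X i) (r i)).

(** Every factor is split into positive and negative parts, and the product is expanded over the
    choices of a part. *)
Lemma indep_mean : has_mean P (fun t => \prod_(i in A) f i (X i t)) (\prod_(i in A) r i).
Proof.
pose h i (b : bool) x := Num.max (if b then f i x else - f i x) 0.
pose sgn (b : bool) : R := if b then 1 else -1.
have fE i x : f i x = \sum_(b : bool) sgn b * h i b x.
  rewrite big_bool /sgn /h /= mul1r mulN1r; case: (leP (f i x) 0); case: (leP (- f i x) 0); lra.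
have mh i b : measurable_fun setT (h i b).
  by case: b; apply: measurable_maxr => //; exact: measurableT_comp.
pose q i b := fine (\int[P]_t (h i b (X i t))%:E)%E.
have hq i b : has_mean P (h i b \o X i) (q i b).
  have [q' hq'] : exists q', has_mean P (h i b \o X i) q'.
    apply: has_mean_exists; apply: (le_integrable measurableT _ _ (hr i).1).
      by apply/measurable_EFinP; exact: measurableT_comp.
    move=> t _; rewrite /= lee_fin ger0_norm; last by rewrite /h le_max lexx orbT.
    rewrite /h ge_max normr_ge0 andbT; case: b; first exact: ler_norm.
    by rewrite -normrN ler_norm.
  by rewrite /q (hq'.2 : (\int[P]_t (h i b (X i t))%:E = q'%:E)%E).
have rE i : r i = \sum_(b : bool) sgn b * q i b.
  apply: has_mean_unique (hr i) _.
  apply: (@eq_has_mean _ _ _ _ (fun t => \sum_(b : bool) sgn b * h i b (X i t))).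
    by move=> t; rewrite /= fE.
  by apply: has_mean_sum => b _; apply: has_meanZ; exact: hq.
rewrite (eq_bigr _ (fun i _ => rE i)) (big_distr_big true).
apply: (@eq_has_mean _ _ _ _ (fun t => \sum_(g in pffun_on true (mem A) (fun _ : bool => true))
   (\prod_(i in A) sgn (g i)) * \prod_(i in A) h i (g i) (X i t))).
  move=> t; rewrite (eq_bigr _ (fun i _ => fE i (X i t))) (big_distr_big true) /=.
  by apply: eq_bigr => g _; rewrite -big_split.
apply: has_mean_sum => g _; rewrite big_split /=; apply: has_meanZ.
apply: (@indep_mean_ge0 _ _ _ _ _ _ _ (fun i => h i (g i)) indep mX) => // i x.
by rewrite /h le_max lexx orbT.
Qed.

End SignedIndependence.

Section SameDistribution.
Context d (T : measurableType d) (R : realType) (P : probability T R).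

Lemma same_mean (xi w : {RV P >-> R}) (f : R -> R) r : same_distribution P w xi ->
  measurable_fun setT f -> has_mean P (f \o xi) r -> has_mean P (f \o w) r.
Proof.
move=> same mf [h1 h2].
have mfE : measurable_fun setT (EFin \o f) by exact/measurable_EFinP.
have eqm (g : R -> \bar R) : (\int[distribution P w]_y g y = \int[distribution P xi]_y g y)%E.
  by apply: eq_measure_integral => B mB _; exact: same.
have int : P.-integrable setT (EFin \o (f \o w)).
  apply/integrableP; split; first by apply/measurable_EFinP; exact: measurableT_comp.
  have /integrableP[_] := h1.
  have mabs : measurable_fun setT (fun y => `|(f y)%:E|%E) by exact: measurableT_comp.
  have := @ge0_integral_distribution _ _ _ _ _ P xi _ mabs (fun y => abse_ge0 _).
  have := @ge0_integral_distribution _ _ _ _ _ P w _ mabs (fun y => abse_ge0 _).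
  by rewrite eqm => -> /= ->.
split=> //; rewrite -h2.
rewrite -(@integral_distribution _ _ _ _ _ P w _ mfE int) eqm.
exact: (@integral_distribution _ _ _ _ _ P xi _ mfE h1).
Qed.

End SameDistribution.

(** * Moments of a sub-Gaussian variable *)

Section Moments.
Context d (T : measurableType d) (R : realType) (P : probability T R) (xi : {RV P >-> R}).
Hypotheses (E0 : ('E_P[xi] = 0)%E) (V1 : ('V_P[xi] = 1)%E) (sub : subgaussian P xi).

(** With [y = |x| / sqrt m] one has [y ^ m <= exp (m y)], and [m y = sqrt m |x|]. *)
Lemma norm_expn_le_expR (m : nat) (x : R) : (0 < m)%N ->
  `|x ^+ m| <= Num.sqrt m%:R ^+ m * (expR (Num.sqrt m%:R * x) + expR (- Num.sqrt m%:R * x)).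
Proof.
move=> m0; set s := Num.sqrt _.
have s0 : 0 < s by rewrite sqrtr_gt0 ltr0n.
have ss : s * s = m%:R by rewrite -expr2 sqr_sqrtr ?ler0n.
have -> : `|x ^+ m| = s ^+ m * (`|x| / s) ^+ m.
  by rewrite normrX -exprMn [s * _]mulrC divfK // lt0r_neq0.
rewrite ler_wpM2l ?exprn_ge0 ?(ltW s0) //.
apply: (@le_trans _ _ (expR (`|x| / s) ^+ m)).
  rewrite lerXn2r ?nnegrE ?expR_ge0 ?divr_ge0 ?(ltW s0) //.
  by apply: le_trans (expR_ge1Dx _); rewrite lerDr.
rewrite -expRM_natl.
have -> : m%:R * (`|x| / s) = s * `|x| by rewrite -ss; field; rewrite lt0r_neq0.
have [x0|x0] := leP 0 x; first by rewrite ger0_norm // lerDl expR_ge0.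
by rewrite ltr0_norm // mulrN -mulNr lerDr expR_ge0.
Qed.

(** At the parameters [sqrt m] and [- sqrt m] the exponential bound is [exp (C0 m)], an [m]-th
    power, so only the factor [sqrt m ^ m] grows faster than geometrically. *)
Lemma subgaussian_moments : exists C mu, [/\ 0 < C,
  (forall m : nat, has_mean P (fun t => xi t ^+ m) (mu m)),
  mu 0%N = 1, mu 1%N = 0 & mu 2%N = 1 /\
  (forall m : nat, (0 < m)%N -> `|mu m| <= (C * Num.sqrt m%:R) ^+ m)].
Proof.
have [C0 hC] := sub.
have mxi : measurable_fun setT xi by [].
have G l : exists2 q, has_mean P (fun t => expR (l * xi t)) q & q <= expR (C0 * l ^+ 2).
  have := hC l; rewrite E0 /= unlock.
  under eq_integral => x _ do rewrite subr0.
  have mG : measurable_fun setT (fun t => expR (l * xi t)).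
    by apply: measurableT_comp => //; exact: measurable_funM.
  move=> h; have i0 : (0 <= \int[P]_x (expR (l * xi x))%:E)%E.
    by apply: integral_ge0 => x _; rewrite lee_fin expR_ge0.
  have fin : (\int[P]_x (expR (l * xi x))%:E)%E \is a fin_num.
    by rewrite ge0_fin_numE // (le_lt_trans h) // ltry.
  exists (fine (\int[P]_x (expR (l * xi x))%:E)%E).
    by apply: has_mean_ge0 => //; rewrite ?fineK // => t; exact: expR_ge0.
  by rewrite -lee_fin fineK.
have B (m : nat) : (0 < m)%N -> exists2 r, has_mean P (fun t => xi t ^+ m) r &
    `|r| <= (2 * expR C0 * Num.sqrt m%:R) ^+ m.
  move=> m0; set s := Num.sqrt _.
  have [q1 h1 b1] := G s; have [q2 h2 b2] := G (- s).
  have [r hr br] := has_mean_dominated (measurable_funX m mxi)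
     (fun t => norm_expn_le_expR (xi t) m0) (has_meanZ (s ^+ m) (has_meanD h1 h2)).
  exists r => //; apply: (le_trans br).
  have ss : s ^+ 2 = m%:R by rewrite sqr_sqrtr ?ler0n.
  have s0 : 0 <= s by rewrite sqrtr_ge0.
  rewrite sqrrN ss in b2; rewrite ss in b1.
  rewrite exprMn mulrC ler_wpM2r ?exprn_ge0 // exprMn -expRM_natr.
  apply: (@le_trans _ _ (2 * expR (C0 * m%:R))); first by lra.
  rewrite ler_wpM2r ?expR_ge0 // ler_eXnr // ler1n.
  by [].
pose mu (m : nat) := fine (\int[P]_t (xi t ^+ m)%:E)%E.
have hmu (m : nat) : has_mean P (fun t => xi t ^+ m) (mu m).
  have [->|m0] := posnP m.
    have h : has_mean P (fun t => xi t ^+ 0) 1 by exact: has_mean_cst.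
    by rewrite /mu h.2.
  by have [r hr _] := B m m0; rewrite /mu hr.2.
exists (2 * expR C0), mu; split => //.
- by rewrite mulr_gt0 ?expR_gt0.
- by apply: (has_mean_unique (hmu 0%N)); exact: has_mean_cst.
- apply: EFin_inj; rewrite -(hmu 1%N).2; transitivity (\int[P]_t (xi t)%:E)%E.
    by apply: eq_integral => t _; rewrite expr1.
  by have := E0; rewrite unlock.
split.
  apply: EFin_inj; rewrite -(hmu 2%N).2.
  transitivity (\int[P]_t ((xi t - 0) * (xi t - 0))%:E)%E.
    by apply: eq_integral => t _; rewrite subr0 expr2.
  by have := V1; rewrite /variance unlock E0 /= unlock.
by move=> m m0; have [r hr br] := B m m0; rewrite (has_mean_unique (hmu m) hr).
Qed.

End Moments.

(** * Wigner matrices with a variance profile *)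

Section WalkMeans.
Context d (T : measurableType d) (R : realType) (P : probability T R) (n : nat).
Local Notation E := ('I_n * 'I_n)%type.

Lemma has_mean_walks k (u v : 'I_n) (F : T -> seq E -> R) g :
  (forall l, has_mean P (F^~ l) (g l)) ->
  has_mean P (fun t => walks k u v (F t)) (walks k u v g).
Proof.
elim: k u F g => [|k IH] u F g h /=.
  by case: ifP => _; [exact: h | exact: has_mean_cst].
by apply: has_mean_sum => x _; apply: (IH x (fun t l => F t (edge u x :: l))) => l; exact: h.
Qed.

Lemma has_mean_saw k (u : 'I_n) U (F : T -> 'I_n -> seq E -> R) g :
  (forall v l, has_mean P (fun t => F t v l) (g v l)) ->
  has_mean P (fun t => saw k u U (F t)) (saw k u U g).
Proof.
elim: k u U F g => [|k IH] u U F g h /=; first exact: h.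
by apply: has_mean_sum => x _; apply: (IH x _ (fun t v l => F t v (edge u x :: l))) => v l; exact: h.
Qed.

Lemma has_mean_Lf th K (F : T -> seq E -> R) g :
  (forall l, has_mean P (F^~ l) (g l)) ->
  has_mean P (fun t => Lf th K (F t)) (Lf th K g).
Proof.
move=> h; apply: has_mean_sum => i _; apply: has_mean_sum => k _; apply: has_mean_sum => k' _.
apply: (has_mean_saw _ _ _ (F := fun t v l => saw k' i [::] (fun v' l' =>
    F t (edge v v' :: l ++ l') - th * ((v == v')%:R * F t (l ++ l'))))) => v l.
apply: (has_mean_saw _ _ _ (F := fun t v' l' =>
    F t (edge v v' :: l ++ l') - th * ((v == v')%:R * F t (l ++ l')))) => v' l'.
by apply: has_meanB; [exact: h | do 2! apply: has_meanZ; exact: h].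
Qed.

Variables (w : E -> T -> R) (sg : E -> R) (mu : nat -> R).
Hypotheses (mu0 : mu 0%N = 1)
  (hw : forall e (m : nat), has_mean P (fun t => w e t ^+ m) (mu m))
  (indep : mutually_independent P [set e : E | (e.1 <= e.2)%N]%SET w)
  (sg_upper : forall e : E, (e.2 < e.1)%N -> sg e = 0).
Local Notation X t := (fun e => sg e * w e t).
Local Notation Xw t l := (\prod_(e <- l) (sg e * w e t)).

Lemma mean_word l : has_mean P (fun t => Xw t l) (mom mu sg l).
Proof.
have mw e : measurable_fun setT (w e).
  by have := has_mean_measurable (hw e 1%N); under eq_fun do rewrite expr1.
case: (boolP (all (fun e : E => (e.1 <= e.2)%N) l)) => [/allP al|/allPn[e el]]; last first.
  rewrite -ltnNge => /sg_upper se.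
  have c0 : (count_mem e l == 0%N) = false by apply/negbTE; rewrite -lt0n -has_count has_pred1.
  have -> : mom mu sg l = 0 by rewrite /mom (bigD1 e) //= se expr0n c0 mulr0 mul0r.
  apply: eq_has_mean (has_mean_cst P 0) => t.
  by rewrite prod_count (bigD1 e) //= se mul0r expr0n c0 mul0r.
have c0 (e : E) : e \notin [set e : E | (e.1 <= e.2)%N]%SET -> count_mem e l = 0%N.
  by rewrite inE => he; apply/count_memPn; apply: contra he; exact: al.
pose A := [set e : E | (e.1 <= e.2)%N]%SET.
have -> : mom mu sg l = (\prod_(e : E) sg e ^+ count_mem e l) * \prod_(e in A) mu (count_mem e l).
  rewrite /mom big_split mulrC; congr (_ * _); rewrite (bigID (mem A)) /= [Z in _ * Z]big1 ?mulr1 //.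
  by move=> e he; rewrite c0.
apply: (@eq_has_mean _ _ _ _ (fun t => (\prod_(e : E) sg e ^+ count_mem e l) *
   \prod_(e in A) (w e t) ^+ count_mem e l)).
  move=> t; rewrite [RHS]prod_count; under [RHS]eq_bigr do rewrite exprMn.
  rewrite big_split; congr (_ * _); rewrite [RHS](bigID (mem A)) /= [Z in _ = _ * Z]big1 ?mulr1 //.
  by move=> e he; rewrite c0.
apply: has_meanZ.
apply: (@indep_mean _ _ _ _ _ A w (fun e x => x ^+ count_mem e l)) => // e.
by first [exact: hw | apply: measurable_funX; exact: measurable_id].
Qed.

Lemma mean_trace k : has_mean P (fun t => \tr (emx (X t) ^+ k)) (tmom mu sg k).
Proof.
apply: (@eq_has_mean _ _ _ _ (fun t => \sum_v walks k v v (fun l => Xw t l))).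
  by move=> t; rewrite emx_trace.
apply: has_mean_sum => v _; apply: (has_mean_walks _ _ _ (F := fun t l => Xw t l)) => l.
exact: mean_word.
Qed.

Lemma mean_cen ls acc :
  has_mean P (fun t => Xw t acc * \prod_(l <- ls) (Xw t l - mom mu sg l)) (cen mu sg ls acc).
Proof.
elim: ls acc => [|l ls IH] acc /=.
  by apply: eq_has_mean (mean_word acc) => t; rewrite big_nil mulr1.
have := has_meanB (IH (l ++ acc)) (has_meanZ (mom mu sg l) (IH acc)).
by apply: eq_has_mean => t; rewrite big_cons big_cat /=; ring.
Qed.

(** By linearity the fourth power is four nested copies of the functional, so the expectation is
    taken on each quadruple of lists. *)
Lemma mean_Lf4 th K : has_mean P
  (fun t => (Lf th K (fun l => Xw t l) - Lf th K (mom mu sg)) ^+ 4)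
  (Lf th K (fun l1 => Lf th K (fun l2 => Lf th K (fun l3 => Lf th K (fun l4 =>
    cen mu sg [:: l1; l2; l3; l4] [::]))))).
Proof.
pose F t l := Xw t l - mom mu sg l.
apply: (@eq_has_mean _ _ _ _ (fun t => Lf th K (fun l1 => Lf th K (fun l2 => Lf th K (fun l3 =>
  Lf th K (fun l4 => F t l1 * (F t l2 * (F t l3 * F t l4)))))))).
  move=> t; rewrite -LfB -/(F t); set L := Lf th K (F t).
  have e4 l1 l2 l3 : Lf th K (fun l4 => F t l1 * (F t l2 * (F t l3 * F t l4))) =
      F t l1 * F t l2 * L * F t l3.
    by rewrite !LfM -/L; ring.
  have e3 l1 l2 : Lf th K (fun l3 => F t l1 * F t l2 * L * F t l3) = F t l1 * L ^+ 2 * F t l2.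
    by rewrite LfM -/L; ring.
  have e2 l1 : Lf th K (fun l2 => F t l1 * L ^+ 2 * F t l2) = L ^+ 3 * F t l1.
    by rewrite LfM -/L; ring.
  transitivity (Lf th K (fun l1 => L ^+ 3 * F t l1)); last by rewrite LfM -/L -exprSr.
  apply: eq_Lf => l1; rewrite -e2; apply: eq_Lf => l2; rewrite -e3; apply: eq_Lf => l3.
  by rewrite e4.
apply: (has_mean_Lf _ _ (F := fun t l1 => Lf th K (fun l2 => Lf th K (fun l3 =>
  Lf th K (fun l4 => F t l1 * (F t l2 * (F t l3 * F t l4))))))) => l1.
apply: (has_mean_Lf _ _ (F := fun t l2 => Lf th K (fun l3 =>
  Lf th K (fun l4 => F t l1 * (F t l2 * (F t l3 * F t l4)))))) => l2.
apply: (has_mean_Lf _ _ (F := fun t l3 =>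
  Lf th K (fun l4 => F t l1 * (F t l2 * (F t l3 * F t l4))))) => l3.
apply: (has_mean_Lf _ _ (F := fun t l4 => F t l1 * (F t l2 * (F t l3 * F t l4)))) => l4.
apply: eq_has_mean (mean_cen [:: l1; l2; l3; l4] [::]) => t.
by rewrite big_nil mul1r !big_cons big_nil mulr1.
Qed.

End WalkMeans.

Section SpectralNorm.
Variables (R : realType) (n : nat).
Hypothesis n0 : (0 < n)%N.
Implicit Types (A : 'M[R]_n) (v : 'cV[R]_n).

Let S A := [set euclid_norm (A *m v) | v in [set v : 'cV[R]_n | euclid_norm v = 1]].

Lemma spectral_norm_le A a : (forall v, nrm v = 1 -> nrm (A *m v) <= a) -> spectral_norm A <= a.
Proof.
move=> h; apply: ge_sup; last by move=> _ [v v1 <-]; exact: h.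
exists (euclid_norm (A *m delta_mx (Ordinal n0) ord0)), (delta_mx (Ordinal n0) ord0) => //=.
rewrite /euclid_norm (bigD1 (Ordinal n0)) //= mxE !eqxx expr1n big1 ?addr0 ?sqrtr1 //.
by move=> i /negPf ni; rewrite mxE ni expr0n.
Qed.

Lemma has_ubound_spectral A : has_ubound (S A).
Proof.
exists (Num.sqrt (\sum_i \sum_j A i j ^+ 2)) => _ [v v1 <-].
have v2 : nrm2 v = 1 by rewrite -sqr_nrm (v1 : nrm v = 1) expr1n.
by apply: ler_wsqrtr; have := nrm2_frob A v; rewrite v2 mulr1.
Qed.

Lemma nrm_mul_le_spectral A v : nrm (A *m v) <= spectral_norm A * nrm v.
Proof.
have [v0|v0] := eqVneq (nrm v) 0.
  have -> : v = 0.
    have h : nrm2 v = 0 by rewrite -sqr_nrm v0 expr0n.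
    apply/matrixP => i j; rewrite [j]ord1 mxE; apply/eqP; rewrite -sqrf_eq0; apply/eqP.
    by apply: (psumr_eq0P _ h) => // k _; exact: sqr_ge0.
  by rewrite mulmx0 nrm0 mulr0.
have vp : 0 < nrm v by rewrite lt_neqAle eq_sym v0 nrm_ge0.
have v1 : nrm ((nrm v)^-1 *: v) = 1.
  by rewrite nrmZ ger0_norm ?invr_ge0 ?nrm_ge0 // mulVf.
have := ub_le_sup (has_ubound_spectral A).
move=> /(_ (nrm (A *m ((nrm v)^-1 *: v)))) h.
rewrite -ler_pdivrMr // mulrC.
have <- : nrm (A *m ((nrm v)^-1 *: v)) = (nrm v)^-1 * nrm (A *m v).
  by rewrite -scalemxAr nrmZ ger0_norm // invr_ge0 nrm_ge0.
by apply: h; exists ((nrm v)^-1 *: v).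
Qed.

End SpectralNorm.

(** * Almost sure statements from summable probabilities *)

Section BorelCantelli.
Context d (T : measurableType d) (R : realType) (P : probability T R).

Lemma sqr_summable_ae (Q : nat -> T -> Prop) (c : R) (N : nat) : 0 <= c ->
  (forall n, (N < n)%N -> exists F, [/\ measurable F, (P F <= (c / n%:R ^+ 2)%:E)%E &
     forall t, ~ F t -> Q n t]) ->
  {ae P, forall t, exists M, forall n, (M <= n)%N -> Q n t}.
Proof.
move=> c0 h.
(* A telescoping majorant of [c / n^2], since [(n + 1) (n + 2) <= 6 n^2] for [n >= 1]. *)
pose a (n : nat) : R := 6 * c * ((n.+1)%:R^-1 - (n.+2)%:R^-1).
have /boolp.choice[F hF] : forall n, exists F : set T,
    [/\ measurable F, (P F <= (a n)%:E)%E & (N < n)%N -> forall t, ~ F t -> Q n t].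
  move=> n; have aE : a n = 6 * c / (n.+1%:R * n.+2%:R).
    have h1 : (n.+1%:R : R) != 0 by rewrite pnatr_eq0.
    have h2 : (n.+2%:R : R) != 0 by rewrite pnatr_eq0.
    move: h1 h2; rewrite /a -[n.+2%:R]natr1; move: (n.+1%:R) => x h1 h2.
    by field; rewrite h1 h2.
  have [Nn|nN] := ltnP N n; last first.
    exists set0; split=> //; rewrite measure0 lee_fin aE.
    by rewrite mulr_ge0 ?invr_ge0 ?mulr_ge0 ?ler0n.
  have [F [mF PF FQ]] := h n Nn; exists F; split=> //; apply: (le_trans PF).
  have n1 : (1 <= n)%N by apply: leq_ltn_trans Nn.
  have np : (0 : R) < n%:R by rewrite ltr0n.
  rewrite lee_fin aE ler_pdivrMr ?exprn_gt0 // mulrAC ler_pdivlMr ?mulr_gt0 ?ltr0n //.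
  rewrite [6 * c]mulrC -mulrA ler_wpM2l // -!natrX -!natrM ler_nat.
  by clear -n1; nia.
apply: (@negligibleS _ _ _ P (lim_sup_set F)); last first.
  apply/negligibleP.
    apply: bigcap_measurable => // k _; apply: bigcup_measurable => j _.
    by have [] := hF j.
  apply: lim_sup_set_cvg0 => [k|]; first by have [] := hF k.
  apply: (@le_lt_trans _ _ (6 * c)%:E); last exact: ltry.
  apply: lime_le; first by apply: is_cvg_nneseries => n _ _; exact: measure_ge0.
  have Sm (m : nat) : (\sum_(0 <= i < m) P (F i) <= (6 * c * (1 - (m.+1)%:R^-1))%:E)%E.
    elim: m => [|m IH]; first by rewrite big_geq // invr1 subrr mulr0.
    rewrite big_nat_recr //=; have [_ Pm _] := hF m.
    apply: (le_trans (leeD IH Pm)); rewrite -EFinD lee_fin /a.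
    by rewrite -mulrDr addrA subrK.
  near=> m; apply: (le_trans (Sm m)).
  by rewrite lee_fin ler_piMr ?mulr_ge0 // lerBlDr lerDl invr_ge0 ler0n.
move=> t /= nt k _; apply: contrapT => hk; apply: nt.
exists (maxn k N.+1) => n; rewrite geq_max => /andP[kn Nn].
have [_ _] := hF n; apply => // Ft; apply: hk; exists n => //.
Unshelve. all: by end_near.
Qed.

End BorelCantelli.

(** * Deviation events and almost sure convergence *)

Section Wigner.
Context (d : measure_display) (T : measurableType d) (R : realType)
  (P : probability T R) (xi : {RV P >-> R})
  (w : forall n : nat, 'I_n -> 'I_n -> {RV P >-> R}) (sigma : forall n : nat, 'M[R]_n).
Hypotheses (w_sym : forall n (i j : 'I_n), w i j = w j i :> (T -> R))
  (indep : forall n, mutually_independent P [set ij : 'I_n * 'I_n | (ij.1 <= ij.2)%N]%SET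
               (fun ij => w ij.1 ij.2 : T -> R))
  (same : forall n (i j : 'I_n), same_distribution P (w i j) xi)
  (sigma_sym : forall n, (sigma n)^T = sigma n)
  (sigma0 : forall n (i j : 'I_n), 0 <= sigma n i j)
  (sigma1 : forall n (i : 'I_n), \sum_(j < n) sigma n i j ^+ 2 = 1)
  (sigma_small : (fun n => max_entry (sigma n) * Num.sqrt (ln n%:R)) @ \oo --> (0 : R)).
Variables (C : R) (mu : nat -> R).
Hypotheses (C0 : 0 < C) (xi_mean : forall m : nat, has_mean P (fun t => xi t ^+ m) (mu m))
  (mu0 : mu 0%N = 1) (mu1 : mu 1%N = 0) (mu2 : mu 2%N = 1)
  (mu_bound : forall m : nat, (0 < m)%N -> `|mu m| <= (C * Num.sqrt m%:R) ^+ m).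

(* Vanishing below the diagonal makes the moment formula [mean_word] valid for
   every list of pairs, not only for lists of edges. *)
Let sg n (e : 'I_n * 'I_n) : R := if (e.1 <= e.2)%N then sigma n e.1 e.2 else 0.
Let ww n (e : 'I_n * 'I_n) : T -> R := w e.1 e.2.
Let H n t := hadamard (sigma n) (\matrix_(i, j) w i j t).

Lemma sigma_symE n (i j : 'I_n) : sigma n i j = sigma n j i.
Proof. by rewrite -[in LHS](sigma_sym n) mxE. Qed.

Lemma sg_edge n (u v : 'I_n) : sg (edge u v) = sigma n u v.
Proof. by rewrite /sg edge_le /edge; case: ifP => _ //=; rewrite sigma_symE. Qed.

Lemma hadamard_emx n t : H n t = emx (fun e => sg e * ww e t).
Proof.
apply/matrixP => i j; rewrite !mxE sg_edge; congr (_ * _).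
by rewrite /ww /edge; case: ifP => _ //=; rewrite w_sym.
Qed.

Lemma sg_ge0 n (e : 'I_n * 'I_n) : 0 <= sg e.
Proof. by rewrite /sg; case: ifP. Qed.

Lemma sg_row n (u : 'I_n) : \sum_x sg (edge u x) ^+ 2 = 1.
Proof. by rewrite -[RHS](sigma1 u); apply: eq_bigr => x _; rewrite sg_edge. Qed.

Lemma sg_le1 n (e : 'I_n * 'I_n) : sg e <= 1.
Proof.
rewrite /sg; case: ifP => // _; rewrite -(@ler_pXn2r _ 2) ?nnegrE // expr1n.
rewrite -[leRHS](sigma1 e.1) (bigD1 e.2) //= lerDl; apply: sumr_ge0 => j _; exact: sqr_ge0.
Qed.

Lemma max_entry_ge0 n : 0 <= max_entry (sigma n).
Proof. exact: bigmax_ge_id. Qed.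

Lemma sg_sqr_le n (e : 'I_n * 'I_n) : sg e ^+ 2 <= max_entry (sigma n) ^+ 2.
Proof.
rewrite lerXn2r ?nnegrE ?sg_ge0 ?max_entry_ge0 // /sg; case: ifP => _; last exact: max_entry_ge0.
exact: (le_bigmax _ (fun ij : 'I_n * 'I_n => sigma n ij.1 ij.2)).
Qed.

Lemma ww_mean n (e : 'I_n * 'I_n) (m : nat) : has_mean P (fun t => ww e t ^+ m) (mu m).
Proof.
apply: (@same_mean _ _ _ _ xi (w e.1 e.2) (fun x => x ^+ m)); [exact: same| |exact: xi_mean].
by apply: measurable_funX; exact: measurable_id.
Qed.

Lemma sg_upper n (e : 'I_n * 'I_n) : (e.2 < e.1)%N -> sg e = 0.
Proof. by rewrite /sg ltnNge => /negPf ->. Qed.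

Lemma max_entry_small (de : R) : 0 < de -> exists N : nat, forall n : nat, (N < n)%N ->
  max_entry (sigma n) ^+ 2 * ln n%:R <= de /\ 1 <= ln (n%:R : R).
Proof.
(* The minimum with 1 gives [z ^+ 2 <= z <= de] for the small quantity [z]. *)
move=> de0; have /cvgrPdist_le/(_ (Num.min 1 de)) := sigma_small.
rewrite lt_min ltr01 de0 => /(_ isT) [N _ hN].
exists (maxn N (Num.bound (expR 1 : R))) => n; rewrite gtn_max => /andP[Nn en].
have e0 : 0 < expR 1 :> R by exact: expR_gt0.
have n1 : expR 1 <= n%:R :> R.
  apply: (le_trans (ltW (archi_boundP (ltW e0)))); rewrite ler_nat; exact: ltnW.
have l1 : 1 <= ln (n%:R : R) by rewrite -[leLHS]expRK ler_ln ?posrE // (lt_le_trans e0).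
split=> //.
have := hN n (ltnW Nn); rewrite /= sub0r normrN ger0_norm; last first.
  by rewrite mulr_ge0 ?sqrtr_ge0 ?max_entry_ge0.
have -> : max_entry (sigma n) ^+ 2 * ln n%:R = (max_entry (sigma n) * Num.sqrt (ln n%:R)) ^+ 2.
  by rewrite exprMn sqr_sqrtr // (le_trans ler01).
have : 0 <= max_entry (sigma n) * Num.sqrt (ln n%:R) by rewrite mulr_ge0 ?sqrtr_ge0 ?max_entry_ge0.
move: (_ * Num.sqrt _) => z z0; rewrite le_min => /andP[z1 zd].
by apply: le_trans zd; rewrite expr2 ler_piMr.
Qed.

Lemma trace_exponent (ka L : R) : 0 < ka -> 1 <= L -> exists l : nat,
  ka * L <= (2 ^ l.+1)%N%:R /\ (2 ^ l.+1)%N%:R <= 4 * (ka + 1) * L.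
Proof.
move=> ka0 L1; have y0 : 0 <= ka * L by rewrite mulr_ge0 ?(ltW ka0) // (le_trans ler01).
pose m := (Num.truncn (ka * L)).+1; exists (up_log 2 m).
have /andP[m1 m2] := truncn_itv y0.
have h1 : (m <= 2 ^ up_log 2 m)%N by exact: up_logP.
have h2 : (2 ^ (up_log 2 m).+1 <= 4 * m)%N.
  have [m_gt1|m_le1] := ltnP 1 m; last first.
    have -> : m = 1%N by apply/eqP; rewrite eqn_leq m_le1.
    by rewrite up_log1.
  have /andP[h3 _] := up_log_bounds (isT : (1 < 2)%N) m_gt1.
  have : (0 < up_log 2 m)%N by rewrite up_log_gt0.
  move: h3; case: (up_log 2 m) => // k; rewrite /= !expnS; clear; lia.
split.
  apply: (le_trans (ltW m2)); rewrite ler_nat expnS; move: h1; clear; lia.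
apply: (@le_trans _ _ (4 * m)%:R); first by rewrite ler_nat.
rewrite natrM /m -[(Num.truncn _).+1%:R]natr1 -mulrA ler_wpM2l ?ler0n // mulrDl mul1r; exact: lerD.
Qed.

Lemma upper_event (ep : R) : 0 < ep -> ep <= 1 -> exists N : nat, forall n, (N < n)%N ->
  exists F, [/\ measurable F, (P F <= (4 / n%:R ^+ 2)%:E)%E &
    forall t, ~ F t -> spectral_norm (H n t) <= 2 + ep].
Proof.
move=> ep0 ep1.
have [c c0 hc] := @tmom_upper R C (ep / 2) C0 ltac:(lra) ltac:(lra).
pose q : R := (2 + ep / 2) / (2 + ep).
have q0 : 0 < q by rewrite divr_gt0 //; lra.
have q1 : q < 1 by rewrite ltr_pdivrMr; lra.
have lq : ln q < 0 by rewrite ln_lt0 // q0.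
(* Gives [q ^ p <= n ^ -6] as soon as [p >= ka * ln n]; with the [n ^ 4] of the trace bound,
   [n ^ -2] is left. *)
pose ka : R := 6 / (- ln q).
have ka0 : 0 < ka by rewrite divr_gt0 // oppr_gt0.
have [N hN] := @max_entry_small (c / (4 * (ka + 1))) ltac:(rewrite divr_gt0 // mulr_gt0 //; lra).
exists N => n Nn; have [sm L1] := hN n Nn.
have n0 : (0 < n)%N by apply: leq_ltn_trans Nn.
have np : 0 < n%:R :> R by rewrite ltr0n.
have [l [Pl Pu]] := trace_exponent ka0 L1.
set L := ln _ in sm L1 Pl Pu; set p := (2 ^ l.+1)%N in Pl Pu.
have a0 : 0 < 2 + ep by lra.
have hT := mean_trace mu0 (@ww_mean n) (@indep n) (@sg_upper n) p.
have sym t : (emx (fun e => sg e * ww e t))^T = emx (fun e => sg (n := n) e * ww e t) by exact: emx_sym.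
have [mF PF] := has_mean_markov hT (fun t => trace_pow_ge0 l (sym t)) (exprn_gt0 p a0).
exists [set t | (2 + ep) ^+ p <= \tr (emx (fun e => sg (n := n) e * ww e t) ^+ p)]; split => //.
  apply: (le_trans PF); rewrite lee_fin ler_pdivrMr ?exprn_gt0 //.
  have := hc n (@sg n) mu l p erefl (@sg_ge0 n).
  move=> /(_ (fun u => ltac:(by rewrite sg_row))) h.
  apply: (le_trans (h _ mu0 mu1 mu2 _)).
  - move=> e; apply: (@le_trans _ _ (4 * (ka + 1) * L * max_entry (sigma n) ^+ 2)).
      by apply: ler_pM; rewrite ?ler0n ?sqr_ge0 ?sg_sqr_le.
    have k4 : 0 < 4 * (ka + 1) by rewrite mulr_gt0 //; lra.
    by move: sm; rewrite ler_pdivlMr // mulrC -mulrA [L * _]mulrC.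
  - by move=> m m3; apply: mu_bound; apply: leq_trans m3.
  have qp : q ^+ p <= n%:R ^- 6.
    have -> : n%:R ^- 6 = expR (- (6 * L)) :> R.
      by rewrite expRN expRM_natl /L lnK // posrE.
    rewrite -[q]lnK ?posrE // -expRM_natr ler_expR mulrC.
    have h6 : ka * L * ln q = - (6 * L).
      by rewrite /ka; field; rewrite lt_eqF.
    by rewrite -h6 ler_wnM2r // ltW.
  have -> : (2 + ep / 2) ^+ p = q ^+ p * (2 + ep) ^+ p.
    by rewrite -exprMn /q divfK // lt0r_neq0.
  rewrite mulrA ler_wpM2r ?exprn_ge0 ?(ltW a0) //.
  have -> : 4 / n%:R ^+ 2 = 4 * n%:R ^+ 4 * n%:R ^- 6 :> R.
    by field; rewrite lt0r_neq0.
  by rewrite ler_wpM2l // mulr_ge0 ?exprn_ge0 ?ler0n.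
move=> t /= /negP; rewrite -ltNge => tr; rewrite hadamard_emx; apply: spectral_norm_le => // v v1.
have := nrm_pow_le_trace l (sym t) v1; rewrite -/p => h.
rewrite -(@ler_pXn2r _ p) ?nnegrE ?nrm_ge0 ?(ltW a0) ?expn_gt0 //.
exact: (le_trans h (ltW tr)).
Qed.

Lemma lower_event (ep : R) : 0 < ep -> ep <= 1 -> exists (c : R) (N : nat), 0 <= c /\
  forall n, (N < n)%N ->
  exists F, [/\ measurable F, (P F <= (c / n%:R ^+ 2)%:E)%E &
    forall t, ~ F t -> 2 - ep <= spectral_norm (H n t)].
Proof.
move=> ep0 ep1; pose th : R := 2 - ep.
have th0 : 0 <= th by rewrite /th; lra.
(* From [ep K >= 4] one gets [2 K - (2 - ep) (K + 1) >= 2], of which the loss of mass takes at most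
   1 by the choice of [N]. *)
pose K := (Num.truncn (4 / ep)).+1.
have K1 : 4 / ep < K%:R by have /andP[] := truncn_itv (divr_ge0 (ler0n R 4) (ltW ep0)).
have epK : 4 <= ep * K%:R by move: K1; rewrite ltr_pdivrMr // mulrC => /ltW.
pose Lm := (2 * K + 2)%N.
(* One bound for the finitely many moments involved: four closed walks have at most [4 * Lm] edges
   in all. *)
pose b : R := 1 + \sum_(m < (4 * Lm).+1) `|mu m|.
have b1 : 1 <= b by rewrite lerDl sumr_ge0.
have mub (m : nat) : (m <= 4 * Lm)%N -> `|mu m| <= b.
  rewrite -ltnS => hm; rewrite /b (bigD1 (Ordinal hm)) //= addrCA lerDl addr_ge0 //.
  exact: sumr_ge0.
have Kp : 0 < K%:R :> R by rewrite ltr0n.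
have [N hN] := @max_entry_small (2 * K%:R * (K * K)%:R)^-1
  ltac:(by rewrite invr_gt0 !mulr_gt0 ?ltr0n).
pose c := `|fourth_cst th K b|.
exists c, N; split => [|n Nn]; first exact: normr_ge0.
have n0 : (0 < n)%N by apply: leq_ltn_trans Nn.
have np : 0 < n%:R :> R by rewrite ltr0n.
have [sm L1] := hN n Nn.
set ss := max_entry (sigma n) ^+ 2 in sm.
have ss0 : 0 <= ss by exact: sqr_ge0.
have ssK : 2 * K%:R * ((K * K)%:R * ss) <= 1.
  have k0 : 0 < 2 * K%:R * (K * K)%:R :> R by rewrite !mulr_gt0 ?ltr0n.
  rewrite mulrA mulrC -ler_pdivlMr // mul1r; apply: le_trans sm.
  by rewrite ler_peMr.
have low := Lf_mom K th0 mu0 mu1 mu2 (@sg_row n) (@sg_sqr_le n).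
have low2 : n%:R <= Lf th K (mom mu (@sg n)).
  apply: le_trans low; rewrite -[leLHS]mulr1 ler_wpM2l ?ler0n //.
  rewrite -[K.+1%:R]natr1 /th -/ss; move: ssK epK; move: ((K * K)%:R * ss) => z.
  by move: (K%:R) => k; lra.
have h4 := mean_Lf4 mu0 (@ww_mean n) (@indep n) (@sg_upper n) th K.
have n4 : 0 < n%:R ^+ 4 :> R by exact: exprn_gt0.
have pos4 (x : R) : 0 <= x ^+ 4 by rewrite -[4%N]/(2 * 2)%N exprM sqr_ge0.
have [mF PF] := has_mean_markov h4 (fun t => pos4 _) n4.
exists [set t | n%:R ^+ 4 <= (Lf th K (fun l => \prod_(e <- l) (sg (n := n) e * ww e t)) -
   Lf th K (mom mu (@sg n))) ^+ 4]; split => //.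
  apply: (le_trans PF); rewrite lee_fin ler_pdivrMr //.
  have := @Lf_fourth R n th K th0 mu (@sg n) b mu0 mu1 b1 mub (@sg_ge0 n) (@sg_le1 n)
     (fun u => ltac:(by rewrite sg_row)).
  move=> h; apply: (le_trans h).
  have -> : c / n%:R ^+ 2 * n%:R ^+ 4 = c * n%:R ^+ 2 by field; rewrite lt0r_neq0.
  by rewrite ler_wpM2r ?exprn_ge0 ?ler0n // ler_norm.
move=> t /= nF; rewrite leNgt; apply/negP => sp; apply: nF.
have L0 : Lf th K (fun l => \prod_(e <- l) (sg (n := n) e * ww e t)) <= 0.
  apply: (Lf_le0 K th0 (a := fun e => sg (n := n) e * ww e t)) => v.
  rewrite -hadamard_emx; apply: (le_trans (nrm_mul_le_spectral _ _)).
  by rewrite ler_wpM2r ?nrm_ge0 // ltW.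
have key (x y : R) : x <= 0 -> n%:R <= y -> n%:R ^+ 4 <= (x - y) ^+ 4.
  move=> x0 yn; have nyx : n%:R <= y - x by lra.
  have -> : (x - y) ^+ 4 = (y - x) ^+ 4 by ring.
  by rewrite lerXn2r ?nnegrE ?ler0n // (le_trans (ler0n R n)).
exact: key L0 low2.
Qed.

Lemma spectral_norm_cvg : {ae P, forall t, (fun n => spectral_norm (H n t)) @ \oo --> (2 : R)}.
Proof.
have ej0 (j : nat) : 0 < (j.+1%:R : R)^-1 by rewrite invr_gt0 ltr0n.
have ej1 (j : nat) : (j.+1%:R : R)^-1 <= 1 by rewrite invf_le1 ?ltr0n // ler1n.
have U : {ae P, forall t, forall j : nat, exists M, forall n, (M <= n)%N ->
    spectral_norm (H n t) <= 2 + (j.+1%:R)^-1}.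
  apply: ae_foralln => j; have [N hN] := upper_event (ej0 j) (ej1 j).
  exact: (sqr_summable_ae _ hN).
have L : {ae P, forall t, forall j : nat, exists M, forall n, (M <= n)%N ->
    2 - (j.+1%:R)^-1 <= spectral_norm (H n t)}.
  apply: ae_foralln => j; have [c [N [c0 hN]]] := lower_event (ej0 j) (ej1 j).
  exact: (sqr_summable_ae c0 hN).
apply: filterS2 U L => t U L.
apply/cvgrPdist_le => e e0.
have [j je] : exists j : nat, (j.+1%:R : R)^-1 <= e.
  exists (Num.bound e^-1); rewrite invf_ple ?posrE ?ltr0n //.
  apply: (le_trans (ltW (archi_boundP (ltW _)))); first by rewrite invr_gt0.
  by rewrite ler_nat.
have [M1 h1] := U j; have [M2 h2] := L j.
exists (maxn M1 M2) => // n /=; rewrite geq_max => /andP[n1 n2].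
move: (h1 n n1) (h2 n n2) je; move: (spectral_norm _) (_^-1) => x z h3 h4 h5.
by rewrite ler_norml; apply/andP; split; lra.
Qed.

End Wigner.

Theorem theorem1p2 (d : measure_display) (T : measurableType d) (R : realType)
  (P : probability T R) (xi : {RV P >-> R})
  (w : forall n : nat, 'I_n -> 'I_n -> {RV P >-> R})
  (sigma : forall n : nat, 'M[R]_n) :
  ('E_P[xi] = 0)%E ->
  ('V_P[xi] = 1)%E ->
  subgaussian P xi ->
  (forall n (i j : 'I_n), w n i j = w n j i :> (T -> R)) ->
  (forall n, mutually_independent P [set ij : 'I_n * 'I_n | (ij.1 <= ij.2)%N]
               (fun ij => w n ij.1 ij.2 : T -> R)) ->
  (forall n (i j : 'I_n), same_distribution P (w n i j) xi) ->
  (forall n, (sigma n)^T = sigma n) ->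
  (forall n (i j : 'I_n), 0 <= sigma n i j) ->
  (forall n (i : 'I_n), \sum_(j < n) sigma n i j ^+ 2 = 1) ->
  (fun n => max_entry (sigma n) * Num.sqrt (ln n%:R)) @ \oo --> (0 : R) ->
  {ae P, forall omega,
     (fun n => spectral_norm (hadamard (sigma n) (\matrix_(i, j) w n i j omega)))
       @ \oo --> (2 : R)}.
Proof.
move=> E0 V1 sub w_sym indep same s_sym s0 s1 small.
have [C [mu [C0 xm m0 m1 [m2 mb]]]] := subgaussian_moments E0 V1 sub.
exact: (spectral_norm_cvg w_sym indep same s_sym s0 s1 small C0 xm m0 m1 m2 mb).
Qed.
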